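(* Let $\mathbb F$ be an algebraically closed field and $\mathcal C$ a spherical $\mathbb F$-linear semisimple tensor category with $\mathrm{End}(\mathbf 1)\cong\mathbb F$, finitely many isomorphism classes of simple objects and $\dim\mathcal C\ne0$. Consider the state-sum (triangulation) TQFT in $2+1$ dimensions associated with $\mathcal C$. Then the dimension of the vector space $\mathcal H_{S^1\times S^1}$ associated to the two dimensional torus equals the number $\#\mathcal Z_1(\mathcal C)$ of isomorphism classes of simple objects of $\mathcal Z_1(\mathcal C)$.
   Context: Tensor categories are taken strict, Hom-spaces finite dimensional. Semisimple: finite direct sums, split idempotents, every object a finite direct sum of simple objects ($\mathrm{End}(X)\cong\mathbb F$). Spherical: strict pivotal with duals $\overline X$, $\overline{\overline X}=X$, duality morphisms $\varepsilon(X):\mathbf 1\to X\overline X$, $\overline\varepsilon(X):X\overline X\to\mathbf 1$, and equal left and right traces; $d(X)=\overline\varepsilon(X)\varepsilon(X)$. $\{X_i\}_{i\in\Gamma}$ are representatives of simple classes, $\dim\mathcal C=\sum_id(X_i)^2$. Center $\mathcal Z_1(\mathcal C)$: objects $(X,e_X)$ with $e_X(Y):XY\to YX$ isomorphisms natural in $Y$, $e_X(YZ)=(\mathrm{id}_Y\otimes e_X(Z))(e_X(Y)\otimes\mathrm{id}_Z)$, $e_X(\mathbf 1)=\mathrm{id}_X$; morphisms $t\in\mathrm{Hom}_{\mathcal C}(X,Y)$ with $(\mathrm{id}_Z\otimes t)e_X(Z)=e_Y(Z)(t\otimes\mathrm{id}_Z)$ for all $Z$. State-sum TQFT (Turaev–Viro–Barrett–Westbury/Gelfand–Kazhdan).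 Given a triangulation with a chosen orientation of every edge, a labelling $\ell$ assigns to each edge an element of $\Gamma$; the oriented edge $e$ carries the object $X_{\ell(e)}$ and the reversed edge the object $\overline{X_{\ell(e)}}$. To an oriented triangle $\Delta$ with boundary edges (oriented along $\partial\Delta$) carrying $A,B,C$ in cyclic order one associates $V(\Delta,\ell)=\mathrm{Hom}_{\mathcal C}(\mathbf 1,ABC)$, independent of the starting edge by the pivotal structure. Evaluating the planar theta graph gives a non-degenerate pairing $V(\Delta,\ell)\otimes V(-\Delta,\ell)\to\mathbb F$. For a labelled oriented tetrahedron, evaluating on $S^2$ the tetrahedral graph dual to its boundary gives a linear form on the tensor product of the $V$-spaces of its four boundary faces. For a closed oriented surface $\Sigma$ with triangulation $T$ put $V(\Sigma,T)=\bigoplus_\ell\bigotimes_{\Delta}V(\Delta,\ell)$. Extend $T$ on both boundary components to a triangulation of $\Sigma\times[0,1]$; for each labelling take the product of the tetrahedral forms, contract each pair of spaces belonging to an interior face with the copairing dual to the theta-graph pairing $V(\Delta,\ell)\otimes V(-\Delta,\ell)\to\mathbb F$, multiply by $\prod d(X_{\ell(e)})$ over edges and by $(\dim\mathcal C)^{-1}$ for each vertex, where the vertices and edges of $\Sigma\times\{0\}$ are not counted in these weights, and sum over labellings of the edges not in the boundary. Using the pairings $V(\Delta,\ell)\otimes V(-\Delta,\ell)\to\mathbb F$, this yields an endomorphism $P_T$ of $V(\Sigma,T)$, which is an idempotent independent of the interior triangulation. The state space is $\mathcal H_\Sigma=\mathrm{im}\,P_T$; up to canonical isomorphism it does not depend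 on $T$. *)

(* Defs.v *)
From HB Require Import structures.
From mathcomp Require Import all_boot all_order all_algebra.

Set Implicit Arguments.
Unset Strict Implicit.
Unset Printing Implicit Defensive.

Import GRing.Theory.
Local Open Scope ring_scope.

(** * Linear categories with finite dimensional Hom-spaces *)

Record lincat (F : fieldType) := Lincat {
  ob : Type;
  hom : ob -> ob -> vectType F;
  idm : forall X, hom X X;
  compm : forall X Y Z, hom Y Z -> hom X Y -> hom X Z;
  comp1m : forall X Y (f : hom X Y), compm (idm Y) f = f;
  compm1 : forall X Y (f : hom X Y), compm f (idm X) = f;
  compA : forall X Y Z W (h : hom Z W) (g : hom Y Z) (f : hom X Y),
    compm h (compm g f) = compm (compm h g) f;
  comp_linearl : forall X Y Z (f : hom X Y), linear (fun g : hom Y Z => compm g f);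
  comp_linearr : forall X Y Z (g : hom Y Z), linear (fun f : hom X Y => compm g f)
}.
Arguments hom {F l} X Y.
Arguments idm {F l} X.
Arguments compm {F l X Y Z} g f.

Declare Scope cat_scope.
Delimit Scope cat_scope with cat.
Local Open Scope cat_scope.

Notation "g \oc f" := (compm g f) (at level 50, left associativity) : cat_scope.

(* In a strict tensor category objects such as X(YZ) and (XY)Z are equal but
   not convertible; [eqm e] is the identity morphism seen along e : X = Y. *)
Definition eqm (F : fieldType) (C : lincat F) (X Y : ob C) (e : X = Y) :
  hom X Y := match e in _ = Z return hom X Z with erefl => idm X end.
Arguments eqm {F C X Y} e.

Definition isomorphic (F : fieldType) (C : lincat F) (X Y : ob C) : Prop :=
  exists (f : hom X Y) (g : hom Y X), g \oc f = idm X /\ f \oc g = idm Y.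

(* End(X) = F, via c |-> c id_X. *)
Definition simple_ob (F : fieldType) (C : lincat F) (X : ob C) : Prop :=
  forall f : hom X X, exists! c : F, f = c *: idm X.

Definition direct_sum (F : fieldType) (C : lincat F) n (S : 'I_n -> ob C)
    (Y : ob C) : Prop :=
  exists (i : forall k, hom (S k) Y) (p : forall k, hom Y (S k)),
    [/\ forall k, p k \oc i k = idm (S k),
        forall k l, k != l -> p k \oc i l = 0
      & \sum_k (i k \oc p k) = idm Y].

(* The last clause (Schur's lemma for the chosen notion of simplicity) is part
   of semisimplicity: the even morphisms between free modules over an exterior
   algebra on one odd generator satisfy the first three clauses only. *)
Definition semisimple (F : fieldType) (C : lincat F) : Prop :=
  [/\ forall n (S : 'I_n -> ob C), exists Y, direct_sum S Y,
      forall (X : ob C) (e : hom X X), e \oc e = e ->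
        exists (Y : ob C) (i : hom Y X) (p : hom X Y),
          i \oc p = e /\ p \oc i = idm Y,
      forall X : ob C, exists n (S : 'I_n -> ob C),
        (forall k, simple_ob (S k)) /\ direct_sum S X
    & forall S T : ob C, simple_ob S -> simple_ob T -> ~ isomorphic S T ->
        forall f : hom S T, f = 0].

(* (x i)_i lists exactly once each R-class of the objects satisfying P. *)
Definition representatives (O : Type) (P : O -> Prop) (R : O -> O -> Prop)
    (I : Type) (x : I -> O) : Prop :=
  [/\ forall i, P (x i),
      forall i j, R (x i) (x j) -> i = j
    & forall o, P o -> exists i, R o (x i)].

(** * Strict tensor categories *)

Record tensorcat (F : fieldType) := Tensorcat {
  tcat :> lincat F;
  unit_ob : ob tcat;
  tens : ob tcat -> ob tcat -> ob tcat;
  tensA : forall X Y Z, tens X (tens Y Z) = tens (tens X Y) Z;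
  tens1X : forall X, tens unit_ob X = X;
  tensX1 : forall X, tens X unit_ob = X;
  tensm : forall X Y X' Y', hom X Y -> hom X' Y' -> hom (tens X X') (tens Y Y');
  tensm_idm : forall X Y, tensm (idm X) (idm Y) = idm (tens X Y);
  tensm_compm : forall X Y Z X' Y' Z' (g : hom Y Z) (f : hom X Y)
      (g' : hom Y' Z') (f' : hom X' Y'),
    tensm (g \oc f) (g' \oc f') = tensm g g' \oc tensm f f';
  tensm_linearl : forall X Y X' Y' (f' : hom X' Y'),
    linear (fun f : hom X Y => tensm f f');
  tensm_linearr : forall X Y X' Y' (f : hom X Y),
    linear (fun f' : hom X' Y' => tensm f f');
  tensmA : forall X Y Z X' Y' Z' (f : hom X X') (g : hom Y Y') (h : hom Z Z'),
    eqm (tensA X' Y' Z') \oc tensm f (tensm g h) =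
    tensm (tensm f g) h \oc eqm (tensA X Y Z);
  tensm1f : forall X Y (f : hom X Y),
    eqm (tens1X Y) \oc tensm (idm unit_ob) f = f \oc eqm (tens1X X);
  tensmf1 : forall X Y (f : hom X Y),
    eqm (tensX1 Y) \oc tensm f (idm unit_ob) = f \oc eqm (tensX1 X)
}.
Arguments unit_ob {F t}.
Arguments tens {F t} X Y.
Arguments tensA {F t} X Y Z.
Arguments tens1X {F t} X.
Arguments tensX1 {F t} X.
Arguments tensm {F t X Y X' Y'} f g.

Notation "X ** Y" := (tens X Y) (at level 40, left associativity) : cat_scope.
Notation "f *t g" := (tensm f g) (at level 40, left associativity) : cat_scope.

(* The scalar_of c such that f = c id_1, when End(1) = F. *)
Definition scalar_of (F : fieldType) (C : tensorcat F)
    (f : hom (@unit_ob F C) unit_ob) : F :=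
  coord [tuple idm (@unit_ob F C)] ord0 f.

(** * Strict spherical categories *)

Record dualdata (F : fieldType) := Dualdata {
  dcat :> tensorcat F;
  dual : ob dcat -> ob dcat;
  dualK : forall X, dual (dual X) = X;
  dual1 : dual unit_ob = unit_ob;
  dualM : forall X Y, dual (X ** Y) = dual Y ** dual X;
  coev : forall X, hom unit_ob (X ** dual X);
  ev : forall X, hom (X ** dual X) unit_ob
}.
Arguments dual {F d} X.
Arguments dualK {F d} X.
Arguments dualM {F d} X Y.
Arguments coev {F d} X.
Arguments ev {F d} X.

Section DualData.
Variables (F : fieldType) (C : dualdata F).
Implicit Types X Y Z : ob C.

Definition coev' X : hom unit_ob (dual X ** X) :=
  (idm (dual X) *t eqm (dualK X)) \oc coev (dual X).

Definition ev' X : hom (dual X ** X) unit_ob :=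
  ev (dual X) \oc (idm (dual X) *t eqm (esym (dualK X))).

(* The two duals of a morphism, Y^* -> X^* X Y^* -> X^* Y Y^* -> X^* and
   Y^* -> Y^* X X^* -> Y^* Y X^* -> X^*. *)
Definition rdual X Y (s : hom X Y) : hom (dual Y) (dual X) :=
  eqm (tensX1 (dual X)) \oc (idm (dual X) *t ev Y)
    \oc (idm (dual X) *t (s *t idm (dual Y)))
    \oc eqm (esym (tensA (dual X) X (dual Y)))
    \oc (coev' X *t idm (dual Y)) \oc eqm (esym (tens1X (dual Y))).

Definition ldual X Y (s : hom X Y) : hom (dual Y) (dual X) :=
  eqm (tens1X (dual X)) \oc (ev' Y *t idm (dual X))
    \oc ((idm (dual Y) *t s) *t idm (dual X))
    \oc eqm (tensA (dual Y) X (dual X))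
    \oc (idm (dual Y) *t coev X) \oc eqm (esym (tensX1 (dual Y))).

Definition trace X (s : hom X X) : hom (@unit_ob F C) unit_ob :=
  ev X \oc (s *t idm (dual X)) \oc coev X.

Definition trace' X (s : hom X X) : hom (@unit_ob F C) unit_ob :=
  ev' X \oc (idm (dual X) *t s) \oc coev' X.

Lemma nest_dual X Y : X ** ((Y ** dual Y) ** dual X) = (X ** Y) ** dual (X ** Y).
Proof. by rewrite dualM -!tensA. Qed.

End DualData.

Record spherical (F : fieldType) := Spherical {
  scat :> dualdata F;
  zigzag : forall X : ob scat,
    eqm (tens1X X) \oc (ev X *t idm X) \oc eqm (tensA X (dual X) X)
      \oc (idm X *t coev' X) \oc eqm (esym (tensX1 X)) = idm X;
  zigzag' : forall X : ob scat,
    eqm (tensX1 X) \oc (idm X *t ev' X) \oc eqm (esym (tensA X (dual X) X))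
      \oc (coev X *t idm X) \oc eqm (esym (tens1X X)) = idm X;
  coevM : forall X Y : ob scat,
    coev (X ** Y) = eqm (nest_dual X Y)
      \oc (idm X *t (coev Y *t idm (dual X)))
      \oc (idm X *t eqm (esym (tens1X (dual X)))) \oc coev X;
  evM : forall X Y : ob scat,
    ev (X ** Y) = ev X \oc (idm X *t eqm (tens1X (dual X)))
      \oc (idm X *t (ev Y *t idm (dual X)))
      \oc eqm (esym (nest_dual X Y));
  pivotal : forall (X Y : ob scat) (s : hom X Y), rdual s = ldual s;
  sphere : forall (X : ob scat) (s : hom X X), trace s = trace' s
}.

(** * The center *)

Section Center.
Variables (F : fieldType) (C : tensorcat F).

Record center_ob := Center {
  cob : ob C;
  hb : forall Y, hom (cob ** Y) (Y ** cob);
  hb_iso : forall Y, exists g : hom (Y ** cob) (cob ** Y),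
    g \oc hb Y = idm _ /\ hb Y \oc g = idm _;
  hb_natural : forall Y Z (f : hom Y Z),
    (f *t idm cob) \oc hb Y = hb Z \oc (idm cob *t f);
  hb_tens : forall Y Z,
    hb (Y ** Z) = eqm (tensA Y Z cob) \oc (idm Y *t hb Z)
      \oc eqm (esym (tensA Y cob Z)) \oc (hb Y *t idm Z) \oc eqm (tensA cob Y Z);
  hb_one : eqm (tens1X cob) \oc hb unit_ob = eqm (tensX1 cob)
}.

Definition center_mor (X Y : center_ob) (t : hom (cob X) (cob Y)) : Prop :=
  forall Z, (idm Z *t t) \oc hb X Z = hb Y Z \oc (t *t idm Z).

Definition center_isomorphic (X Y : center_ob) : Prop :=
  exists (f : hom (cob X) (cob Y)) (g : hom (cob Y) (cob X)),
    [/\ center_mor f, center_mor g, g \oc f = idm _ & f \oc g = idm _].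

Definition center_simple (X : center_ob) : Prop :=
  forall t : hom (cob X) (cob X), center_mor t ->
    exists! c : F, t = c *: idm (cob X).

(* There are exactly n isomorphism classes of simple objects of the center. *)
Definition number_simples_center (n : nat) : Prop :=
  exists Z : 'I_n -> center_ob, representatives center_simple center_isomorphic Z.

End Center.

(** * Triangulated surfaces and cobordisms

   Triangulations are Delta-complexes: the vertices of each simplex are ordered,
   compatibly with its faces, and faces of the same simplex may be identified.
   The orderings orient the edges. *)

Record delta_complex := Complex {
  vert : finType;
  edge : finType;
  tri : finType;
  src : edge -> vert;
  tgt : edge -> vert;
  e01 : tri -> edge;
  e12 : tri -> edge;
  e02 : tri -> edge;
  tri_v0 : forall f, src (e01 f) = src (e02 f);
  tri_v1 : forall f, tgt (e01 f) = src (e12 f);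
  tri_v2 : forall f, tgt (e12 f) = tgt (e02 f)
}.

(* A closed surface; [sgn f] tells whether the order of the vertices of f
   agrees with the orientation.  Each edge occurs in the boundaries of the
   oriented triangles exactly once with each sign. *)
Record surface := Surface {
  scpx :> delta_complex;
  sgn : tri scpx -> bool;
  surface_closed : forall (e : edge scpx) (s : bool),
    (\sum_f (((e01 f == e) && (sgn f == s)) + ((e12 f == e) && (sgn f == s))
             + ((e02 f == e) && (sgn f == ~~ s))))%N = 1%N
}.

Record embedding (K L : delta_complex) := Embedding {
  on_vert : vert K -> vert L;
  on_edge : edge K -> edge L;
  on_tri : tri K -> tri L;
  on_vert_inj : injective on_vert;
  on_edge_inj : injective on_edge;
  on_tri_inj : injective on_tri;
  on_src : forall e, src (on_edge e) = on_vert (src e);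
  on_tgt : forall e, tgt (on_edge e) = on_vert (tgt e);
  on_e01 : forall f, e01 (on_tri f) = on_edge (e01 f);
  on_e12 : forall f, e12 (on_tri f) = on_edge (e12 f);
  on_e02 : forall f, e02 (on_tri f) = on_edge (e02 f)
}.

(* An oriented 3-dimensional complex with boundary top(T) - bot(T): with each
   sign s, every triangle occurs exactly once either in the boundary of an
   oriented tetrahedron, or in bot(T) or -top(T).
   [f012 t], ..., [f123 t] are the faces of t; [tsgn] is the orientation. *)
Record cobordism (T : surface) := Cobordism {
  wcpx :> delta_complex;
  tet : finType;
  tsgn : tet -> bool;
  f012 : tet -> tri wcpx;
  f013 : tet -> tri wcpx;
  f023 : tet -> tri wcpx;
  f123 : tet -> tri wcpx;
  tet01 : forall t, e01 (f013 t) = e01 (f012 t);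
  tet02 : forall t, e01 (f023 t) = e02 (f012 t);
  tet03 : forall t, e02 (f023 t) = e02 (f013 t);
  tet12 : forall t, e01 (f123 t) = e12 (f012 t);
  tet13 : forall t, e02 (f123 t) = e12 (f013 t);
  tet23 : forall t, e12 (f123 t) = e12 (f023 t);
  bot : embedding T wcpx;
  top : embedding T wcpx;
  bot_top_disjoint : forall v v', on_vert bot v <> on_vert top v';
  cobordism_boundary : forall (f : tri wcpx) (s : bool),
    (\sum_t (((f123 t == f) && (tsgn t == s)) + ((f023 t == f) && (tsgn t == ~~ s))
             + ((f013 t == f) && (tsgn t == s)) + ((f012 t == f) && (tsgn t == ~~ s)))
     + \sum_(g : tri T) ((on_tri bot g == f) && (sgn g == s))
     + \sum_(g : tri T) ((on_tri top g == f) && (sgn g == ~~ s)))%N = 1%N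
}.

(** ** The product triangulation of T x [0,1]

   With v and v' the copies of a vertex v in T x 0 and T x 1, the simplices are
   - edges [a,b], [a',b'] (false, true), [a,b'] for an edge [a,b], and [v,v'];
   - triangles [a,b,c], [a',b',c'], then [a,b,c'], [a,b',c'] for a triangle
     [a,b,c], then [a,b,b'], [a,a',b'] for an edge [a,b];
   - tetrahedra [a,a',b',c'], [a,b,b',c'], [a,b,c,c']. *)
Section Prism.
Variable T : surface.

Definition pvert : finType := (bool * vert T)%type.
Definition pedge : finType := (bool * edge T + edge T + vert T)%type.
Definition ptri : finType := (bool * tri T + bool * tri T + bool * edge T)%type.
Definition ptet : finType := (tri T + tri T + tri T)%type.

Definition hor (b : bool) (e : edge T) : pedge := inl (inl (b, e)).
Definition dia (e : edge T) : pedge := inl (inr e).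
Definition ver (v : vert T) : pedge := inr v.
Definition horf (b : bool) (f : tri T) : ptri := inl (inl (b, f)).
Definition diaf (b : bool) (f : tri T) : ptri := inl (inr (b, f)).
Definition verf (b : bool) (e : edge T) : ptri := inr (b, e).

Definition psrc (x : pedge) : pvert :=
  match x with
  | inl (inl (b, e)) => (b, src e)
  | inl (inr e) => (false, src e)
  | inr v => (false, v)
  end.

Definition ptgt (x : pedge) : pvert :=
  match x with
  | inl (inl (b, e)) => (b, tgt e)
  | inl (inr e) => (true, tgt e)
  | inr v => (true, v)
  end.

Definition pe01 (x : ptri) : pedge :=
  match x with
  | inl (inl (b, f)) => hor b (e01 f)
  | inl (inr (false, f)) => hor false (e01 f)
  | inl (inr (true, f)) => dia (e01 f)
  | inr (false, e) => hor false e
  | inr (true, e) => ver (src e)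
  end.

Definition pe12 (x : ptri) : pedge :=
  match x with
  | inl (inl (b, f)) => hor b (e12 f)
  | inl (inr (false, f)) => dia (e12 f)
  | inl (inr (true, f)) => hor true (e12 f)
  | inr (false, e) => ver (tgt e)
  | inr (true, e) => hor true e
  end.

Definition pe02 (x : ptri) : pedge :=
  match x with
  | inl (inl (b, f)) => hor b (e02 f)
  | inl (inr (_, f)) => dia (e02 f)
  | inr (_, e) => dia e
  end.

Lemma ptri_v0 x : psrc (pe01 x) = psrc (pe02 x).
Proof. by case: x => [[[b f]|[[] f]]|[[] e]] //=; rewrite tri_v0. Qed.

Lemma ptri_v1 x : ptgt (pe01 x) = psrc (pe12 x).
Proof. by case: x => [[[b f]|[[] f]]|[[] e]] //=; rewrite tri_v1. Qed.

Lemma ptri_v2 x : ptgt (pe12 x) = ptgt (pe02 x).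
Proof. by case: x => [[[b f]|[[] f]]|[[] e]] //=; rewrite tri_v2. Qed.

Definition pcomplex : delta_complex :=
  @Complex pvert pedge ptri psrc ptgt pe01 pe12 pe02 ptri_v0 ptri_v1 ptri_v2.

Definition ptsgn (t : ptet) : bool :=
  match t with
  | inl (inl f) => sgn f
  | inl (inr f) => ~~ sgn f
  | inr f => sgn f
  end.

Definition pf012 (t : ptet) : ptri :=
  match t with
  | inl (inl f) => verf true (e01 f)
  | inl (inr f) => verf false (e01 f)
  | inr f => horf false f
  end.

Definition pf013 (t : ptet) : ptri :=
  match t with
  | inl (inl f) => verf true (e02 f)
  | inl (inr f) => diaf false f
  | inr f => diaf false f
  end.

Definition pf023 (t : ptet) : ptri :=
  match t with
  | inl (inl f) => diaf true f
  | inl (inr f) => diaf true f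
  | inr f => verf false (e02 f)
  end.

Definition pf123 (t : ptet) : ptri :=
  match t with
  | inl (inl f) => horf true f
  | inl (inr f) => verf true (e12 f)
  | inr f => verf false (e12 f)
  end.

Definition plevel (b : bool) : embedding T pcomplex.
Proof.
apply: (@Embedding T pcomplex (pair b) (hor b) (horf b)) => //.
- by move=> v w [].
- by move=> v w [].
- by move=> v w [].
Defined.

Lemma prism_boundary (f : ptri) (s : bool) :
  (\sum_t (((pf123 t == f) && (ptsgn t == s)) + ((pf023 t == f) && (ptsgn t == ~~ s))
     + ((pf013 t == f) && (ptsgn t == s)) + ((pf012 t == f) && (ptsgn t == ~~ s)))
   + \sum_(g : tri T) ((horf false g == f) && (sgn g == s))
   + \sum_(g : tri T) ((horf true g == f) && (sgn g == ~~ s)))%N = 1%N.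
Proof.
have one2 (g : tri T) :
    (\sum_h ((h == g) && (sgn h == s)) + \sum_h ((h == g) && (sgn h == ~~ s)))%N = 1%N.
  rewrite -big_split /= (bigD1 g) //= eqxx big1 ?addn0; last first.
    by move=> h /negPf ->.
  by case: (sgn g) s => [] [].
have hh b c g h : (horf b g == horf c h) = (b == c) && (g == h) by [].
have dd b c g h : (diaf b g == diaf c h) = (b == c) && (g == h) by [].
have vv b c e e' : (verf b e == verf c e') = (b == c) && (e == e') by [].
have hd b c g h : (horf b g == diaf c h) = false by [].
have hv b c g e : (horf b g == verf c e) = false by [].
have dv b c g e : (diaf b g == verf c e) = false by [].
have dh b c g h : (diaf b g == horf c h) = false by [].
have vh b c e g : (verf b e == horf c g) = false by [].
have vd b c e g : (verf b e == diaf c g) = false by [].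
rewrite !big_sumType /=.
case: f => [[[b g]|[b g]]|[b e]].
1-2: rewrite -[RHS](one2 g).
3: rewrite -[RHS](surface_closed e (b (+) s)).
all: rewrite -!big_split /=; apply: eq_bigr => h _.
all: rewrite -?/(horf _ _) -?/(diaf _ _) -?/(verf _ _).
all: rewrite ?hh ?dd ?vv ?hd ?hv ?dv ?dh ?vh ?vd.
all: clear one2.
- by case: b (sgn h) s (h == g) => [] [] [] [].
- by case: b (sgn h) s (h == g) => [] [] [] [].
by case: b (sgn h) s (e01 h == e) (e12 h == e) (e02 h == e) => [] [] [] [] [] [].
Qed.

Definition prism : cobordism T.
Proof.
apply: (@Cobordism T pcomplex ptet ptsgn pf012 pf013 pf023 pf123
  _ _ _ _ _ _ (plevel false) (plevel true) _ prism_boundary) => //.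
all: by case=> [[f|f]|f] //=; rewrite ?tri_v0 ?tri_v1 ?tri_v2.
Defined.

End Prism.

(** ** The torus

   The square with vertices 0, 1, 2 = (1,1), 1' and opposite sides identified:
   a = [0,1] = [1',2], b = [1,2] = [0,1'], diagonal c = [0,2]. *)
Section Torus.

Let a : 'I_3 := @Ordinal 3 0 isT.
Let b : 'I_3 := @Ordinal 3 1 isT.
Let c : 'I_3 := @Ordinal 3 2 isT.

Definition torus_complex : delta_complex :=
  @Complex unit 'I_3 bool (fun=> tt) (fun=> tt)
    (fun f => if f then a else b) (fun f => if f then b else a) (fun=> c)
    (fun=> erefl) (fun=> erefl) (fun=> erefl).

Lemma torus_closed (e : edge torus_complex) (s : bool) :
  (\sum_(f : tri torus_complex)
     (((e01 f == e) && (f == s)) + ((e12 f == e) && (f == s))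
      + ((e02 f == e) && (f == ~~ s))))%N = 1%N.
Proof. by rewrite big_bool; case: e s => [[|[|[|]]] // ?] []. Qed.

Definition torus : surface := @Surface torus_complex id torus_closed.

End Torus.

(** * The state sum *)

Section StateSum.
Variables (F : fieldType) (C : spherical F) (G : finType) (X : G -> ob C).

Definition dim_ob (Y : ob C) : F := scalar_of (ev Y \oc coev Y).

Definition dim_cat : F := \sum_i dim_ob (X i) ^+ 2.

(* Y -> Y 1 -> Y (Y^* Z) -> (Y Y^* ) Z -> Z. *)
Definition bendl (W Y Z : ob C) (h : W = dual Y ** Z) (x : hom unit_ob W) : hom Y Z :=
  eqm (tens1X Z) \oc (ev Y *t idm Z) \oc eqm (tensA Y (dual Y) Z)
    \oc (idm Y *t (eqm h \oc x)) \oc eqm (esym (tensX1 Y)).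

(* Y -> 1 Y -> (Z Y^* ) Y -> Z (Y^* Y) -> Z. *)
Definition bendr (W Y Z : ob C) (h : W = Z ** dual Y) (x : hom unit_ob W) : hom Y Z :=
  eqm (tensX1 Z) \oc (idm Z *t ev' Y) \oc eqm (esym (tensA Z (dual Y) Y))
    \oc ((eqm h \oc x) *t idm Y) \oc eqm (esym (tens1X Y)).

(* The spaces Hom(1, ABC) of a triangle [0,1,2] whose edges 01, 12, 02 carry
   X_i, X_j, X_k: [wpos] for the boundary 01, 12, 20 and [wneg] for the
   boundary 02, 21, 10 of the opposite orientation. *)
Definition wpos (i j k : G) : ob C := X i ** (X j ** dual (X k)).
Definition wneg (i j k : G) : ob C := X k ** (dual (X j) ** dual (X i)).
Definition Vpos (i j k : G) : vectType F := hom unit_ob (wpos i j k).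
Definition Vneg (i j k : G) : vectType F := hom unit_ob (wneg i j k).

Lemma wneg_dual i j k : wneg i j k = dual (wpos i j k) ** unit_ob.
Proof. by rewrite tensX1 /wpos /wneg !dualM dualK tensA. Qed.

(* The theta graph. *)
Definition theta i j k (x : Vpos i j k) (y : Vneg i j k) : F :=
  scalar_of (bendl (wneg_dual i j k) y \oc x).

(* Bases of Vpos and Vneg that are dual for theta. *)
Definition ndim (i j k : G) : nat := \dim {:Vpos i j k}.

Definition bpos i j k (m : nat) : Vpos i j k := (vbasis {:Vpos i j k})`_m.

Definition theta_mx i j k : 'M[F]_(ndim i j k, \dim {:Vneg i j k}) :=
  \matrix_(m, n) theta (bpos i j k m) (vbasis {:Vneg i j k})`_n.

Definition bneg i j k (m : nat) : Vneg i j k :=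
  [seq \sum_n pinvmx (theta_mx i j k) n m' *: (vbasis {:Vneg i j k})`_n
    | m' <- enum 'I_(ndim i j k)]`_m.

(* The tetrahedral graph, drawn as
   1 -x-> A B C -y-> A B D E -z-> A H E -w-> 1. *)
Definition tetra (A B D E H K : ob C) (x : hom unit_ob (A ** (B ** K)))
    (y : hom K (D ** E)) (z : hom (B ** D) H) (w : hom (A ** (H ** E)) unit_ob) : F :=
  scalar_of (w \oc (idm A *t (z *t idm E)) \oc (idm A *t eqm (tensA B D E))
            \oc (idm A *t (idm B *t y)) \oc x).

(* The linear form of a tetrahedron [0,1,2,3] whose edge pq carries X_(lpq),
   on vectors attached to its faces.  If the order of the vertices agrees with
   the orientation, the oriented boundary faces are 123, 032, 013, 021. *)
Section Tetrahedron.
Variables l01 l02 l03 l12 l13 l23 : G.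

Lemma tpos_y : wneg l02 l23 l03 = dual (dual (X l03)) ** (dual (X l23) ** dual (X l02)).
Proof. by rewrite dualK. Qed.

Lemma tpos_z : wpos l12 l23 l13 = X l12 ** dual (X l13 ** dual (X l23)).
Proof. by rewrite dualM dualK. Qed.

Definition tetra_pos (x123 : Vpos l12 l23 l13) (x023 : Vneg l02 l23 l03)
    (x013 : Vpos l01 l13 l03) (x012 : Vneg l01 l12 l02) : F :=
  tetra x013 (bendl tpos_y x023) (bendr tpos_z x123)
    (bendl (wneg_dual l01 l12 l02) x012).

Lemma tneg_y : wpos l02 l23 l03 = dual (dual (X l02)) ** (X l23 ** dual (X l03)).
Proof. by rewrite dualK. Qed.

Lemma tneg_z : wneg l12 l23 l13 = X l13 ** dual (X l12 ** X l23).
Proof. by rewrite dualM. Qed.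

Definition tetra_neg (x123 : Vneg l12 l23 l13) (x023 : Vpos l02 l23 l03)
    (x013 : Vneg l01 l13 l03) (x012 : Vpos l01 l12 l02) : F :=
  tetra x012 (bendl tneg_y x023) (bendr tneg_z x123)
    (bendl (wneg_dual l01 l13 l03) x013).

End Tetrahedron.

(* A state: a labelling l of the edges, and for each triangle f the index of a
   basis vector of V(f, l).  As [bpos] and [bneg] are dual bases, the same index
   serves for both orientations of f. *)
Definition labelling (K : delta_complex) : finType := {ffun edge K -> G}.

Definition fdim (K : delta_complex) (l : labelling K) (f : tri K) : nat :=
  ndim (l (e01 f)) (l (e12 f)) (l (e02 f)).

Definition state (K : delta_complex) : finType :=
  {l : labelling K & {dffun forall f : tri K, 'I_(fdim l f)}}.

(* V(T), in coordinates: the direct sum over l of the tensor products over f of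
   the spaces Hom(1, ABC), with the product bases of the [bpos] and [bneg]. *)
Definition Vsurf (T : surface) : vectType F := {ffun state T -> F^o}.

Section Cobordism.
Variables (T : surface) (W : cobordism T).

Definition restricts (i : embedding T W) (s : state W) (r : state T) : bool :=
  [forall e, tag s (on_edge i e) == tag r e] &&
  [forall f, tagged s (on_tri i f) == tagged r f :> nat].

Definition tet_weight (s : state W) (t : tet W) : F :=
  let l := tag s in
  let k f : nat := tagged s f in
  let l01 := l (e01 (f012 t)) in
  let l02 := l (e02 (f012 t)) in
  let l03 := l (e02 (f013 t)) in
  let l12 := l (e12 (f012 t)) in
  let l13 := l (e12 (f013 t)) in
  let l23 := l (e12 (f023 t)) in
  if tsgn t then
    tetra_pos (bpos l12 l23 l13 (k (f123 t))) (bneg l02 l23 l03 (k (f023 t)))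
      (bpos l01 l13 l03 (k (f013 t))) (bneg l01 l12 l02 (k (f012 t)))
  else
    tetra_neg (bneg l12 l23 l13 (k (f123 t))) (bpos l02 l23 l03 (k (f023 t)))
      (bneg l01 l13 l03 (k (f013 t))) (bpos l01 l12 l02 (k (f012 t))).

(* Edges and vertices of the bottom are not counted. *)
Definition state_weight (s : state W) : F :=
  \prod_(t : tet W) tet_weight s t
  * \prod_(e : edge W | e \notin codom (on_edge (bot W))) dim_ob (X (tag s e))
  * \prod_(v : vert W | v \notin codom (on_vert (bot W))) dim_cat^-1.

(* The state sum is a form on V(top) (x) V(-bot); pairing V(-bot) with V(bot)
   by the theta graphs turns it into a map from V(top) to V(bot). *)
Definition cobordism_map (v : Vsurf T) : Vsurf T :=
  [ffun r0 => \sum_(r1 : state T)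
     (\sum_(s : state W | restricts (top W) s r1 && restricts (bot W) s r0)
        state_weight s) * v r1].

Lemma cobordism_map_linear : linear cobordism_map.
Proof.
move=> c u v; apply/ffunP => r0; rewrite !ffunE scaler_sumr -big_split /=.
apply: eq_bigr => r1 _; rewrite !ffunE mulrDr; congr (_ + _).
by rewrite -[in RHS]/(_ * _) mulrCA.
Qed.

End Cobordism.

(* P_T, computed with the product triangulation of T x [0,1]; it does not
   depend on the triangulation of the interior. *)
Definition projector (T : surface) : 'End(Vsurf T) :=
  linfun (cobordism_map (prism T)).

Definition state_space (T : surface) : {vspace Vsurf T} := limg (projector T).

End StateSum.

(* Main.v *)
Require Import Defs.
From HB Require Import structures.
From Stdlib Require Import ProofIrrelevance Classical IndefiniteDescription.
From mathcomp Require Import all_boot all_order all_algebra.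
Import Defs.

(** A state of the torus with edges a, b and diagonal c determines a morphism
    f : ab -> c -> ba on the bottom and f' : b'a' -> c' -> a'b' on the top, and
    such morphisms span the Hom spaces.  Contracting the six tetrahedra of the
    prism gives, up to nonzero weights, the form
      M(f, f') = sum over v and over trace-dual bases al of Hom(va', av) and be
      of Hom(vb', bv) of d_v tr (f, be, al, f', be^*, al^* ).
    For an object Z of the center and s : a -> Z, r : Z -> a, put
      f_b = (b r) e_Z(b) (s b) : ab -> ba.
    If Z is simple, handle slides give sum_b d_b M(f_b, f') = lambda chi_Z(f'),
    where lambda id_Z is the average of s r over the half braiding and chi_Z is
    the character of Z.  The induced objects of the center show that each f
    arises in this way, and the center is semisimple because averaging turns a
    generalized inverse into a central one.  Hence the kernel of the projector
    is the common kernel of the characters of the simple objects of the center.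
    Pairing with the inverse half braiding shows that characters of pairwise
    non-isomorphic simple objects are independent. *)

Set Implicit Arguments.
Unset Strict Implicit.
Unset Printing Implicit Defensive.

Import GRing.Theory.
Local Open Scope ring_scope.
Local Open Scope cat_scope.

(** Strictness holds only up to equality proofs between objects, so diagrams would drown in casts.
    Every box is therefore evaluated in front of an arbitrary tail, where associators disappear and
    the interchange law becomes naturality; the casts that remain are unique by proof irrelevance.
    The projector is studied through its kernel: its rank is the number of independent functionals
    that cut this kernel out. The handle slide evaluates only sums over all colours b, while a state
    fixes one colour. Induced objects remove this obstacle, since there s and r can be chosen so
    that f_b vanishes for every b but one. Scalars on a simple object Z of the center are found by
    comparing traces, lambda d(Z) = dim C tr(s r). Taking a as a simple retract of the underlying
    object of Z makes the right side nonzero, so lambda is invertible. Finiteness of the set of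
    simple objects of the center comes from the characters as well: they are independent functions
    on the finite set of states. *)

Local Notation o0 := (@Ordinal 3 0 isT).
Local Notation o1 := (@Ordinal 3 1 isT).
Local Notation o2 := (@Ordinal 3 2 isT).

(** * Calculus in strict tensor categories *)

Section LinearFunctions.
Variables (F : fieldType) (U V : lmodType F) (f : U -> V).
Hypothesis f_lin : linear f.

Lemma lin0 : f 0 = 0.
Proof.
have := f_lin 1 0 0; rewrite !scale1r addr0 => /eqP.
by rewrite -subr_eq0 opprD addNKr oppr_eq0 => /eqP.
Qed.

Lemma linD u v : f (u + v) = f u + f v.
Proof. by rewrite -[u in LHS]scale1r f_lin scale1r. Qed.

Lemma linZ c u : f (c *: u) = c *: f u.
Proof. by rewrite -[c *: u]addr0 f_lin lin0 addr0. Qed.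

Lemma linB u v : f (u - v) = f u - f v.
Proof. by rewrite -scaleN1r linD linZ scaleN1r. Qed.

Lemma lin_sum I r (P : pred I) (x : I -> U) :
  f (\sum_(i <- r | P i) x i) = \sum_(i <- r | P i) f (x i).
Proof. exact: (big_morph f linD lin0). Qed.

End LinearFunctions.

Section Lincat.
Variables (F : fieldType) (C : lincat F).
Implicit Types X Y Z W : ob C.

Lemma compDl X Y Z (g g' : hom Y Z) (f : hom X Y) :
  (g + g') \oc f = (g \oc f) + (g' \oc f).
Proof. exact: (linD (comp_linearl f)). Qed.

Lemma compDr X Y Z (g : hom Y Z) (f f' : hom X Y) :
  g \oc (f + f') = (g \oc f) + (g \oc f').
Proof. exact: (linD (comp_linearr g)). Qed.

Lemma compBl X Y Z (g g' : hom Y Z) (f : hom X Y) :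
  (g - g') \oc f = (g \oc f) - (g' \oc f).
Proof. exact: (linB (comp_linearl f)). Qed.

Lemma compBr X Y Z (g : hom Y Z) (f f' : hom X Y) :
  g \oc (f - f') = (g \oc f) - (g \oc f').
Proof. exact: (linB (comp_linearr g)). Qed.

Lemma compZl X Y Z c (g : hom Y Z) (f : hom X Y) :
  (c *: g) \oc f = c *: (g \oc f).
Proof. exact: (linZ (comp_linearl f)). Qed.

Lemma compZr X Y Z c (g : hom Y Z) (f : hom X Y) :
  g \oc (c *: f) = c *: (g \oc f).
Proof. exact: (linZ (comp_linearr g)). Qed.

Lemma comp0l X Y Z (f : hom X Y) : (0 : hom Y Z) \oc f = 0.
Proof. exact: (lin0 (comp_linearl f)). Qed.

Lemma comp0r X Y Z (g : hom Y Z) : g \oc (0 : hom X Y) = 0.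
Proof. exact: (lin0 (comp_linearr g)). Qed.

Lemma comp_suml X Y Z I r (P : pred I) (g : I -> hom Y Z) (f : hom X Y) :
  (\sum_(i <- r | P i) g i) \oc f = \sum_(i <- r | P i) (g i \oc f).
Proof. exact: (lin_sum (comp_linearl f)). Qed.

Lemma comp_sumr X Y Z I r (P : pred I) (g : hom Y Z) (f : I -> hom X Y) :
  g \oc (\sum_(i <- r | P i) f i) = \sum_(i <- r | P i) (g \oc f i).
Proof. exact: (lin_sum (comp_linearr g)). Qed.

(** Composites are kept right-nested, where g \oc f does not occur literally as soon as something
    precedes f; [ra] and [ra3] apply an equation in front of such a remaining factor k. *)
Lemma ra W X Y Z (g : hom Y Z) (f : hom X Y) (h : hom X Z) (k : hom W X) :
  g \oc f = h -> g \oc (f \oc k) = h \oc k.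
Proof. by move=> <-; rewrite compA. Qed.

Lemma ra3 V W X Y Z (g : hom Y Z) (f : hom X Y) (e : hom W X) (h : hom W Z)
    (k : hom V W) :
  g \oc (f \oc e) = h -> g \oc (f \oc (e \oc k)) = h \oc k.
Proof. by move=> <-; rewrite !compA. Qed.

(** Objects form an arbitrary type, so it is proof irrelevance that makes any two casts between the
    same objects agree; coherence of associators then comes for free. *)
Lemma eqm_refl X (e : X = X) : eqm e = idm X.
Proof. by rewrite (proof_irrelevance _ e erefl). Qed.

Lemma eqm_irr X Y (e e' : X = Y) : eqm e = eqm e'.
Proof. by rewrite (proof_irrelevance _ e e'). Qed.

Lemma eqmC X Y Z (e : X = Y) (e' : Y = Z) : eqm e' \oc eqm e = eqm (etrans e e').
Proof. by case: Z / e'; rewrite comp1m; apply: eqm_irr. Qed.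

Lemma eqmK X Y (e : X = Y) (e' : Y = X) : eqm e' \oc eqm e = idm X.
Proof. by rewrite eqmC eqm_refl. Qed.

Lemma eqmKA X Y Z (e : X = Y) (e' : Y = X) (k : hom Z X) :
  eqm e' \oc (eqm e \oc k) = k.
Proof. by rewrite compA eqmK comp1m. Qed.

Lemma eqmCA X Y Z W (e : X = Y) (e' : Y = Z) (k : hom W X) :
  eqm e' \oc (eqm e \oc k) = eqm (etrans e e') \oc k.
Proof. by rewrite compA eqmC. Qed.

End Lincat.

Section Tensor.
Variables (F : fieldType) (C : tensorcat F).
Implicit Types X Y Z W A B : ob C.

Lemma tensDl X Y X' Y' (f g : hom X Y) (h : hom X' Y') :
  (f + g) *t h = f *t h + g *t h.
Proof. exact: (linD (tensm_linearl (X:=X) (Y:=Y) h)). Qed.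

Lemma tensDr X Y X' Y' (h : hom X Y) (f g : hom X' Y') :
  h *t (f + g) = h *t f + h *t g.
Proof. exact: (linD (tensm_linearr (X':=X') (Y':=Y') h)). Qed.

Lemma tensZl X Y X' Y' c (f : hom X Y) (h : hom X' Y') :
  (c *: f) *t h = c *: (f *t h).
Proof. exact: (linZ (tensm_linearl (X:=X) (Y:=Y) h)). Qed.

Lemma tensZr X Y X' Y' c (h : hom X Y) (f : hom X' Y') :
  h *t (c *: f) = c *: (h *t f).
Proof. exact: (linZ (tensm_linearr (X':=X') (Y':=Y') h)). Qed.

Lemma tens0l X Y X' Y' (h : hom X' Y') : (0 : hom X Y) *t h = 0.
Proof. exact: (lin0 (tensm_linearl (X:=X) (Y:=Y) h)). Qed.

Lemma tens0r X Y X' Y' (h : hom X Y) : h *t (0 : hom X' Y') = 0.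
Proof. exact: (lin0 (tensm_linearr (X':=X') (Y':=Y') h)). Qed.

Lemma tens_suml X Y X' Y' I r (P : pred I) (f : I -> hom X Y) (h : hom X' Y') :
  (\sum_(i <- r | P i) f i) *t h = \sum_(i <- r | P i) (f i *t h).
Proof. exact: (lin_sum (tensm_linearl (X:=X) (Y:=Y) h)). Qed.

Lemma tens_sumr X Y X' Y' I r (P : pred I) (h : hom X Y) (f : I -> hom X' Y') :
  h *t (\sum_(i <- r | P i) f i) = \sum_(i <- r | P i) (h *t f i).
Proof. exact: (lin_sum (tensm_linearr (X':=X') (Y':=Y') h)). Qed.

Lemma tens_eqml X Y Z (e : X = Y) : eqm e *t idm Z = eqm (f_equal (tens^~ Z) e).
Proof. by case: Y / e; rewrite !eqm_refl tensm_idm. Qed.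

Lemma tens_eqmr X Y Z (e : X = Y) : idm Z *t eqm e = eqm (f_equal (tens Z) e).
Proof. by case: Y / e; rewrite !eqm_refl tensm_idm. Qed.

(* Diagrams are typed by right-nested words followed by an arbitrary tail Z: a
   box f becomes the family [at_ f Z], natural in Z, and no associator remains. *)
Fixpoint word (s : seq (ob C)) : ob C :=
  match s with
  | [::] => unit_ob
  | x :: s' => if s' is [::] then x else x ** word s'
  end.

Definition wtail (s : seq (ob C)) Z : ob C := foldr tens Z s.

Definition whisk (s : seq (ob C)) A B (g : hom A B) : hom (wtail s A) (wtail s B) :=
  (fix w s : hom (wtail s A) (wtail s B) :=
     if s is x :: s' then idm x *t w s' else g) s.

Lemma wtailE s Z : word s ** Z = wtail s Z.
Proof.
elim: s => [|x [|y s] IH] /=; first exact: tens1X.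
  by [].
by rewrite -tensA; congr (x ** _).
Qed.

Fact at_key : unit. Proof. exact: tt. Qed.

(* Sealed, so that rewriting does not look for composites inside it. *)
Definition at_ (s t : seq (ob C)) (f : hom (word s) (word t)) Z :
    hom (wtail s Z) (wtail t Z) :=
  locked_with at_key
    (eqm (wtailE t Z) \oc (f *t idm Z) \oc eqm (esym (wtailE s Z))).

Lemma at_E s t (f : hom (word s) (word t)) Z :
  at_ f Z = eqm (wtailE t Z) \oc (f *t idm Z) \oc eqm (esym (wtailE s Z)).
Proof. exact: locked_withE. Qed.

Lemma tens_interchange X Y X' Y' (f : hom X Y) (g : hom X' Y') :
  (f *t idm Y') \oc (idm X *t g) = (idm Y *t g) \oc (f *t idm X').
Proof. by rewrite -!tensm_compm !comp1m !compm1. Qed.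

Lemma tensm_idl X Y Z W (g : hom Z W) (f : hom Y Z) :
  (idm X *t g) \oc (idm X *t f) = idm X *t (g \oc f).
Proof. by rewrite -tensm_compm comp1m. Qed.

Lemma tensm_idr X Y Z W (g : hom Z W) (f : hom Y Z) :
  (g *t idm X) \oc (f *t idm X) = (g \oc f) *t idm X.
Proof. by rewrite -tensm_compm comp1m. Qed.

(** By induction on the word; the step is naturality of the associator. *)
Lemma whiskE s A B (g : hom A B) :
  whisk s g \oc eqm (wtailE s A) = eqm (wtailE s B) \oc (idm (word s) *t g).
Proof.
elim: s => [|x [|y s] IH].
- rewrite /= (eqm_irr (wtailE [::] A) (tens1X A)).
  by rewrite (eqm_irr (wtailE [::] B) (tens1X B)) tensm1f.
- by rewrite /= !eqm_refl comp1m compm1.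
have eW Z : eqm (wtailE (x :: y :: s) Z)
    = (idm x *t eqm (wtailE (y :: s) Z)) \oc eqm (esym (tensA x (word (y :: s)) Z)).
  by rewrite tens_eqmr eqmC; apply: eqm_irr.
rewrite !eW compA tensm_idl {}IH -tensm_idl -!compA; congr (_ \oc _).
have := tensmA (idm x) (idm (word (y :: s))) g.
rewrite tensm_idm => /(congr1 (fun k => eqm (esym (tensA x (word (y :: s)) B)) \oc k
   \oc eqm (esym (tensA x (word (y :: s)) A)))).
by rewrite -!compA eqmK compm1 !compA eqmK comp1m.
Qed.

(** This is the interchange law: f acts on the word and g on the tail. *)
Lemma at_nat s t (f : hom (word s) (word t)) A B (g : hom A B) :
  at_ f B \oc whisk s g = whisk t g \oc at_ f A.
Proof.
have E r : whisk r g = eqm (wtailE r B) \oc (idm (word r) *t g)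
    \oc eqm (esym (wtailE r A)).
  by rewrite -whiskE -compA eqmK compm1.
rewrite !E !at_E -!compA; congr (_ \oc _).
by rewrite !eqmKA; rewrite (ra _ (tens_interchange f g)) -!compA.
Qed.

Lemma at_comp s t u (g : hom (word t) (word u)) (f : hom (word s) (word t)) Z :
  at_ (s := s) (t := u) (g \oc f) Z = at_ g Z \oc at_ f Z.
Proof. by rewrite !at_E -!compA eqmKA -tensm_idr -!compA. Qed.

End Tensor.

(** * Duality and traces *)

Section Tails.
Variables (F : fieldType) (C : tensorcat F).
Implicit Types X Y Z W A B : ob C.

Lemma tensm_rassoc X Y Z X' Y' Z' (f : hom X X') (g : hom Y Y') (h : hom Z Z') :
  (f *t g) *t h = eqm (tensA X' Y' Z') \oc (f *t (g *t h)) \oc eqm (esym (tensA X Y Z)).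
Proof. by rewrite tensmA -compA eqmK compm1. Qed.

Lemma tens1f_eqm X Y (f : hom X Y) :
  idm unit_ob *t f = eqm (esym (tens1X Y)) \oc f \oc eqm (tens1X X).
Proof. by rewrite -compA -tensm1f eqmKA. Qed.

Lemma tensf1_eqm X Y (f : hom X Y) :
  f *t idm unit_ob = eqm (esym (tensX1 Y)) \oc f \oc eqm (tensX1 X).
Proof. by rewrite -compA -tensmf1 eqmKA. Qed.

Definition at02 B B' (f : hom unit_ob (B ** B')) Z : hom Z (B ** (B' ** Z)) :=
  at_ (s := [::]) (t := [:: B; B']) f Z.
Definition at20 A A' (f : hom (A ** A') unit_ob) Z : hom (A ** (A' ** Z)) Z :=
  at_ (s := [:: A; A']) (t := [::]) f Z.
Definition at12 A B B' (f : hom A (B ** B')) Z : hom (A ** Z) (B ** (B' ** Z)) :=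
  at_ (s := [:: A]) (t := [:: B; B']) f Z.
Definition at21 A A' B (f : hom (A ** A') B) Z : hom (A ** (A' ** Z)) (B ** Z) :=
  at_ (s := [:: A; A']) (t := [:: B]) f Z.
Definition at22 A A' B B' (f : hom (A ** A') (B ** B')) Z :
    hom (A ** (A' ** Z)) (B ** (B' ** Z)) :=
  at_ (s := [:: A; A']) (t := [:: B; B']) f Z.

Section Natural.
Variables (A A' B B' Z Z' : ob C) (g : hom Z Z').

Lemma nat02 (f : hom unit_ob (B ** B')) :
  at02 f Z' \oc g = (idm B *t (idm B' *t g)) \oc at02 f Z.
Proof. exact: (@at_nat _ _ [::] [:: B; B']). Qed.

Lemma nat20 (f : hom (A ** A') unit_ob) :
  at20 f Z' \oc (idm A *t (idm A' *t g)) = g \oc at20 f Z.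
Proof. exact: (@at_nat _ _ [:: A; A'] [::]). Qed.

Lemma nat12 (f : hom A (B ** B')) :
  at12 f Z' \oc (idm A *t g) = (idm B *t (idm B' *t g)) \oc at12 f Z.
Proof. exact: (@at_nat _ _ [:: A] [:: B; B']). Qed.

Lemma nat21 (f : hom (A ** A') B) :
  at21 f Z' \oc (idm A *t (idm A' *t g)) = (idm B *t g) \oc at21 f Z.
Proof. exact: (@at_nat _ _ [:: A; A'] [:: B]). Qed.

Lemma nat22 (f : hom (A ** A') (B ** B')) :
  at22 f Z' \oc (idm A *t (idm A' *t g)) = (idm B *t (idm B' *t g)) \oc at22 f Z.
Proof. exact: (@at_nat _ _ [:: A; A'] [:: B; B']). Qed.
End Natural.

Lemma at22_comp A A' B B' D D' (g : hom (B ** B') (D ** D')) (f : hom (A ** A') (B ** B')) Z :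
  at22 (g \oc f) Z = at22 g Z \oc at22 f Z.
Proof. exact: (@at_comp _ _ [:: A; A'] [:: B; B'] [:: D; D']). Qed.

Lemma at212_comp A A' B D D' (g : hom B (D ** D')) (f : hom (A ** A') B) Z :
  at22 (g \oc f) Z = at12 g Z \oc at21 f Z.
Proof. exact: (@at_comp _ _ [:: A; A'] [:: B] [:: D; D']). Qed.

Lemma at122_comp A B B' D D' (g : hom (B ** B') (D ** D')) (f : hom A (B ** B')) Z :
  at12 (g \oc f) Z = at22 g Z \oc at12 f Z.
Proof. exact: (@at_comp _ _ [:: A] [:: B; B'] [:: D; D']). Qed.

Lemma at22E A A' B B' (f : hom (A ** A') (B ** B')) Z :
  at22 f Z = eqm (esym (tensA B B' Z)) \oc (f *t idm Z) \oc eqm (tensA A A' Z).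
Proof. by rewrite /at22 at_E; congr (_ \oc _ \oc _); apply: eqm_irr. Qed.

Lemma at12E A B B' (f : hom A (B ** B')) Z :
  at12 f Z = eqm (esym (tensA B B' Z)) \oc (f *t idm Z).
Proof.
by rewrite /at12 at_E (eqm_refl (esym _)) compm1; congr (_ \oc _); apply: eqm_irr.
Qed.

Lemma at21E A A' B (f : hom (A ** A') B) Z :
  at21 f Z = (f *t idm Z) \oc eqm (tensA A A' Z).
Proof.
by rewrite /at21 at_E (eqm_refl (wtailE [:: B] _)) comp1m; congr (_ \oc _); apply: eqm_irr.
Qed.

Lemma at02E B B' (f : hom unit_ob (B ** B')) Z :
  at02 f Z = eqm (esym (tensA B B' Z)) \oc (f *t idm Z) \oc eqm (esym (tens1X Z)).
Proof. by rewrite /at02 at_E; congr (_ \oc _ \oc _); apply: eqm_irr. Qed.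

Lemma at20E A A' (f : hom (A ** A') unit_ob) Z :
  at20 f Z = eqm (tens1X Z) \oc (f *t idm Z) \oc eqm (tensA A A' Z).
Proof. by rewrite /at20 at_E; congr (_ \oc _ \oc _); apply: eqm_irr. Qed.

Lemma at22_idl A B B' (f : hom B B') Z :
  at22 (idm A *t f) Z = idm A *t (f *t idm Z).
Proof. by rewrite at22E tensm_rassoc -!compA eqmK compm1 eqmKA. Qed.

Lemma at22_idr A B B' (f : hom B B') Z :
  at22 (f *t idm A) Z = f *t idm (A ** Z).
Proof. by rewrite at22E tensm_rassoc tensm_idm -!compA eqmK compm1 eqmKA. Qed.

End Tails.

(* Moves the strictness casts of both sides together and compares the rest. *)
Ltac push_eqm :=
  rewrite -?(tensm_idl, tensm_idr) ?(tens_eqml, tens_eqmr) -?compA ?eqmCA ?eqmC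
    ?eqm_refl ?comp1m ?compm1.
Ltac match_eqm := repeat first [exact: eqm_irr | reflexivity | congr (_ \oc _)].

Section Duality.
Variables (F : fieldType) (C : spherical F).
Implicit Types X Y Z W A B : ob C.

Definition evt X Z : hom (X ** (dual X ** Z)) Z := at20 (ev X) Z.
Definition coevt X Z : hom Z (X ** (dual X ** Z)) := at02 (coev X) Z.
Definition evt' X Z : hom (dual X ** (X ** Z)) Z := at20 (ev' X) Z.
Definition coevt' X Z : hom Z (dual X ** (X ** Z)) := at02 (coev' X) Z.

Lemma evtE X Z :
  evt X Z = eqm (tens1X Z) \oc (ev X *t idm Z) \oc eqm (tensA X (dual X) Z).
Proof. exact: at20E. Qed.

Lemma evt'E X Z :
  evt' X Z = eqm (tens1X Z) \oc (ev' X *t idm Z) \oc eqm (tensA (dual X) X Z).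
Proof. exact: at20E. Qed.

Lemma coevtE X Z :
  coevt X Z = eqm (esym (tensA X (dual X) Z)) \oc (coev X *t idm Z)
    \oc eqm (esym (tens1X Z)).
Proof. exact: at02E. Qed.

Lemma coevt'E X Z :
  coevt' X Z = eqm (esym (tensA (dual X) X Z)) \oc (coev' X *t idm Z)
    \oc eqm (esym (tens1X Z)).
Proof. exact: at02E. Qed.

Lemma evt_nat X Z W (g : hom Z W) :
  evt X W \oc (idm X *t (idm (dual X) *t g)) = g \oc evt X Z.
Proof. exact: nat20. Qed.

Lemma evt'_nat X Z W (g : hom Z W) :
  evt' X W \oc (idm (dual X) *t (idm X *t g)) = g \oc evt' X Z.
Proof. exact: nat20. Qed.

Lemma coevt_nat X Z W (g : hom Z W) :
  coevt X W \oc g = (idm X *t (idm (dual X) *t g)) \oc coevt X Z.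
Proof. exact: nat02. Qed.

Lemma coevt'_nat X Z W (g : hom Z W) :
  coevt' X W \oc g = (idm (dual X) *t (idm X *t g)) \oc coevt' X Z.
Proof. exact: nat02. Qed.

Lemma zz1 X Z : evt X (X ** Z) \oc (idm X *t coevt' X Z) = idm (X ** Z).
Proof.
have := congr1 (fun h => h *t idm Z) (zigzag X); rewrite tensm_idm => <-.
rewrite evtE coevt'E; push_eqm.
by rewrite !tensm_rassoc tensm_idm; push_eqm; match_eqm.
Qed.

Lemma zz2 X Z : (idm X *t evt' X Z) \oc coevt X (X ** Z) = idm (X ** Z).
Proof.
have := congr1 (fun h => h *t idm Z) (zigzag' X); rewrite tensm_idm => <-.
rewrite evt'E coevtE; push_eqm.
by rewrite !tensm_rassoc tensm_idm; push_eqm; match_eqm.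
Qed.

Lemma coev_cast X Y (e : X = Y) (e' : X ** dual X = Y ** dual Y) :
  coev Y = eqm e' \oc coev X.
Proof. by case: Y / e e' => e'; rewrite eqm_refl comp1m. Qed.

Lemma ev_cast X Y (e : X = Y) (e' : Y ** dual Y = X ** dual X) :
  ev Y = ev X \oc eqm e'.
Proof. by case: Y / e e' => e'; rewrite eqm_refl compm1. Qed.

Lemma evt'_dual X Z :
  evt' (dual X) Z = evt X Z \oc (eqm (dualK X) *t idm (dual X ** Z)).
Proof.
have e : dual (dual X) ** dual (dual (dual X)) = X ** dual X by rewrite !dualK.
rewrite evtE evt'E /ev' (ev_cast (esym (dualK X)) e).
by push_eqm; match_eqm.
Qed.

Lemma coevt'_dual X Z :
  coevt' (dual X) Z = (eqm (esym (dualK X)) *t idm (dual X ** Z)) \oc coevt X Z.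
Proof.
have e : X ** dual X = dual (dual X) ** dual (dual (dual X)) by rewrite !dualK.
rewrite coevtE coevt'E /coev' (coev_cast (esym (dualK X)) e).
by push_eqm; match_eqm.
Qed.

Lemma evt_dual X Z :
  evt (dual X) Z = evt' X Z \oc (idm (dual X) *t (eqm (dualK X) *t idm Z)).
Proof.
by rewrite evtE evt'E /ev'; push_eqm; match_eqm.
Qed.

Lemma coevt_dual X Z :
  coevt (dual X) Z = (idm (dual X) *t (eqm (esym (dualK X)) *t idm Z)) \oc coevt' X Z.
Proof.
by rewrite coevtE coevt'E /coev'; push_eqm; match_eqm.
Qed.

(** The zigzag identities of [dual X] are the remaining ones of X, once the second dual is
    identified with X. *)
Lemma zz3 X Z : (idm (dual X) *t evt X Z) \oc coevt' X (dual X ** Z) = idm (dual X ** Z).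
Proof.
rewrite -(zz2 (dual X)) evt'_dual coevt_dual -!tensm_idl -!compA; congr (_ \oc _).
by rewrite compA !tens_eqml !tens_eqmr eqmK comp1m.
Qed.

Lemma zz4 X Z : evt' X (dual X ** Z) \oc (idm (dual X) *t coevt X Z) = idm (dual X ** Z).
Proof.
rewrite -(zz1 (dual X)) evt_dual coevt'_dual -!tensm_idl -!compA; congr (_ \oc _).
by rewrite compA !tens_eqml !tens_eqmr eqmK comp1m.
Qed.

(* The partial trace of h over the strand v. *)
Definition lptr v Z A (h : hom (v ** Z) (v ** A)) : hom Z A :=
  locked_with at_key (evt' v A \oc (idm (dual v) *t h) \oc coevt' v Z).

Lemma lptrE v Z A (h : hom (v ** Z) (v ** A)) :
  lptr h = evt' v A \oc (idm (dual v) *t h) \oc coevt' v Z.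
Proof. exact: locked_withE. Qed.

Lemma lptr_natr v Z Z' A (h : hom (v ** Z') (v ** A)) (k : hom Z Z') :
  lptr (h \oc (idm v *t k)) = lptr h \oc k.
Proof. by rewrite !lptrE -!compA coevt'_nat -tensm_idl -!compA. Qed.

Lemma lptr_natl v Z A A' (h : hom (v ** Z) (v ** A)) (k : hom A A') :
  lptr ((idm v *t k) \oc h) = k \oc lptr h.
Proof. by rewrite !lptrE !compA -evt'_nat -tensm_idl !compA. Qed.

Lemma lptr_linear v Z A : linear (@lptr v Z A).
Proof.
move=> c f g; rewrite !lptrE tensDr tensZr compDr compZr.
by rewrite compDl compZl.
Qed.

Lemma lptr_tens v Z A T (h : hom (v ** Z) (v ** A)) :
  lptr h *t idm T = lptr (at22 h T).
Proof.
rewrite !lptrE !evt'E !coevt'E at22E; push_eqm.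
by rewrite !tensm_rassoc !tensm_idm; push_eqm; match_eqm.
Qed.

Lemma tens_idm_cast X Y A B (f : hom X Y) (e : A = B) :
  f *t idm A = eqm (f_equal (tens Y) (esym e)) \oc (f *t idm B) \oc eqm (f_equal (tens X) e).
Proof. by case: B / e; rewrite !eqm_refl comp1m compm1. Qed.

Lemma tens_cast_idm X Y A B (f : hom X Y) (e : A = B) :
  idm A *t f = eqm (f_equal (tens^~ Y) (esym e)) \oc (idm B *t f) \oc eqm (f_equal (tens^~ X) e).
Proof. by case: B / e; rewrite !eqm_refl comp1m compm1. Qed.

(** An instance of [evM] at the duals of Y and X. The cast e is left arbitrary, so that any proof of
    the equality can be supplied. *)
Lemma evt'M X Y T (e : dual (X ** Y) ** ((X ** Y) ** T)
                       = dual Y ** (dual X ** (X ** (Y ** T)))) :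
  evt' (X ** Y) T = evt' Y T \oc (idm (dual Y) *t evt' X (Y ** T)) \oc eqm e.
Proof.
have e' : dual (X ** Y) ** dual (dual (X ** Y))
    = (dual Y ** dual X) ** dual (dual Y ** dual X) by rewrite dualM.
rewrite !evt'E /ev' (ev_cast (esym (dualM X Y)) e') evM; push_eqm.
rewrite (tens_idm_cast (ev (dual X)) (f_equal (tens^~ T) (esym (dualK Y)))).
by rewrite !tensm_rassoc tensm_idm; push_eqm; match_eqm.
Qed.

Lemma coevt'M X Y T (e : dual (X ** Y) ** ((X ** Y) ** T)
                       = dual Y ** (dual X ** (X ** (Y ** T)))) :
  coevt' (X ** Y) T = eqm (esym e) \oc (idm (dual Y) *t coevt' X (Y ** T)) \oc coevt' Y T.
Proof.
have e' : (dual Y ** dual X) ** dual (dual Y ** dual X)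
  = dual (X ** Y) ** dual (dual (X ** Y)) by rewrite (dualM X Y).
rewrite !coevt'E /coev' (coev_cast (esym (dualM X Y)) e') coevM; push_eqm.
rewrite (tens_idm_cast (coev (dual X)) (f_equal (tens^~ T) (esym (dualK Y)))).
by rewrite !tensm_rassoc tensm_idm; push_eqm; match_eqm.
Qed.

(** * The spherical trace: closed strands and cyclicity *)

Section Trace.
Hypothesis one_simple : simple_ob (@unit_ob F C).

Lemma one_neq0 : idm (@unit_ob F C) <> 0.
Proof.
move=> i0; have [c [_ U]] := one_simple (idm unit_ob).
have e d : idm (@unit_ob F C) = d *: idm unit_ob by rewrite i0 scaler0.
by have /eqP := U 0 (e 0); rewrite (U 1 (e 1)) oner_eq0.
Qed.

Lemma scalar_ofE (f : hom (@unit_ob F C) unit_ob) : f = scalar_of f *: idm unit_ob.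
Proof.
have [c [fc _]] := one_simple f.
have fr : free [tuple idm (@unit_ob F C)] by rewrite seq1_free; apply/eqP/one_neq0.
rewrite /scalar_of {1 2}fc; congr (_ *: _).
by rewrite linearZ /= (coord_free ord0 ord0 fr) eqxx mulr1.
Qed.

Definition tr X (h : hom X X) : F := scalar_of (trace h).

Lemma tr'E X (h : hom X X) : trace' h = tr h *: idm unit_ob.
Proof. by rewrite -sphere -scalar_ofE. Qed.

Lemma trT X (h : hom X X) Z :
  evt X Z \oc (h *t idm (dual X ** Z)) \oc coevt X Z = tr h *: idm Z.
Proof.
transitivity (eqm (tens1X Z) \oc (trace h *t idm Z) \oc eqm (esym (tens1X Z))).
  rewrite /trace !evtE !coevtE; push_eqm.
  by rewrite !tensm_rassoc tensm_idm; push_eqm; match_eqm.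
rewrite (scalar_ofE (trace h)) tensZl tensm_idm compZr compm1 compZl eqmC.
by rewrite eqm_refl.
Qed.

(** The strand closes up on the left and gives [trace']; sphericity turns this into [tr]. *)
Lemma lptr_id X (h : hom X X) Z : lptr (h *t idm Z) = tr h *: idm Z.
Proof.
transitivity (eqm (tens1X Z) \oc (trace' h *t idm Z) \oc eqm (esym (tens1X Z))).
  rewrite /trace' lptrE !evt'E !coevt'E; push_eqm.
  by rewrite !tensm_rassoc; push_eqm; match_eqm.
rewrite tr'E tensZl tensm_idm compZr compm1 compZl eqmC.
by rewrite eqm_refl.
Qed.

Lemma scale1_inj (c d : F) : c *: idm (@unit_ob F C) = d *: idm unit_ob -> c = d.
Proof.
move/eqP; rewrite -subr_eq0 -scalerBl scaler_eq0 => /orP[|/eqP/one_neq0 //].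
by rewrite subr_eq0 => /eqP.
Qed.

Lemma tr_linear X : linear (@tr X : hom X X -> F^o).
Proof.
move=> c f g; apply: scale1_inj; rewrite scalerDl -scalerA -!lptr_id.
by rewrite tensDl tensZl (lptr_linear c).
Qed.

Lemma trD X (f g : hom X X) : tr (f + g) = tr f + tr g.
Proof. exact: (linD (@tr_linear X)). Qed.

Lemma trZ X c (f : hom X X) : tr (c *: f) = c * tr f.
Proof. exact: (linZ (@tr_linear X)). Qed.

Lemma tr0 X : tr (0 : hom X X) = 0.
Proof. exact: (lin0 (@tr_linear X)). Qed.

Lemma tr_sum X I r (P : pred I) (f : I -> hom X X) :
  tr (\sum_(i <- r | P i) f i) = \sum_(i <- r | P i) tr (f i).
Proof. exact: (lin_sum (@tr_linear X)). Qed.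

(** Caps and cups of a product are nested, so closing v ** Z is closing v first and Z afterwards. *)
Lemma tr_lptr v Z (h : hom (v ** Z) (v ** Z)) : tr (lptr h) = tr h.
Proof.
apply: scale1_inj; rewrite -!lptr_id lptr_tens !lptrE.
have e T : dual (v ** Z) ** ((v ** Z) ** T) = dual Z ** (dual v ** (v ** (Z ** T))).
  by rewrite dualM !tensA.
rewrite (evt'M (e _)) (coevt'M (e _)) at22E (tens_cast_idm _ (dualM v Z)).
by rewrite -tensm_idm !tensm_rassoc; push_eqm; match_eqm.
Qed.

Lemma ev_slide X Y (s : hom X Y) Z :
  evt Y Z \oc (s *t idm (dual Y ** Z)) = evt X Z \oc (idm X *t (rdual s *t idm Z)).
Proof.
have -> : rdual s *t idm Z = (idm (dual X) *t evt Y Z)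
    \oc (idm (dual X) *t (s *t idm (dual Y ** Z))) \oc coevt' X (dual Y ** Z).
  rewrite /rdual evtE coevt'E; push_eqm.
  by rewrite !tensm_rassoc !tensm_idm; push_eqm; match_eqm.
rewrite -compA -!tensm_idl !(ra _ (evt_nat _ _)) -!compA; congr (_ \oc _).
by rewrite (ra _ (evt_nat _ _)) -compA zz1 compm1.
Qed.

Lemma coev_slide X Y (s : hom X Y) Z :
  (s *t idm (dual X ** Z)) \oc coevt X Z = (idm Y *t (ldual s *t idm Z)) \oc coevt Y Z.
Proof.
have -> : ldual s *t idm Z = evt' Y (dual X ** Z)
    \oc (idm (dual Y) *t (s *t idm (dual X ** Z))) \oc (idm (dual Y) *t coevt X Z).
  rewrite /ldual evt'E coevtE; push_eqm.
  by rewrite !tensm_rassoc !tensm_idm; push_eqm; match_eqm.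
rewrite -!tensm_idl -compA -compA -(coevt_nat Y).
by rewrite (ra _ (esym (coevt_nat Y _))) -compA (ra _ (zz2 Y _)) comp1m.
Qed.

(** The factor g slides over the cap as its right dual and returns through the cup as its left dual;
    pivotality identifies the two. *)
Lemma trC X Y (f : hom X Y) (g : hom Y X) : tr (g \oc f) = tr (f \oc g).
Proof.
apply: scale1_inj; rewrite -!trT -!tensm_idr.
rewrite compA ev_slide -!compA; congr (_ \oc _).
rewrite (ra _ (esym (tens_interchange f _))) -compA pivotal -coev_slide.
by rewrite !compA.
Qed.

Definition rptr v X Y (h : hom (X ** v) (Y ** v)) : hom X Y :=
  eqm (tensX1 Y) \oc (idm Y *t ev v) \oc eqm (esym (tensA Y v (dual v)))
    \oc (h *t idm (dual v)) \oc eqm (tensA X v (dual v)) \oc (idm X *t coev v)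
    \oc eqm (esym (tensX1 X)).

Lemma tr_rptr v X (h : hom (X ** v) (X ** v)) : tr (rptr h) = tr h.
Proof.
rewrite /tr; congr scalar_of.
rewrite /trace /rptr coevM evM; push_eqm.
rewrite (tens_idm_cast h (dualM X v)) !tensm_rassoc ?tensm_idm.
by push_eqm; match_eqm.
Qed.

Lemma tr_id X : tr (idm X) = dim_ob X.
Proof. by rewrite /tr /trace tensm_idm compm1. Qed.

Lemma tr_tens1 v X (t : hom X X) : tr (t *t idm v) = tr t * dim_ob v.
Proof. by rewrite -tr_lptr lptr_id trZ tr_id. Qed.

End Trace.
End Duality.

(** * Trace-dual bases and resolutions of the identity *)

Section DualBases.
Variables (F : fieldType) (U V : vectType F) (B : U -> V -> F).
Hypothesis B_linl : forall v, linear (B^~ v : U -> F^o).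
Hypothesis B_linr : forall u, linear (B u : V -> F^o).
Hypothesis B_ndl : forall u, (forall v, B u v = 0) -> u = 0.
Hypothesis B_ndr : forall v, (forall u, B u v = 0) -> v = 0.

Definition gram : 'M[F]_(\dim {:U}, \dim {:V}) :=
  \matrix_(m, n) B (vbasis {:U})`_m (vbasis {:V})`_n.

(** The formula of [bneg] for a general pairing. The Gram matrix is not known to be square at this
    point; [pinvmx] is a right inverse because its rows are free. *)
Definition dbasis (m : 'I_(\dim {:U})) : V :=
  \sum_n pinvmx gram n m *: (vbasis {:V})`_n.

Lemma gram_free : row_free gram.
Proof.
apply/inj_row_free => w w0; pose u := \sum_i w 0 i *: (vbasis {:U})`_i.
suff u0 : u = 0.
  have /freeP H := basis_free (vbasisP {:U}).
  by apply/rowP => i; rewrite mxE; apply: H.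
apply: B_ndl => v; rewrite (coord_vbasis (memvf v)) (lin_sum (@B_linr u)).

apply: big1 => j _; rewrite (linZ (@B_linr u)).
have := congr1 (fun A : 'rV_ _ => A 0 j) w0; rewrite !mxE => w0j.
suff -> : B u (vbasis {:V})`_j = 0 by rewrite scaler0.
rewrite -[RHS]w0j.
rewrite (lin_sum (@B_linl _)); apply: eq_bigr => i _.
by rewrite (linZ (@B_linl _)) mxE.
Qed.

Lemma B_dbasis (m m' : 'I_(\dim {:U})) : B (vbasis {:U})`_m (dbasis m') = (m == m')%:R.
Proof.
have := congr1 (fun A : 'M_ _ => A m m') (mulmxVp gram_free); rewrite !mxE => <-.
rewrite (lin_sum (@B_linr _)); apply: eq_bigr => n _.
rewrite (linZ (@B_linr _)) [gram m n]mxE; apply: mulrC.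
Qed.

Lemma dbasis_suml x : \sum_(m < \dim {:U}) B x (dbasis m) *: (vbasis {:U})`_m = x.
Proof.
rewrite [RHS](coord_vbasis (memvf x)); apply: eq_bigr => m _; congr (_ *: _).
rewrite {1}(coord_vbasis (memvf x)) (lin_sum (@B_linl _)) (bigD1 m) //=.
rewrite (linZ (@B_linl _)) B_dbasis eqxx big1 => [|n nm].
  by rewrite addr0 -[LHS]/(_ * 1) mulr1.
by rewrite (linZ (@B_linl _)) B_dbasis (negPf nm) scaler0.
Qed.

Lemma dbasis_sumr y : \sum_(m < \dim {:U}) B (vbasis {:U})`_m y *: dbasis m = y.
Proof.
apply/eqP; rewrite -subr_eq0; apply/eqP; apply: B_ndr => u.
rewrite (linB (@B_linr _)) (lin_sum (@B_linr _)) -{2}(dbasis_suml u).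
rewrite (lin_sum (@B_linl _)) -sumrB big1 // => m _.
by rewrite (linZ (@B_linr _)) (linZ (@B_linl _)); apply/eqP; rewrite subr_eq0; apply/eqP/mulrC.
Qed.

End DualBases.

(** * Semisimplicity: nonzero dimensions, nondegeneracy of the trace, generalized inverses *)

Section Spherical.
Variables (F : fieldType) (C : spherical F).
Hypothesis C_semisimple : semisimple C.
Hypothesis one_simple : simple_ob (@unit_ob F C).
Implicit Types A B S T W Y Z : ob C.

Lemma simple_neq0 S : simple_ob S -> idm S <> 0.
Proof.
move=> sS i0; have [c [_ U]] := sS (idm S).
have e d : idm S = d *: idm S by rewrite i0 scaler0.
by have /eqP := U 0 (e 0); rewrite (U 1 (e 1)) oner_eq0.
Qed.

Lemma simple_scalar S (f : hom S S) : simple_ob S -> exists c, f = c *: idm S.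
Proof. by move=> sS; have [c [fc _]] := sS f; exists c. Qed.

Lemma schur S T (f : hom S T) : simple_ob S -> simple_ob T -> f <> 0 ->
  isomorphic S T.
Proof.
move=> sS sT f0; apply: NNPP => nST; apply: f0.
by have [_ _ _] := C_semisimple; apply.
Qed.

(** With source and target decomposed into simple objects, some matrix entry of f is nonzero, hence
    invertible up to a scalar by Schur's lemma; rescaling it gives a and b. *)
Lemma neq0_simple A B (f : hom A B) : f <> 0 ->
  exists S (a : hom S A) (b : hom B S), simple_ob S /\ b \oc f \oc a = idm S.
Proof.
move=> f0; have [_ _ dec _] := C_semisimple.
have [n [S [sS [i [p [_ _ iA]]]]]] := dec A.
have [m [T [sT [j [q [_ _ jB]]]]]] := dec B.
have [[k [l qfi]]|H] := classic (exists k l, q l \oc f \oc i k <> 0); last first.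
  case: f0; rewrite -[f]compm1 -iA -[f]comp1m -jB comp_suml comp_suml.
  apply: big1 => l _; rewrite comp_sumr; apply: big1 => k _.
  have -> : j l \oc q l \oc f \oc (i k \oc p k) = j l \oc (q l \oc f \oc i k) \oc p k.
    by rewrite !compA.
  suff -> : q l \oc f \oc i k = 0 by rewrite comp0r comp0l.
  by apply: NNPP => e; apply: H; exists k, l.
have [u [v [vu uv]]] := schur (sS k) (sT l) qfi.
have [c vc] := simple_scalar (v \oc (q l \oc f \oc i k)) (sS k).
have c0 : c != 0.
  apply/eqP => c0; apply: qfi; rewrite -[LHS]comp1m -uv -compA vc c0 scale0r.
  exact: comp0r.
exists (S k), (i k), (c^-1 *: (v \oc q l)); split=> //.
by rewrite !compZl -!compA [v \oc _]compA in vc *; rewrite vc scalerA mulVf ?scale1r.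
Qed.

Lemma tail1_inj A B (f g : hom A B) :
  f *t idm unit_ob = g *t idm (@unit_ob F C) -> f = g.
Proof.
move=> e; have : f \oc eqm (tensX1 A) = g \oc eqm (tensX1 A) by rewrite -!tensmf1 e.
move/(congr1 (fun k => k \oc eqm (esym (tensX1 A)))).
by rewrite -!compA eqmK !compm1.
Qed.

Definition unbend S (h : hom (S ** dual S) unit_ob) : hom S S :=
  eqm (tens1X S) \oc (h *t idm S) \oc eqm (tensA S (dual S) S)
    \oc (idm S *t coev' S) \oc eqm (esym (tensX1 S)).

Lemma unbend_tail S (h : hom (S ** dual S) unit_ob) Z :
  unbend h *t idm Z = at20 h (S ** Z) \oc (idm S *t coevt' S Z).
Proof.
rewrite /unbend coevt'E at20E; push_eqm.
by rewrite !tensm_rassoc !tensm_idm; push_eqm; match_eqm.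
Qed.

Lemma bend_unbend S (h : hom (S ** dual S) unit_ob) Z :
  at20 h Z = evt S Z \oc (unbend h *t idm (dual S ** Z)).
Proof.
rewrite unbend_tail compA -nat20 -compA.
by rewrite !tensm_idl zz3 tensm_idm compm1.
Qed.

Lemma coev_neq0 S : idm S <> 0 -> coev S <> 0.
Proof.
move=> iS c0; apply: iS; apply: tail1_inj.
by rewrite tens0l tensm_idm -zz2 coevtE c0 tens0l comp0r comp0l comp0r.
Qed.

(** A nonzero coevaluation detects a simple summand, which is then the unit, so some h : S ** dual S
    -> 1 does not kill it. Unbending h gives an endomorphism of S, a scalar c, so h is c times the
    evaluation and h \oc coev S is c d(S). This would vanish if d(S) did. *)
Lemma dim_neq0 S : simple_ob S -> dim_ob S != 0.
Proof.
move=> sS; apply/eqP => d0.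
have [T [a [b [sT baE]]]] := neq0_simple (coev_neq0 (simple_neq0 sS)).
have [a0|a0] := classic (a = 0).
  by case: (simple_neq0 sT); rewrite -baE a0 comp0r.
have [u [v [vu _]]] := schur sT one_simple a0.
pose h := u \oc b; have [c hc] := simple_scalar (unbend h) sS.
have h0 : h \oc coev S = 0.
  apply: tail1_inj; rewrite tens0l -tensm_idr.
  have := bend_unbend h unit_ob; rewrite hc tensZl tensm_idm compZr compm1.
  move/(congr1 (fun k => k \oc coevt S unit_ob)); rewrite compZl.
  have -> : evt S unit_ob \oc coevt S unit_ob = dim_ob S *: idm unit_ob.
    by rewrite -tr_id -trT // tensm_idm compm1.
  rewrite d0 scale0r scaler0 at20E coevtE -!compA eqmKA.
  move/(congr1 (fun k => eqm (esym (tens1X unit_ob)) \oc k \oc eqm (tens1X unit_ob))).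
  by rewrite comp0r comp0l -!compA eqmKA eqmK compm1.
case: (simple_neq0 sT); rewrite -baE -[b]comp1m -vu -!compA (compA u) -/h.
by rewrite (compA h) h0 comp0l comp0r.
Qed.

Lemma tr_nondegl A B (f : hom A B) : (forall g : hom B A, tr (g \oc f) = 0) -> f = 0.
Proof.
move=> H; apply: NNPP => f0; have [S [a [b [sS baf]]]] := neq0_simple f0.
have /eqP := H (a \oc b); rewrite -compA trC // baf tr_id.
by rewrite (negPf (dim_neq0 sS)).
Qed.

Lemma tr_nondegr A B (f : hom A B) : (forall g : hom B A, tr (f \oc g) = 0) -> f = 0.
Proof. by move=> H; apply: tr_nondegl => g; rewrite trC. Qed.

Lemma comp_linfun A B T (f : hom A B) (h : hom T A) :
  linfun (compm f : hom T A -> hom T B) h = f \oc h.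
Proof.
pose L := GRing.isLinear.Build F (hom T A) (hom T B) _ (compm f) (comp_linearr (X := T) f).
pose f' : {linear hom T A -> hom T B} := HB.pack (compm f) L.
exact: (lfunE f').
Qed.

(* Splits off simple summands of f one at a time; the measure is the dimension
   of the space of the composites f \oc h. *)
Lemma regular A B (f : hom A B) : exists g : hom B A, f \oc g \oc f = f.
Proof.
have [n] := ubnP (\dim (limg (linfun (compm f : hom B A -> hom B B)))).
elim: n => // n IH in f *; rewrite ltnS => le_n.
have [->|f0] := classic (f = 0); first by exists 0; rewrite comp0r.
have [S [a [b [sS baf]]]] := neq0_simple f0.
pose f' := f - (f \oc a \oc b \oc f).
have bf' : b \oc f' = 0 by rewrite compBr !compA baf comp1m subrr.
pose img (k : hom A B) := limg (linfun (compm k : hom B A -> hom B B)).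
have sub : (img f' <= img f)%VS.
  apply/subvP => _ /memv_imgP[h _ ->]; apply/memv_imgP.
  exists (h - (a \oc b \oc f \oc h)); first exact: memvf.
  by rewrite !comp_linfun compBl compBr !compA.
have [|g' gE] := IH f'.
  (* The image really shrinks: otherwise f a b = f' h for some h, and applying b, which kills f',
     gives b = b f a b = 0. *)
  apply: leq_trans le_n; rewrite -/(img f) -/(img f') ltnNge; apply/negP => le_d.
  have e : img f' = img f by apply/eqP; rewrite eqEdim sub.
  have : f \oc (a \oc b) \in img f.
    by apply/memv_imgP; exists (a \oc b); [exact: memvf | rewrite comp_linfun].
  rewrite -e => /memv_imgP[h _]; rewrite comp_linfun => fab.
  apply: (simple_neq0 sS); rewrite -baf -[b]comp1m -{1}baf -!compA (compA a).
  by rewrite (compA f) fab (compA b) (compA b) bf' !comp0l.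
(* The pair a, b inverts the summand just split off and g' inverts f'. The outer factors are
   complementary projections, chosen so that f composed with either of them is f'. *)
pose g := (a \oc b) + ((idm A - (a \oc b \oc f)) \oc g' \oc (idm B - (f \oc a \oc b))).
exists g; rewrite compDr compDl -[RHS](subrK (f \oc a \oc b \oc f)) -/f' addrC.
congr (_ + _); last by rewrite !compA.
have e1 : f \oc (idm A - (a \oc b \oc f)) = f' by rewrite compBr compm1 !compA.
have e2 : (idm B - (f \oc a \oc b)) \oc f = f' by rewrite compBl comp1m.
by rewrite -[RHS]gE -{1}e1 -e2 !compA.
Qed.

Section TraceDual.
Variables (A B : ob C).

(** Only the copairing, the sum of the x_i tensor y_i, is pinned down. The families may be longer
    than a basis, which allows padding by zeros and indexing through an intermediate simple
    object. *)
Definition dualfam (I : finType) (x : I -> hom A B) (y : I -> hom B A) : Prop :=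
  (forall g, \sum_i tr (y i \oc g) *: x i = g) /\
  (forall h, \sum_i tr (h \oc x i) *: y i = h).

Let pair (f : hom A B) (g : hom B A) : F := tr (g \oc f).

Lemma pair_linl g : linear (pair^~ g : hom A B -> F^o).
Proof. by move=> c f f'; rewrite /pair compDr compZr (tr_linear one_simple). Qed.

Lemma pair_linr f : linear (pair f : hom B A -> F^o).
Proof. by move=> c g g'; rewrite /pair compDl compZl (tr_linear one_simple). Qed.

Lemma pair_ndr g : (forall f, pair f g = 0) -> g = 0.
Proof. by move=> H; apply: tr_nondegr => f; apply: H. Qed.

Definition dualx (m : 'I_(\dim {:hom A B})) : hom A B := (vbasis {:hom A B})`_m.
Definition dualy : 'I_(\dim {:hom A B}) -> hom B A := dbasis pair.

Lemma dualxyP : dualfam dualx dualy.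
Proof.
have H := @tr_nondegl A B.
split=> g; first exact: (dbasis_suml pair_linl pair_linr H).
exact: (dbasis_sumr pair_linl pair_linr H pair_ndr).
Qed.

End TraceDual.

Lemma dualfam1 A B (I : finType) (x : I -> hom A B) (y : I -> hom B A) :
  (forall g, \sum_i tr (y i \oc g) *: x i = g) -> dualfam x y.
Proof.
move=> xy; split=> // h; apply/eqP; rewrite -subr_eq0; apply/eqP/tr_nondegl => g.
apply/eqP; rewrite compBr -scaleN1r trD // trZ // mulN1r subr_eq0 trC //.
rewrite (trC one_simple h) // -{2}(xy g) comp_suml comp_sumr !tr_sum //.
apply/eqP/eq_bigr => i _; rewrite compZl compZr !trZ // mulrC.
by rewrite trC //.
Qed.

(** The copairing is canonical: expanding in the second family and using cyclicity of the trace
    moves h and k from the x side to the y side. *)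
Lemma dualfam_transport (V : lmodType F) A B A' B' (I J : finType)
    (x : I -> hom A B) (y : I -> hom B A)
    (x' : J -> hom A' B') (y' : J -> hom B' A')
    (h : hom B B') (k : hom A' A) (Psi : hom A' B' -> hom B A -> V) :
  dualfam x y -> dualfam x' y' ->
  (forall g, linear (Psi^~ g)) -> (forall f, linear (Psi f)) ->
  \sum_i Psi (h \oc x i \oc k) (y i) = \sum_j Psi (x' j) (k \oc y' j \oc h).
Proof.
move=> [_ xy] [xy' _] linl linr.
transitivity (\sum_i \sum_j tr (y' j \oc (h \oc x i \oc k)) *: Psi (x' j) (y i)).
  apply: eq_bigr => i _; rewrite -{1}(xy' (h \oc x i \oc k)) (lin_sum (linl _)).
  by apply: eq_bigr => j _; rewrite (linZ (linl _)).
rewrite exchange_big; apply: eq_bigr => j _ /=.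
rewrite -[in RHS](xy (k \oc y' j \oc h)) (lin_sum (linr _)).
apply: eq_bigr => i _; rewrite (linZ (linr _)); congr (_ *: _).
by rewrite !compA trC // !compA.
Qed.

Lemma dualfam_transportl (V : lmodType F) A B B' (I J : finType)
    (x : I -> hom A B) (y : I -> hom B A)
    (x' : J -> hom A B') (y' : J -> hom B' A)
    (h : hom B B') (Psi : hom A B' -> hom B A -> V) :
  dualfam x y -> dualfam x' y' ->
  (forall g, linear (Psi^~ g)) -> (forall f, linear (Psi f)) ->
  \sum_i Psi (h \oc x i) (y i) = \sum_j Psi (x' j) (y' j \oc h).
Proof.
move=> xy xy' linl linr.
transitivity (\sum_i Psi (h \oc x i \oc idm A) (y i)).
  by apply: eq_bigr => i _; rewrite compm1.
rewrite (dualfam_transport h (idm A) xy xy' linl linr).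
by apply: eq_bigr => m _; rewrite comp1m.
Qed.

Lemma dualfam_eq (V : lmodType F) A B (I J : finType)
    (x : I -> hom A B) (y : I -> hom B A)
    (x' : J -> hom A B) (y' : J -> hom B A) (Psi : hom A B -> hom B A -> V) :
  dualfam x y -> dualfam x' y' ->
  (forall g, linear (Psi^~ g)) -> (forall f, linear (Psi f)) ->
  \sum_i Psi (x i) (y i) = \sum_j Psi (x' j) (y' j).
Proof.
move=> xy xy' linl linr.
transitivity (\sum_i Psi (idm B \oc x i) (y i)).
  by apply: eq_bigr => i _; rewrite comp1m.
rewrite (dualfam_transportl (idm B) xy xy' linl linr).
by apply: eq_bigr => m _; rewrite compm1.
Qed.

Lemma dualfam_sym A B (I : finType) (x : I -> hom A B) (y : I -> hom B A) :
  dualfam x y -> dualfam y x.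
Proof.
by move=> [H1 H2]; split=> g;
   [rewrite -[RHS]H2 | rewrite -[RHS]H1]; apply: eq_bigr => i _; rewrite trC.
Qed.

(** * Resolution of the identity through the simple colours *)

Section Representatives.
Variables (G : finType) (X : G -> ob C).
Hypothesis X_repr : representatives (@simple_ob F C) (@isomorphic F C) X.
Local Notation d i := (dim_ob (X i)).

Lemma X_simple i : simple_ob (X i). Proof. by have [] := X_repr. Qed.

Lemma d_neq0 i : d i != 0. Proof. exact: (dim_neq0 (@X_simple i)). Qed.

Lemma hom_neq0_eq i j (f : hom (X i) (X j)) : f <> 0 -> i = j.
Proof.
by move=> f0; have [_ inj _] := X_repr; apply/inj/(schur _ _ f0); apply: X_simple.
Qed.

Lemma endo_scalar i (f : hom (X i) (X i)) : f = ((d i)^-1 * tr f) *: idm (X i).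
Proof.
have [c ->] := simple_scalar f (@X_simple i).
by rewrite trZ // tr_id mulrCA mulVf ?mulr1 // d_neq0.
Qed.

Lemma decompose W : exists n (j : 'I_n -> G) (a : forall k, hom (X (j k)) W)
  (b : forall k, hom W (X (j k))), idm W = \sum_k (a k \oc b k).
Proof.
have [_ _ dec _] := C_semisimple; have [n [S [sS [i [p [_ _ iW]]]]]] := dec W.
have [_ _ ex] := X_repr.
have H k : exists z : {j : G & (hom (X j) W * hom W (X j))%type},
   (tagged z).1 \oc (tagged z).2 = i k \oc p k.
  have [j [u [v [vu _]]]] := ex _ (sS k).
  exists (Tagged (fun j => (hom (X j) W * hom W (X j))%type) (i k \oc v, u \oc p k)) => /=.
  by rewrite -compA (compA v) vu comp1m.
have [z zE] := fin_all_exists H.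
exists n, (fun k => tag (z k)), (fun k => (tagged (z k)).1), (fun k => (tagged (z k)).2).
by rewrite -iW; apply: eq_bigr => k _.
Qed.

(** Tested on an inclusion of X_j into W, all colours but j die by Schur's lemma, and the remaining
    composites y \oc a are scalars tr / d j. The factor d i cancels this denominator. *)
Lemma resolution W (I : G -> finType) (x : forall i, I i -> hom (X i) W)
    (y : forall i, I i -> hom W (X i)) :
  (forall i, dualfam (x i) (y i)) ->
  \sum_i d i *: (\sum_m (x i m \oc y i m)) = idm W.
Proof.
move=> xy; have [n [j [a [b abW]]]] := decompose W.
rewrite -[LHS]compm1 abW comp_sumr; apply: eq_bigr => k _.
rewrite compA; congr (_ \oc _).
rewrite comp_suml (bigD1 (j k)) //= [X in _ + X]big1 ?addr0 => [|i ik]; last first.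
  rewrite compZl comp_suml big1 ?scaler0 // => m _; rewrite -compA.
  have [->|/hom_neq0_eq e] := classic (y i m \oc a k = 0); first exact: comp0r.
  by rewrite e eqxx in ik.
have [xy1 _] := xy (j k).
rewrite compZl comp_suml -{2}(xy1 (a k)) scaler_sumr; apply: eq_bigr => m _.
rewrite -compA {1}[y _ _ \oc _]endo_scalar compZr compm1 scalerA.
by rewrite mulrA mulfV ?mul1r ?d_neq0.
Qed.

End Representatives.
End Spherical.

(** * The handle slide *)

Section Rotation.
Variables (F : fieldType) (C : spherical F).
Hypothesis C_semisimple : semisimple C.
Hypothesis one_simple : simple_ob (@unit_ob F C).
Variables (G : finType) (X : G -> ob C).
Hypothesis X_repr : representatives (@simple_ob F C) (@isomorphic F C) X.
Local Notation d i := (dim_ob (X i)).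
Implicit Types A B W Y Z v b : ob C.

Definition sharp v b W (k : hom (b ** v) W) : hom b (W ** dual v) :=
  (k *t idm (dual v)) \oc eqm (tensA b v (dual v)) \oc (idm b *t coev v)
    \oc eqm (esym (tensX1 b)).

Definition flat v W b (h : hom W (b ** v)) : hom (W ** dual v) b :=
  eqm (tensX1 b) \oc (idm b *t ev v) \oc eqm (esym (tensA b v (dual v)))
    \oc (h *t idm (dual v)).

Definition unsharp v b W (g : hom b (W ** dual v)) : hom (b ** v) W :=
  eqm (tensX1 W) \oc (idm W *t ev' v) \oc eqm (esym (tensA W (dual v) v))
    \oc (g *t idm v).

Lemma flat_sharp v W b (h : hom W (b ** v)) (k : hom (b ** v) W) :
  flat h \oc sharp k = rptr (h \oc k).
Proof. by rewrite /rptr -tensm_idr !compA. Qed.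

Lemma sharp_tail v b W (k : hom (b ** v) W) Z :
  at12 (sharp k) Z = at21 k (dual v ** Z) \oc (idm b *t coevt v Z).
Proof.
rewrite at12E at21E coevtE /sharp; push_eqm.
by rewrite !tensm_rassoc !tensm_idm; push_eqm; match_eqm.
Qed.

Lemma flat_tail v b W (h : hom W (b ** v)) Z :
  at21 (flat h) Z = (idm b *t evt v Z) \oc at12 h (dual v ** Z).
Proof.
rewrite at12E at21E evtE /flat; push_eqm.
by rewrite !tensm_rassoc !tensm_idm; push_eqm; match_eqm.
Qed.

Lemma unsharp_tail v b W (g : hom b (W ** dual v)) Z :
  at21 (unsharp g) Z = (idm W *t evt' v Z) \oc at12 g (v ** Z).
Proof.
rewrite at12E at21E evt'E /unsharp; push_eqm.
by rewrite !tensm_rassoc !tensm_idm; push_eqm; match_eqm.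
Qed.

Lemma at12_inj A B B' (f g : hom A (B ** B')) :
  at12 f unit_ob = at12 g unit_ob -> f = g.
Proof.
rewrite !at12E => /(congr1 (fun k => eqm (tensA B B' unit_ob) \oc k)).
by rewrite !eqmKA => /tail1_inj.
Qed.

Lemma unsharpK v b W (g : hom b (W ** dual v)) : sharp (unsharp g) = g.
Proof.
apply: at12_inj; rewrite sharp_tail unsharp_tail -compA nat12 compA.
by rewrite tensm_idl zz4 tensm_idm comp1m.
Qed.

(** Rotating the strand v preserves the trace pairing, because flat y \oc sharp x is the right
    partial trace of y \oc x. *)
Lemma dualfam_flat v b W (I : finType) (x : I -> hom (b ** v) W)
    (y : I -> hom W (b ** v)) :
  dualfam x y -> dualfam (fun i => sharp (x i)) (fun i => flat (y i)).
Proof.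
case=> xy _; apply: dualfam1 => // g.
rewrite -[RHS](unsharpK g) -(xy (unsharp g)) /sharp tens_suml !comp_suml.
apply: eq_bigr => i _; rewrite tensZl !compZl; congr (_ *: _).
by rewrite -{1}(unsharpK g) flat_sharp tr_rptr.
Qed.

(** The resolution of the identity of W ** dual v, inserted across W and the returning arc of the
    loop around h; rotating v back turns each term into a pair x, y. *)
Lemma lptr_resolution v W Z A (I : G -> finType) (h : hom (v ** Z) (v ** A))
    (x : forall b : G, I b -> hom (X b ** v) W)
    (y : forall b : G, I b -> hom W (X b ** v)) :
  (forall b : G, dualfam (x b) (y b)) ->
  \sum_(b : G) d b *: (\sum_m (at21 (x b m) A \oc (idm (X b) *t h) \oc at12 (y b m) Z))
    = idm W *t lptr h.
Proof.
move=> xy.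
have R := resolution C_semisimple one_simple X_repr (fun b : G => dualfam_flat (xy b)).
have e : idm W *t lptr h = (idm W *t evt' v A)
     \oc at22 (idm (W ** dual v)) (v ** A)
     \oc (idm W *t (idm (dual v) *t h)) \oc (idm W *t coevt' v Z).
  rewrite lptrE -!tensm_idl; congr (_ \oc _ \oc _).
  by rewrite at22E tensm_idm compm1 eqmK compm1.
rewrite e -R at22E tens_suml !(comp_suml, comp_sumr).
apply: eq_bigr => b _.
rewrite tensZl !(compZl, compZr) tens_suml !(comp_suml, comp_sumr); congr (_ *: _).
apply: eq_bigr => m _; rewrite -at22E at212_comp.
have e1 : at21 (flat (y b m)) (v ** Z) \oc (idm W *t coevt' v Z) = at12 (y b m) Z.
  rewrite flat_tail -compA nat12 compA tensm_idl zz1 tensm_idm.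
  exact: comp1m.
have e2 : (idm W *t evt' v A) \oc at12 (sharp (x b m)) (v ** A) = at21 (x b m) A.
  rewrite sharp_tail compA -nat21 -compA tensm_idl zz2 tensm_idm.
  exact: compm1.
by rewrite -e1 -e2 -!compA (ra _ (nat21 h _)) -!compA.
Qed.

(* Handle slide: a closed strand summed over all colours passes across W. *)
Lemma handle_slide W Z A (Phi : forall Y, hom (Y ** Z) (Y ** A)) :
  (forall Y Y' (f : hom Y Y'),
     Phi Y' \oc (f *t idm Z) = (f *t idm A) \oc Phi Y) ->
  \sum_(v : G) d v *: lptr (eqm (esym (tensA (X v) W A)) \oc Phi (X v ** W)
                       \oc eqm (tensA (X v) W Z))
    = idm W *t \sum_u d u *: lptr (Phi (X u)).
Proof.
move=> nat.
pose p (v u : G) := @dualx _ _ (X u) (X v ** W); pose q (v u : G) := @dualy _ _ (X u) (X v ** W).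
have pq (v u : G) : dualfam (p v u) (q v u) by apply: dualxyP.
(* Resolve X_v ** W through colours u; naturality lets Phi act on the intermediate X_u. *)
have PhiE (v : G) : eqm (esym (tensA (X v) W A)) \oc Phi (X v ** W) \oc eqm (tensA (X v) W Z)
    = \sum_u d u *: (\sum_m (at12 (p v u m) A \oc Phi (X u) \oc at21 (q v u m) Z)).
  rewrite -[Phi _]compm1 -tensm_idm.
  rewrite -(resolution C_semisimple one_simple X_repr (pq v)) tens_suml.
  rewrite !(comp_suml, comp_sumr); apply: eq_bigr => u _.
  rewrite tensZl !(compZl, compZr) tens_suml !(comp_suml, comp_sumr).
  congr (_ *: _); apply: eq_bigr => m _.
  by rewrite -tensm_idr -!compA (ra _ (nat _ _ _)) at12E at21E -!compA.
(* Testing against all g makes both sides numbers, so that the sums over v and u can be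
   exchanged. *)
apply/eqP; rewrite -subr_eq0; apply/eqP/(tr_nondegl C_semisimple one_simple) => g.
rewrite compBr -scaleN1r trD // trZ // mulN1r; apply/eqP; rewrite subr_eq0; apply/eqP.
transitivity (\sum_u d u * tr (Phi (X u) \oc (idm (X u) *t lptr g))); last first.
  rewrite -[RHS]tr_lptr // lptr_natr trC // comp_suml tr_sum //.
  apply: eq_bigr => u _; rewrite compZl trZ //; congr (_ * _).
  by rewrite -tr_lptr // lptr_natr.
transitivity (\sum_(v : G) d v * \sum_u d u * \sum_m
   tr (at21 (q v u m) Z \oc (idm (X v) *t g) \oc at12 (p v u m) A \oc Phi (X u))).
  rewrite comp_sumr tr_sum //; apply: eq_bigr => v _.
  rewrite compZr trZ //; congr (_ * _); rewrite -lptr_natl tr_lptr // PhiE.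
  rewrite comp_sumr tr_sum //; apply: eq_bigr => u _.
  rewrite compZr trZ //; congr (_ * _); rewrite comp_sumr tr_sum //.
  by apply: eq_bigr => m _; rewrite !compA trC // !compA.
(* For fixed u the exchanged families resolve the identity with v as summation colour, which closes
   the strand W of g. *)
have L (u : G) := lptr_resolution g (fun v : G => dualfam_sym one_simple (pq v u)).
transitivity (\sum_u d u * \sum_(v : G) d v * \sum_m
   tr (at21 (q v u m) Z \oc (idm (X v) *t g) \oc at12 (p v u m) A \oc Phi (X u))).
  under eq_bigr do rewrite mulr_sumr; rewrite exchange_big /=.
  by apply: eq_bigr => u _; rewrite mulr_sumr; apply: eq_bigr => v _; rewrite mulrCA.
apply: eq_bigr => u _; congr (_ * _); rewrite -L trC // comp_suml tr_sum //.
apply: eq_bigr => v _; rewrite compZl trZ //; congr (_ * _).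
by rewrite comp_suml tr_sum.
Qed.

End Rotation.

(** * Averaging over the half braidings *)

Section CenterBasics.
Variables (F : fieldType) (C : tensorcat F).
Implicit Types (z : center_ob C) (Y : ob C).

Definition hbi z Y : hom (Y ** cob z) (cob z ** Y) :=
  proj1_sig (constructive_indefinite_description _ (hb_iso z Y)).

Lemma hbiK z Y : hbi z Y \oc hb z Y = idm _.
Proof. by rewrite /hbi; case: constructive_indefinite_description => g /= []. Qed.

Lemma hbK z Y : hb z Y \oc hbi z Y = idm _.
Proof. by rewrite /hbi; case: constructive_indefinite_description => g /= []. Qed.

Lemma hbi_unique z Y (g : hom (Y ** cob z) (cob z ** Y)) :
  hb z Y \oc g = idm _ -> hbi z Y = g.
Proof. by move=> e; rewrite -[LHS]compm1 -e compA hbiK comp1m. Qed.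

Lemma hbi_natural z Y Y' (f : hom Y Y') :
  (idm _ *t f) \oc hbi z Y = hbi z Y' \oc (f *t idm _).
Proof.
rewrite -[LHS]comp1m -(hbiK z Y') -!compA; congr (_ \oc _).
by rewrite compA -hb_natural -compA hbK compm1.
Qed.

Lemma hb_tensT z V W : hb z (V ** W)
  = eqm (tensA V W (cob z)) \oc (idm V *t hb z W) \oc at22 (hb z V) W.
Proof. by rewrite hb_tens at22E -!compA. Qed.

Lemma at22K (A A' B B' T : ob C) (f : hom (A ** A') (B ** B')) (g : hom (B ** B') (A ** A')) :
  g \oc f = idm _ -> at22 g T \oc at22 f T = idm _.
Proof.
by move=> gf; rewrite -at22_comp gf at22E tensm_idm compm1 eqmK.
Qed.

Lemma hbi_tensT z V W : hbi z (V ** W)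
  = at22 (hbi z V) W \oc (idm V *t hbi z W) \oc eqm (esym (tensA V W (cob z))).
Proof.
apply: hbi_unique; rewrite hb_tensT -!compA.
rewrite (ra _ (at22K _ (hbK z V))) comp1m (ra _ (tensm_idl _ _ _)) hbK tensm_idm.
by rewrite comp1m eqmK.
Qed.

Lemma center_mor_comp z1 z2 z3 (g : hom (cob z2) (cob z3)) (f : hom (cob z1) (cob z2)) :
  center_mor g -> center_mor f -> center_mor (g \oc f).
Proof.
by move=> gm fm Z; rewrite -tensm_idl -compA fm compA gm -compA tensm_idr.
Qed.

Lemma center_mor_id z : center_mor (idm (cob z)).
Proof. by move=> Z; rewrite !tensm_idm comp1m compm1. Qed.

Lemma center_mor_lin z1 z2 c (g f : hom (cob z1) (cob z2)) :
  center_mor g -> center_mor f -> center_mor (c *: g + f).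
Proof.
by move=> gm fm Z; rewrite tensDr tensDl tensZr tensZl compDl compDr compZl compZr gm fm.
Qed.

Lemma center_mor_i z1 z2 (t : hom (cob z1) (cob z2)) Z : center_mor t ->
  hbi z2 Z \oc (idm Z *t t) = (t *t idm Z) \oc hbi z1 Z.
Proof.
move=> tm; rewrite -[LHS]compm1 -(hbK z1 Z) -!compA.
by rewrite (ra _ (tm Z)) !compA hbiK comp1m.
Qed.

End CenterBasics.

Section Averaging.
Variables (F : fieldType) (C : spherical F).
Hypothesis C_semisimple : semisimple C.
Hypothesis one_simple : simple_ob (@unit_ob F C).
Variables (G : finType) (X : G -> ob C).
Hypothesis X_repr : representatives (@simple_ob F C) (@isomorphic F C) X.
Local Notation d i := (dim_ob (X i)).
Implicit Types (z : center_ob C).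

Definition conj z1 z2 (t : hom (cob z1) (cob z2)) Y : hom (Y ** cob z1) (Y ** cob z2) :=
  hb z2 Y \oc (t *t idm Y) \oc hbi z1 Y.

Definition average z1 z2 (t : hom (cob z1) (cob z2)) : hom (cob z1) (cob z2) :=
  \sum_v d v *: lptr (conj t (X v)).

(** Conjugation by X_v ** W is conjugation by X_v followed by conjugation by W. The handle slide
    therefore turns id_W tensor the average into the average conjugated by the half braiding with
    W. *)
Lemma average_mor z1 z2 (t : hom (cob z1) (cob z2)) : center_mor (average t).
Proof.
move=> W; rewrite -(handle_slide C_semisimple one_simple X_repr); last first.
  move=> Y Y' f; rewrite /conj -!compA -hbi_natural !compA; congr (_ \oc _).
  by rewrite hb_natural -!compA tens_interchange.
rewrite /average tens_suml comp_suml comp_sumr; apply: eq_bigr => v _.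
rewrite tensZl compZl compZr lptr_tens; congr (_ *: _).
have -> : eqm (esym (tensA (X v) W (cob z2))) \oc conj t (X v ** W)
      \oc eqm (tensA (X v) W (cob z1))
    = (idm (X v) *t hb z2 W) \oc at22 (conj t (X v)) W \oc (idm (X v) *t hbi z1 W).
  rewrite /conj hb_tensT hbi_tensT !at22_comp at22_idr -!compA eqmKA.
  by rewrite eqmK compm1.
by rewrite lptr_natr lptr_natl -!compA hbiK compm1.
Qed.

(** Conjugation leaves a central t unchanged, so the loop of colour v comes off and contributes d v,
    to be multiplied by its weight d v. *)
Lemma average_center z1 z2 (t : hom (cob z1) (cob z2)) :
  center_mor t -> average t = dim_cat X *: t.
Proof.
move=> tm; rewrite /dim_cat scaler_suml; apply: eq_bigr => v _.
rewrite /conj -tm -compA hbK compm1 -[idm _ *t t]compm1 lptr_natl -tensm_idm.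
by rewrite (lptr_id one_simple) tr_id compZr compm1 scalerA.
Qed.

Lemma average_compl z1 z2 z3 (g : hom (cob z2) (cob z3)) (t : hom (cob z1) (cob z2)) :
  center_mor g -> average (g \oc t) = g \oc average t.
Proof.
move=> gm; rewrite /average comp_sumr; apply: eq_bigr => v _; rewrite compZr.
by rewrite -lptr_natl /conj -tensm_idr !compA gm.
Qed.

Lemma average_compr z1 z2 z3 (t : hom (cob z2) (cob z3)) (f : hom (cob z1) (cob z2)) :
  center_mor f -> average (t \oc f) = average t \oc f.
Proof.
move=> fm; rewrite /average comp_suml; apply: eq_bigr => v _; rewrite compZl.
by rewrite -lptr_natr /conj -tensm_idr -!compA center_mor_i.
Qed.

Lemma tr_average z (t : hom (cob z) (cob z)) : tr (average t) = dim_cat X * tr t.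
Proof.
rewrite /average tr_sum // /dim_cat mulr_suml; apply: eq_bigr => v _.
rewrite trZ // tr_lptr // /conj trC // compA hbiK comp1m tr_tens1 //.
by rewrite mulrC -mulrA mulrC expr2.
Qed.

Hypothesis dim_neq0 : dim_cat X != 0.

Lemma center_regular z1 z2 (f : hom (cob z1) (cob z2)) : center_mor f ->
  exists2 g : hom (cob z2) (cob z1), center_mor g & f \oc g \oc f = f.
Proof.
move=> fm; have [g fgf] := regular C_semisimple f.
exists ((dim_cat X)^-1 *: average g).
  move=> Z; rewrite tensZr tensZl compZl compZr; congr (_ *: _); exact: average_mor.
rewrite compZr compZl -average_compl // -average_compr // fgf average_center //.
by rewrite scalerA mulVf ?scale1r.
Qed.

(** With g a central generalized inverse, g f and f g are scalars, and f g f = f with f nonzero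
    forces both to be 1. *)
Lemma center_schur z1 z2 (f : hom (cob z1) (cob z2)) :
  center_simple z1 -> center_simple z2 -> center_mor f -> f <> 0 ->
  center_isomorphic z1 z2.
Proof.
move=> s1 s2 fm f0; have [g gm fgf] := center_regular fm.
have [c [gf _]] := s1 _ (center_mor_comp gm fm).
have [c' [fg _]] := s2 _ (center_mor_comp fm gm).
have c1 : c = 1.
  apply/eqP; rewrite -subr_eq0; apply/eqP; apply: NNPP => /eqP c1; apply: f0.
  apply/eqP; have /eqP := fgf; rewrite -compA gf compZr compm1 -subr_eq0 -{2}[f]scale1r.
  by rewrite -scalerBl scaler_eq0 (negPf c1).
have c1' : c' = 1.
  apply/eqP; rewrite -subr_eq0; apply/eqP; apply: NNPP => /eqP c1'; apply: f0.
  apply/eqP; have /eqP := fgf; rewrite fg compZl comp1m -subr_eq0 -{2}[f]scale1r.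
  by rewrite -scalerBl scaler_eq0 (negPf c1').
by exists f, g; split=> //; rewrite ?gf ?fg ?c1 ?c1' scale1r.
Qed.

Lemma center_simple_neq0 z : center_simple z -> idm (cob z) <> 0.
Proof.
move=> s i0; have [c [_ U]] := s _ (@center_mor_id _ _ z).
have e d : idm (cob z) = d *: idm (cob z) by rewrite i0 scaler0.
by have /eqP := U 0 (e 0); rewrite (U 1 (e 1)) oner_eq0.
Qed.

Lemma center_isomorphic_sym z1 z2 : center_isomorphic z1 z2 -> center_isomorphic z2 z1.
Proof. by case=> f [g [fm gm gf fg]]; exists g, f. Qed.

End Averaging.

(** * Semisimplicity of the center *)

Import passmx.

Lemma eigenvector (F : closedFieldType) (V : vectType F) (f : 'End(V)) :
  (0 < \dim {:V})%N -> exists a v, v != 0 /\ f v = a *: v.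
Proof.
move=> V0; have eP := vbasisP {:V}; set e := vbasis _ in eP.
have [|a ra] := @closed_rootP F (char_poly (mxof e e f)) _.
  by rewrite size_char_poly; case: (\dim _) V0.
move: ra; rewrite -eigenvalue_root_char => /eigenvalueP[u uE u0].
exists a, (vecof e u); rewrite vecof_eq0 // (hom_vecof e eP) uE linearZ.
by split.
Qed.

(** * Splitting central idempotents: half braidings on direct summands *)

Section Retract.
Variables (F : fieldType) (C : tensorcat F) (z : center_ob C) (Y : ob C).
Variables (i : hom Y (cob z)) (p : hom (cob z) Y).
Hypotheses (pi : p \oc i = idm Y) (ipm : center_mor (i \oc p)).

Let rhb W : hom (Y ** W) (W ** Y) := (idm W *t p) \oc hb z W \oc (i *t idm W).

(** Centrality carries the idempotent i \oc p through the half braiding to i, which absorbs it.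
    Projections can thus be inserted or dropped when verifying the axioms for Y. *)
Let absorb W : (idm W *t (i \oc p)) \oc hb z W \oc (i *t idm W)
  = hb z W \oc (i *t idm W).
Proof. by rewrite ipm -compA tensm_idr -compA pi compm1. Qed.

Lemma retract_iso W : exists g : hom (W ** Y) (Y ** W),
  g \oc rhb W = idm _ /\ rhb W \oc g = idm _.
Proof.
exists ((p *t idm W) \oc hbi z W \oc (idm W *t i)); rewrite /rhb; split.
  rewrite -!compA (ra _ (tensm_idl _ _ _)) (compA _ (hb z W)) absorb.
  by rewrite (ra _ (hbiK z W)) comp1m tensm_idr pi tensm_idm.
rewrite -!compA (ra _ (tensm_idr _ _ _)) (ra _ (esym (ipm W))) -!compA.
by rewrite (ra _ (hbK z W)) comp1m !tensm_idl !compA pi comp1m pi tensm_idm.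
Qed.

Lemma retract_natural W W' (f : hom W W') :
  (f *t idm Y) \oc rhb W = rhb W' \oc (idm Y *t f).
Proof.
rewrite /rhb !compA tens_interchange -!compA; congr (_ \oc _).
by rewrite tens_interchange compA hb_natural -compA.
Qed.

Lemma retract_tens V W : rhb (V ** W)
  = eqm (tensA V W Y) \oc (idm V *t rhb W) \oc eqm (esym (tensA V Y W))
      \oc (rhb V *t idm W) \oc eqm (tensA Y V W).
Proof.
have -> : rhb (V ** W) = eqm (tensA V W Y) \oc (idm V *t rhb W) \oc at22 (rhb V) W.
  have -> : idm V *t rhb W = (idm V *t (idm W *t p)) \oc (idm V *t hb z W)
      \oc (idm V *t (i *t idm W)) by rewrite !tensm_idl.
  have e : (idm V *t (i *t idm W)) \oc at22 (rhb V) W = at22 (hb z V) W \oc (i *t idm (V ** W)).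
    rewrite -at22_idr -at22_comp -absorb /rhb -at22_idl -at22_comp.
    by rewrite !compA tensm_idl.
  rewrite -(compA _ _ (at22 _ _)) -(compA _ _ (at22 _ _)) e.
  rewrite /rhb hb_tensT -tensm_idm -!compA.
  by rewrite tensm_rassoc -!compA eqmKA.
by rewrite at22E -!compA.
Qed.

Lemma retract_one : eqm (tens1X Y) \oc rhb unit_ob = eqm (tensX1 Y).
Proof.
rewrite /rhb !compA tensm1f -(compA p) hb_one -compA tensmf1 compA pi.
exact: comp1m.
Qed.

Definition retract : center_ob C :=
  Center retract_iso retract_natural retract_tens retract_one.

Lemma retract_incl : center_mor (i : hom (cob retract) (cob z)).
Proof.
move=> W; rewrite /= /rhb -absorb !compA; congr (_ \oc _ \oc _).
exact: tensm_idl.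
Qed.

Lemma retract_proj : center_mor (p : hom (cob z) (cob retract)).
Proof.
move=> W; rewrite /= /rhb -!compA tensm_idr -ipm compA tensm_idl.
by rewrite compA pi comp1m.
Qed.

End Retract.

Section CenterSemisimple.
Variables (F : closedFieldType) (C : spherical F).
Hypothesis C_semisimple : semisimple C.
Hypothesis one_simple : simple_ob (@unit_ob F C).
Variables (G : finType) (X : G -> ob C).
Hypothesis X_repr : representatives (@simple_ob F C) (@isomorphic F C) X.
Hypothesis dim_neq0 : dim_cat X != 0.
Implicit Types (z : center_ob C).

(** Composition with a central non-scalar t has an eigenvalue a, so s = t - a is nonzero and kills
    some v nonzero. For a central generalized inverse g of s, the idempotent g s is neither 0 nor
    the identity. *)
Lemma center_idempotent z : idm (cob z) <> 0 -> ~ center_simple z ->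
  exists e : hom (cob z) (cob z),
    [/\ center_mor e, e \oc e = e, e <> 0 & e <> idm (cob z)].
Proof.
move=> z0 nsz.
have [t [tm tns]] : exists t : hom (cob z) (cob z),
    center_mor t /\ forall c, t <> c *: idm (cob z).
  apply: NNPP => H; apply: nsz => t tm.
  have [c tc] : exists c, t = c *: idm (cob z).
    by apply: NNPP => nc; apply: H; exists t; split=> // c tc; apply: nc; exists c.
  exists c; split=> // c'; rewrite tc => /eqP; rewrite -subr_eq0 -scalerBl scaler_eq0.
  by case/orP=> [|/eqP //]; rewrite subr_eq0 => /eqP.
have [|a [v [v0 tv]]] := @eigenvector F (hom (cob z) (cob z)) (linfun (compm t)).
  rewrite lt0n dimv_eq0; apply/eqP => e; case: z0; apply/eqP.
  by rewrite -memv0 -e memvf.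
rewrite comp_linfun in tv.
pose s := t - (a *: idm (cob z)).
have sm : center_mor s.
  by rewrite /s addrC -scaleN1r scalerA; apply/center_mor_lin/tm/center_mor_id.
have sv : s \oc v = 0 by rewrite compBl compZl comp1m tv subrr.
have [g gm sgs] := center_regular C_semisimple one_simple X_repr dim_neq0 sm.
exists (g \oc s); split.
- exact: center_mor_comp.
- by rewrite -compA (compA s) sgs.
- move=> gs; case: (tns a); apply/eqP; rewrite -subr_eq0 -/s -sgs -compA gs.
  by rewrite comp0r.
move=> gs; case/eqP: v0; rewrite -[v]comp1m -gs -compA sv; exact: comp0r.
Qed.

(** The map h -> i h p embeds End(A) into End(B), and the identity of B is not in its image. This is
    the measure for decomposing objects of the center. *)
Lemma retract_dim (A B : ob C) (i : hom A B) (p : hom B A) : p \oc i = idm A -> i \oc p <> idm B ->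
  (\dim {:hom A A} < \dim {:hom B B})%N.
Proof.
move=> pi nip.
pose f (h : hom A A) : hom B B := i \oc h \oc p.
have f_lin : linear f by move=> c g h; rewrite /f compDr compDl compZr compZl.
pose f' : {linear hom A A -> hom B B} :=
  HB.pack f (GRing.isLinear.Build F (hom A A) (hom B B) _ f f_lin).
have fE h : linfun f' h = i \oc h \oc p by rewrite lfunE.
have inj : lker (linfun f') == 0%VS.
  apply/lker0P => g h; rewrite !fE => /(congr1 (fun k => p \oc k \oc i)).
  by rewrite !compA pi -!compA pi !comp1m !compm1.
rewrite -(limg_dim_eq _ (f := linfun f') (U := fullv)); last first.
  by rewrite (eqP inj) capv0.
rewrite ltnNge; apply/negP => le_d.
have : idm B \in limg (linfun f').
  suff -> : limg (linfun f') = fullv by exact: memvf.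
  by apply/eqP; rewrite eqEdim subvf.
case/memv_imgP => h _; rewrite fE => e; apply: nip.
by rewrite -[LHS]compm1 e -!compA (compA p) pi comp1m.
Qed.

(* Decomposition into simple objects, as an induction principle on id_z. *)
Lemma center_semisimple z (P : hom (cob z) (cob z) -> Prop) :
  P 0 -> (forall f g, P f -> P g -> P (f + g)) ->
  (forall s (i : hom (cob s) (cob z)) (p : hom (cob z) (cob s)),
     center_simple s -> center_mor i -> center_mor p -> P (i \oc p)) ->
  P (idm (cob z)).
Proof.
have [n] := ubnP (\dim {:hom (cob z) (cob z)}).
elim: n => // n IH in z P *; rewrite ltnS => le_n P0 PD PS.
have [->//|z0] := classic (idm (cob z) = 0).
have [sz|nsz] := classic (center_simple z).
  by rewrite -[idm _]comp1m; apply: PS => //; apply: center_mor_id.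
have [e [em ee e0 e1]] := center_idempotent z0 nsz.
have sub (f : hom (cob z) (cob z)) : center_mor f -> f \oc f = f ->
    f <> idm (cob z) -> P f.
  move=> fm ff f1; have [_ spl _ _] := C_semisimple.
  have [Y [i [p [ip pi]]]] := spl _ f ff.
  have ipm : center_mor (i \oc p) by rewrite ip.
  pose y := retract pi ipm.
  have := IH y (fun h => P (i \oc h \oc p)); rewrite compm1 ip; apply.
  - apply: leq_trans le_n; by apply: (retract_dim pi); rewrite ip.
  - by rewrite comp0r comp0l.
  - by move=> g h; rewrite compDr compDl; apply: PD.
  move=> s i' p' ss im pm; rewrite compA -compA; apply: PS => //.
    by apply: center_mor_comp im; apply: retract_incl.
  by apply: (center_mor_comp pm); apply: retract_proj.
rewrite -[idm _](subrK e); apply: PD; last exact: sub.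
apply: sub.
- rewrite addrC -scaleN1r; apply: center_mor_lin em _; exact: center_mor_id.
- by rewrite compBl !compBr !comp1m compm1 ee subrr subr0.
by move/eqP; rewrite -subr_eq0 addrAC subrr sub0r oppr_eq0 => /eqP.
Qed.

End CenterSemisimple.

(** * Half braidings as crossings *)

Section HalfBraiding.
Variables (F : fieldType) (C : tensorcat F) (I : ob C).
Variable e : forall Y, hom (I ** Y) (Y ** I).
Hypothesis e_nat : forall Y Z (f : hom Y Z), (f *t idm I) \oc e Y = e Z \oc (idm I *t f).
Hypothesis e_tens : forall Y Z, e (Y ** Z) = eqm (tensA Y Z I) \oc (idm Y *t e Z)
      \oc eqm (esym (tensA Y I Z)) \oc (e Y *t idm Z) \oc eqm (tensA I Y Z).
Hypothesis e_one : eqm (tens1X I) \oc e unit_ob = eqm (tensX1 I).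
Implicit Types B D T : ob C.

Definition braid2 B B' T : hom (I ** (B ** (B' ** T))) (B ** (B' ** (I ** T))) :=
  (idm B *t at22 (e B') T) \oc at22 (e B) (B' ** T).

Lemma braid2E B B' T : braid2 B B' T = eqm (esym (tensA B B' (I ** T)))
  \oc at22 (e (B ** B')) T \oc (idm I *t eqm (tensA B B' T)).
Proof.
rewrite /braid2 e_tens !at22E; push_eqm.
by rewrite !tensm_rassoc !tensm_idm; push_eqm; match_eqm.
Qed.

(** Naturality of e at the box f; [braid2E] splits the crossing with a product into two
    crossings. *)
Lemma slide22 B B' D D' (f : hom (B ** B') (D ** D')) T :
  at22 f (I ** T) \oc braid2 B B' T = braid2 D D' T \oc (idm I *t at22 f T).
Proof.
have := congr1 (fun k => at22 k T) (e_nat f).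
rewrite !at22_comp at22_idr at22_idl => ef.
rewrite !braid2E (at22E f (I ** T)) -!compA (eqmKA (esym _)) (ra _ ef) -!compA.
congr (_ \oc (_ \oc _)); rewrite !tensm_idl at22E; congr (_ *t _).
by rewrite -!compA eqmKA.
Qed.

Lemma braid_one T : at22 (e unit_ob) T
  = eqm (esym (tens1X (I ** T))) \oc (idm I *t eqm (tens1X T)).
Proof.
have -> : e unit_ob = eqm (esym (tens1X I)) \oc eqm (tensX1 I) by rewrite -e_one eqmKA.
by rewrite at22E; push_eqm; match_eqm.
Qed.

Lemma slide20 B B' (f : hom (B ** B') unit_ob) T :
  at20 f (I ** T) \oc braid2 B B' T = idm I *t at20 f T.
Proof.
have := congr1 (fun k => at22 k T) (e_nat f).
rewrite !at22_comp at22_idr at22_idl braid_one => ef.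
by rewrite braid2E !at20E -!compA (eqmKA (esym _)) (ra _ ef) -!compA eqmKA !tensm_idl.
Qed.

Lemma slide02 B B' (f : hom unit_ob (B ** B')) T :
  braid2 B B' T \oc (idm I *t at02 f T) = at02 f (I ** T).
Proof.
have := congr1 (fun k => at22 k T) (e_nat f).
rewrite !at22_comp at22_idr at22_idl braid_one => ef.
rewrite braid2E !at02E -!compA; congr (_ \oc _).
rewrite tensm_idl eqmKA -tensm_idl (ra _ (esym ef)) -!compA; congr (_ \oc _).
by rewrite tensm_idl eqmK tensm_idm ?compm1.
Qed.
End HalfBraiding.

(** * Half braidings are invertible by duality *)

Section Rigidity.
Variables (F : fieldType) (C : spherical F) (I : ob C).
Variable e : forall Y, hom (I ** Y) (Y ** I).
Hypothesis e_nat : forall Y Z (f : hom Y Z), (f *t idm I) \oc e Y = e Z \oc (idm I *t f).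
Hypothesis e_tens : forall Y Z, e (Y ** Z) = eqm (tensA Y Z I) \oc (idm Y *t e Z)
      \oc eqm (esym (tensA Y I Z)) \oc (e Y *t idm Z) \oc eqm (tensA I Y Z).
Hypothesis e_one : eqm (tens1X I) \oc e unit_ob = eqm (tensX1 I).

Lemma at22_unit (A B A' B' : ob C) (k : hom (A ** (B ** unit_ob)) (A' ** (B' ** unit_ob))) :
  exists g : hom (A ** B) (A' ** B'), at22 g unit_ob = k.
Proof.
exists (eqm (f_equal (tens A') (tensX1 B')) \oc k \oc eqm (f_equal (tens A) (esym (tensX1 B)))).
rewrite at22E tensf1_eqm; push_eqm; rewrite ?(eqm_refl (etrans _ _)) ?comp1m ?compm1 //.
Qed.

Lemma at22_inj (A A' B B' : ob C) (f g : hom (A ** A') (B ** B')) :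
  at22 f unit_ob = at22 g unit_ob -> f = g.
Proof.
rewrite !at22E => /(congr1 (fun k => eqm (tensA B B' unit_ob) \oc k
  \oc eqm (esym (tensA A A' unit_ob)))).
by rewrite -!compA !eqmKA eqmK !compm1 => /tail1_inj.
Qed.

(** The inverse crossing with Y is the crossing with its dual, bent around by a cup and a cap. In
    either composite the cap or the cup slides through the strand I, and a zigzag remains. *)
Lemma braid_inverse Y : exists g : hom (Y ** I) (I ** Y),
  g \oc e Y = idm _ /\ e Y \oc g = idm _.
Proof.
pose inv T := evt Y (I ** (Y ** T)) \oc (idm Y *t at22 (e (dual Y)) (Y ** T))
  \oc (idm Y *t (idm I *t coevt' Y T)).
have [g gE] := at22_unit (inv unit_ob).
have e1 A B : at22 (idm (A ** B)) (@unit_ob F C) = idm _.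
  by rewrite at22E tensm_idm compm1 eqmK.
exists g; split; apply: at22_inj; rewrite at22_comp gE e1 /inv.
  rewrite -!compA -nat22 (ra _ (erefl (braid2 e Y (dual Y) (Y ** unit_ob)))).
  rewrite (ra _ (slide20 e_nat e_tens e_one _ _)) tensm_idl zz1.
  exact: tensm_idm.
rewrite !compA -evt_nat -!compA (ra _ (tensm_idl _ _ _)) tensm_idl.
rewrite (slide02 e_nat e_tens e_one) zz1.
by [].
Qed.

End Rigidity.

(** * The induced object of the center *)

Section Transpose.
Variables (F : fieldType) (C : spherical F).
Implicit Types V W Y Z T : ob C.

(* The transpose V^* -> Y W^* of x : W -> V Y. *)
Definition tld V W Y (x : hom W (V ** Y)) T : hom (dual V ** T) (Y ** (dual W ** T)) :=
  locked_with at_key (evt' V (Y ** (dual W ** T))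
    \oc (idm (dual V) *t at12 x (dual W ** T)) \oc (idm (dual V) *t coevt W T)).

Lemma tldE V W Y (x : hom W (V ** Y)) T : tld x T = evt' V (Y ** (dual W ** T))
    \oc (idm (dual V) *t at12 x (dual W ** T)) \oc (idm (dual V) *t coevt W T).
Proof. exact: locked_withE. Qed.

Lemma at12_linear A B B' Z : linear (fun f : hom A (B ** B') => at12 f Z).
Proof. by move=> c f g; rewrite !at12E tensDl tensZl compDr compZr. Qed.

Lemma at22_linear A A' B B' Z : linear (fun f : hom (A ** A') (B ** B') => at22 f Z).
Proof.
by move=> c f g; rewrite !at22E tensDl tensZl !(compDr, compZr) !(compDl, compZl).
Qed.

Lemma tld_linear V W Y T : linear (fun x : hom W (V ** Y) => tld x T).
Proof.
move=> c f g; rewrite !tldE at12_linear tensDr tensZr compDr compZr.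
by rewrite compDl compZl.
Qed.

Lemma tld_nat V W Y (x : hom W (V ** Y)) T T' (g : hom T T') :
  tld x T' \oc (idm (dual V) *t g) = (idm Y *t (idm (dual W) *t g)) \oc tld x T.
Proof.
rewrite !tldE -!compA tensm_idl coevt_nat -tensm_idl (ra _ (tensm_idl _ _ _)) nat12.
by rewrite -tensm_idl -compA (ra _ (evt'_nat _ _)) -compA.
Qed.

Lemma tld_natY V W Y Y' (x : hom W (V ** Y)) (f : hom Y Y') T :
  tld ((idm V *t f) \oc x) T = (f *t idm (dual W ** T)) \oc tld x T.
Proof.
rewrite !tldE at122_comp at22_idl -tensm_idl !compA; congr (_ \oc _ \oc _).
exact: evt'_nat.
Qed.

Lemma at22_at12 V W Y Z (x : hom W (V ** Y)) T :
  at22 (at12 x Z) T = (idm V *t eqm (tensA Y Z T)) \oc at12 x (Z ** T).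
Proof.
rewrite at22E !at12E; push_eqm.
by rewrite !tensm_rassoc !tensm_idm; push_eqm; match_eqm.
Qed.

Lemma tld_cap V W Y (x : hom W (V ** Y)) T :
  (idm Y *t evt' W T) \oc tld x (W ** T) = evt' V (Y ** T) \oc (idm (dual V) *t at12 x T).
Proof.
rewrite tldE -!compA (ra _ (esym (evt'_nat V _))) -compA; congr (_ \oc _).
by rewrite !tensm_idl compA -nat12 -compA zz2 compm1.
Qed.

(** The cap of W over the transposed second box straightens by [tld_cap], so the two transposes
    compose in the opposite order. *)
Lemma tld_comp V W U Y Z (x : hom W (V ** Y)) (x' : hom U (W ** Z)) T :
  tld (at12 x Z \oc x') T
    = eqm (tensA Y Z (dual U ** T)) \oc (idm Y *t tld x' T) \oc tld x T.
Proof.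
rewrite [tld x' T]tldE -!tensm_idl -!compA.
rewrite -tld_nat (ra _ (esym (tld_nat x _))) -compA (ra _ (tld_cap x _)).
rewrite tldE at122_comp at22_at12 -!tensm_idl !compA; congr (_ \oc _ \oc _ \oc _).
exact: evt'_nat.
Qed.

Lemma evt'_tail V A A' S (e : A ** S = A') :
  evt' V A *t idm S = eqm (esym e) \oc evt' V A'
    \oc eqm (etrans (esym (tensA (dual V) (V ** A) S))
               (f_equal (tens (dual V)) (etrans (esym (tensA V A S)) (f_equal (tens V) e)))).
Proof.
case: A' / e; rewrite eqm_refl comp1m !evt'E; push_eqm.
by rewrite !tensm_rassoc !tensm_idm; push_eqm; match_eqm.
Qed.

Lemma coevt_tail V A A' S (e : A ** S = A') :
  coevt V A *t idm S
    = eqm (esym (etrans (esym (tensA V (dual V ** A) S))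
               (f_equal (tens V) (etrans (esym (tensA (dual V) A S)) (f_equal (tens (dual V)) e)))))
    \oc coevt V A' \oc eqm e.
Proof.
case: A' / e; rewrite eqm_refl compm1 !coevtE; push_eqm.
by rewrite !tensm_rassoc !tensm_idm; push_eqm; match_eqm.
Qed.

Lemma at12_tail A B B' (x : hom A (B ** B')) T T' S (e : T ** S = T') :
  at12 x T *t idm S
    = eqm (esym (etrans (esym (tensA B (B' ** T) S))
             (f_equal (tens B) (etrans (esym (tensA B' T S)) (f_equal (tens B') e)))))
    \oc at12 x T' \oc eqm (etrans (esym (tensA A T S)) (f_equal (tens A) e)).
Proof.
case: T' / e; rewrite !at12E; push_eqm.
by rewrite !tensm_rassoc !tensm_idm; push_eqm; match_eqm.
Qed.

Lemma tld_tail V W Y (x : hom W (V ** Y)) T S :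
  tld x T *t idm S = eqm (etrans (f_equal (tens Y) (tensA (dual W) T S)) (tensA Y (dual W ** T) S))
    \oc tld x (T ** S) \oc eqm (esym (tensA (dual V) T S)).
Proof.
rewrite !tldE -!tensm_idr !tensm_rassoc.
rewrite (evt'_tail V (etrans (esym (tensA Y (dual W ** T) S)) (f_equal (tens Y) (esym (tensA (dual W) T S))))).
rewrite (coevt_tail W (erefl (T ** S))) (at12_tail x (esym (tensA (dual W) T S))).
by push_eqm; match_eqm.
Qed.

Lemma tld_cast V W Y (x : hom W (V ** Y)) T T' (e : T = T') :
  tld x T = eqm (esym (f_equal (fun S => Y ** (dual W ** S)) e)) \oc tld x T'
    \oc eqm (f_equal (tens (dual V)) e).
Proof. by case: T' / e; rewrite !eqm_refl comp1m compm1. Qed.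

Lemma tld_unit V T : tld (eqm (esym (tensX1 V))) T = eqm (esym (tens1X (dual V ** T))).
Proof.
have e : eqm (esym (tens1X (dual V ** T))) \oc (evt' V (dual V ** T)
    \oc (idm (dual V) *t coevt V T)) = eqm (esym (tens1X (dual V ** T))).
  by rewrite zz4 compm1.
rewrite tldE -e !compA; congr (_ \oc _).
rewrite at12E !evt'E; push_eqm.
rewrite (tens_idm_cast (ev (dual V)) (tens1X (dual V ** T))).
by push_eqm; match_eqm.
Qed.
End Transpose.

(** * The half braiding on the sum of the objects dual(X_k) a X_k *)

Section Induced.
Variables (F : fieldType) (C : spherical F).
Hypothesis C_semisimple : semisimple C.
Hypothesis one_simple : simple_ob (@unit_ob F C).
Variables (n : nat) (X : 'I_n -> ob C).
Hypothesis X_repr : representatives (@simple_ob F C) (@isomorphic F C) X.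
Variable a : ob C.
Local Notation d i := (dim_ob (X i)).
Implicit Types (Y Z T : ob C) (k l w : 'I_n).

Definition summand k : ob C := dual (X k) ** (a ** X k).

(* The component V^* a V Y -> Y W^* a W attached to x : W -> V Y and y : V Y -> W. *)
Definition pass V W Y Y' (x : hom W (V ** Y')) (y : hom (V ** Y) W) :
    hom ((dual V ** (a ** V)) ** Y) (Y' ** (dual W ** (a ** W))) :=
  tld x (a ** W) \oc (idm (dual V) *t (idm a *t y))
    \oc eqm (etrans (esym (tensA (dual V) (a ** V) Y))
              (f_equal (tens (dual V)) (esym (tensA a V Y)))).

Lemma pass_linl V W Y Y' (y : hom (V ** Y) W) :
  linear (fun x : hom W (V ** Y') => pass x y).
Proof. by move=> c f g; rewrite /pass tld_linear !compDl !compZl. Qed.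

Lemma pass_linr V W Y Y' (x : hom W (V ** Y')) :
  linear (fun y : hom (V ** Y) W => pass x y).
Proof.
by move=> c f g; rewrite /pass !(tensDr, tensZr) !(compDr, compZr) !(compDl, compZl).
Qed.

Lemma pass_natl V W Y Y' Y'' (f : hom Y' Y'') (x : hom W (V ** Y')) (y : hom (V ** Y) W) :
  (f *t idm _) \oc pass x y = pass ((idm V *t f) \oc x) y.
Proof. by rewrite /pass tld_natY !compA. Qed.

Lemma pass_natr V W Y Y' Y'' (f : hom Y'' Y) (x : hom W (V ** Y')) (y : hom (V ** Y) W) :
  pass x (y \oc (idm V *t f)) = pass x y \oc (idm _ *t f).
Proof.
rewrite /pass -!compA; congr (_ \oc _).
by rewrite -!tensm_idm !tensm_rassoc; push_eqm; match_eqm.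
Qed.

Lemma pass_comp V W U Y Z (x : hom W (V ** Y)) (y : hom (V ** Y) W)
    (x' : hom U (W ** Z)) (y' : hom (W ** Z) U) :
  pass (at12 x Z \oc x') (y' \oc at21 y Z)
    = eqm (tensA Y Z _) \oc (idm Y *t pass x' y') \oc at22 (pass x y) Z.
Proof.
rewrite /pass tld_comp at22E -!compA; congr (_ \oc _).
rewrite -!tensm_idl -!compA; congr (_ \oc _).
rewrite -!tensm_idr tld_tail.
rewrite (ra _ (tld_nat x _)) -!compA; congr (_ \oc _).
rewrite (tld_cast x (esym (tensA a W Z))) at21E; push_eqm.
by rewrite !tensm_rassoc; push_eqm; match_eqm.
Qed.

Lemma pass_unit V : pass (eqm (esym (tensX1 V))) (eqm (tensX1 V))
  = eqm (etrans (tensX1 _) (esym (tens1X _))).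
Proof. by rewrite /pass tld_unit !tens_eqmr !eqmC; apply: eqm_irr. Qed.

(* I is the direct sum of the X_k^* a X_k. *)
Variables (I : ob C) (j : forall k, hom (summand k) I) (q : forall k, hom I (summand k)).
Hypothesis qj : forall k, q k \oc j k = idm _.
Hypothesis qj0 : forall k l, k != l -> q k \oc j l = 0.
Hypothesis jq : \sum_k (j k \oc q k) = idm I.

(** The matrix entry from summand k to summand l of the half braiding on the induced object, the
    value at a of the adjoint of the forgetful functor from the center. The copairing of Hom(X_l,
    X_k Y) makes it independent of bases. *)
Definition block k l Y : hom (summand k ** Y) (Y ** summand l) :=
  d l *: \sum_m pass (@dualx _ _ (X l) (X k ** Y) m) (@dualy _ _ (X l) (X k ** Y) m).

Lemma blockE k l Y (J : finType) (x : J -> hom (X l) (X k ** Y)) (y : J -> hom (X k ** Y) (X l)) :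
  dualfam x y -> block k l Y = d l *: \sum_m pass (x m) (y m).
Proof.
move=> xy; congr (_ *: _); apply: (dualfam_eq one_simple (@dualxyP _ _ C_semisimple one_simple _ _) xy).
  exact: pass_linl.
exact: pass_linr.
Qed.

Definition ihb Y : hom (I ** Y) (Y ** I) :=
  \sum_k \sum_l ((idm Y *t j l) \oc block k l Y \oc (q k *t idm Y)).

Lemma block_nat k l Y Y' (f : hom Y Y') :
  (f *t idm _) \oc block k l Y = block k l Y' \oc (idm _ *t f).
Proof.
rewrite /block compZl compZr comp_suml comp_sumr; congr (_ *: _).
under eq_bigr do rewrite pass_natl.
under [RHS]eq_bigr do rewrite -pass_natr.
exact: (dualfam_transportl one_simple (idm (X k) *t f)
  (dualxyP C_semisimple one_simple _ _) (dualxyP C_semisimple one_simple _ _)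
  (@pass_linl (X k) (X l) Y Y') (@pass_linr (X k) (X l) Y Y')).
Qed.

(** The product axiom entry by entry. A resolution of X_k ** Y supplies the intermediate colour w,
    and the copairing of Hom(X_l, X_k Y Z) is transported to that of Hom(X_l, X_w Z). *)
Lemma block_comp k l Y Z :
  block k l (Y ** Z) = \sum_w (eqm (tensA Y Z _) \oc (idm Y *t block w l Z)
      \oc at22 (block k w Y) Z).
Proof.
pose dP := dualxyP C_semisimple one_simple.
transitivity (\sum_w d l *: (d w *: \sum_m \sum_o
   pass (at12 (@dualx _ _ (X w) (X k ** Y) m) Z \oc (@dualx _ _ (X l) (X w ** Z) o))
        ((@dualy _ _ (X l) (X w ** Z) o) \oc at21 (@dualy _ _ (X w) (X k ** Y) m) Z))).
  rewrite -scaler_sumr; congr (_ *: _).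
  have R := resolution C_semisimple one_simple X_repr (fun w => dP (X w) (X k ** Y)).
  have R' : \sum_w d w *: (\sum_m (at12 (@dualx _ _ (X w) (X k ** Y) m) Z
      \oc at21 (@dualy _ _ (X w) (X k ** Y) m) Z)) = idm (X k ** (Y ** Z)).
    transitivity (eqm (esym (tensA (X k) Y Z)) \oc (idm (X k ** Y) *t idm Z)
        \oc eqm (tensA (X k) Y Z)); last by rewrite tensm_idm compm1 eqmK.
    rewrite -R tens_suml comp_sumr comp_suml; apply: eq_bigr => w _.
    rewrite tensZl compZr compZl tens_suml comp_sumr comp_suml; congr (_ *: _).
    by apply: eq_bigr => m _; rewrite at12E at21E -tensm_idr !compA.
  transitivity (\sum_m \sum_w d w *: (\sum_m' pass (@dualx _ _ (X l) (X k ** (Y ** Z)) m)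
     (@dualy _ _ (X l) (X k ** (Y ** Z)) m \oc at12 (@dualx _ _ (X w) (X k ** Y) m') Z
      \oc at21 (@dualy _ _ (X w) (X k ** Y) m') Z))).
    apply: eq_bigr => m _; rewrite -{1}[dualy m]compm1 -R' comp_sumr.
    rewrite (lin_sum (pass_linr _)); apply: eq_bigr => w _.
    rewrite compZr (linZ (pass_linr _)) comp_sumr (lin_sum (pass_linr _)).
    by congr (_ *: _); apply: eq_bigr => m' _; rewrite compA.
  rewrite exchange_big; apply: eq_bigr => w _ /=; rewrite -scaler_sumr; congr (_ *: _).
  rewrite exchange_big; apply: eq_bigr => m' _ /=; symmetry.
  apply: (dualfam_transportl one_simple (at12 (dualx m') Z) (dP _ _) (dP _ _)
     (Psi := fun x y => pass x (y \oc at21 (dualy m') Z))) => [y|x] c f g.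
    by rewrite pass_linl.
  by rewrite compDl compZl pass_linr.
apply: eq_bigr => w _; rewrite /block (linZ (at22_linear _)) tensZr compZr compZl compZr.
congr (_ *: (_ *: _)).
rewrite (lin_sum (at22_linear _)) comp_sumr.
apply: eq_bigr => m _; rewrite tens_sumr comp_sumr comp_suml; apply: eq_bigr => o _.
exact: pass_comp.
Qed.

(** End(X_k) is a line on which the identity pairs with itself to d k, whence the inverse. *)
Lemma dualfam_id k : @dualfam _ _ (X k) (X k) unit (fun=> idm _) (fun=> (d k)^-1 *: idm _).
Proof.
apply: dualfam1 => // g; rewrite big_const card_unit /= addr0.
by rewrite compZl comp1m trZ // -(endo_scalar C_semisimple one_simple X_repr).
Qed.

Lemma block_one k : block k k unit_ob = eqm (etrans (tensX1 _) (esym (tens1X _))).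
Proof.
rewrite (@blockE _ _ _ unit (fun=> eqm (esym (tensX1 _))) (fun=> (d k)^-1 *: eqm (tensX1 _))).
  rewrite big_const card_unit /= addr0 (linZ (pass_linr _)) scalerA mulfV ?scale1r.
    exact: pass_unit.
  exact: (d_neq0 C_semisimple one_simple X_repr).
apply: dualfam1 => // g; rewrite big_const card_unit /= addr0 compZl.
have := endo_scalar C_semisimple one_simple X_repr (eqm (tensX1 (X k)) \oc g).
move/(congr1 (fun h => eqm (esym (tensX1 (X k))) \oc h)).
by rewrite eqmKA compZr compm1 trZ.
Qed.

Lemma block_one0 k l : k != l -> block k l unit_ob = 0.
Proof.
move=> kl; rewrite /block big1 ?scaler0 // => m _.
suff -> : @dualx _ _ (X l) (X k ** unit_ob) m = 0 by rewrite (lin0 (pass_linl _)).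
have [e|/hom_neq0_eq e] := classic (eqm (tensX1 (X k)) \oc @dualx _ _ (X l) (X k ** unit_ob) m = 0).
  by rewrite -[LHS](eqmKA (tensX1 (X k)) (esym (tensX1 (X k)))) e comp0r.
by rewrite (e C_semisimple X_repr) eqxx in kl.
Qed.

Lemma ihb_nat Y Z (f : hom Y Z) : (f *t idm I) \oc ihb Y = ihb Z \oc (idm I *t f).
Proof.
rewrite /ihb comp_suml comp_sumr; apply: eq_bigr => k _.
rewrite comp_suml comp_sumr; apply: eq_bigr => l _.
rewrite !compA tens_interchange -!compA; congr (_ \oc _).
by rewrite tens_interchange compA block_nat -compA.
Qed.

Lemma ihb_one : eqm (tens1X I) \oc ihb unit_ob = eqm (tensX1 I).
Proof.
rewrite /ihb; transitivity (\sum_k (eqm (tens1X I) \oc ((idm unit_ob *t j k)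
     \oc block k k unit_ob \oc (q k *t idm unit_ob)))).
  rewrite comp_sumr; apply: eq_bigr => k _; congr (_ \oc _).
  rewrite (bigD1 k) //= big1 ?addr0 // => l lk.
  by rewrite block_one0 1?eq_sym // comp0r comp0l.
transitivity ((\sum_k (j k \oc q k)) \oc eqm (tensX1 I)); last by rewrite jq comp1m.
rewrite comp_suml; apply: eq_bigr => k _.
by rewrite block_one tens1f_eqm tensf1_eqm; push_eqm; match_eqm.
Qed.

Lemma ihb_incl k Y : ihb Y \oc (j k *t idm Y) = \sum_l ((idm Y *t j l) \oc block k l Y).
Proof.
rewrite /ihb comp_suml (bigD1 k) //= [X in _ + X]big1 ?addr0 => [|k' kk']; last first.
  rewrite comp_suml big1 // => l _.
  by rewrite -compA tensm_idr qj0 // tens0l comp0r.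
by rewrite comp_suml; apply: eq_bigr => l _; rewrite -compA tensm_idr qj tensm_idm compm1.
Qed.

Lemma ihb_tens Y Z : ihb (Y ** Z) = eqm (tensA Y Z I) \oc (idm Y *t ihb Z)
      \oc eqm (esym (tensA Y I Z)) \oc (ihb Y *t idm Z) \oc eqm (tensA I Y Z).
Proof.
transitivity (eqm (tensA Y Z I) \oc (idm Y *t ihb Z) \oc at22 (ihb Y) Z); last first.
  by rewrite at22E !compA.
rewrite {3}/ihb (lin_sum (at22_linear _)) comp_sumr; apply: eq_bigr => k _.
rewrite (lin_sum (at22_linear _)) comp_sumr.
transitivity (\sum_w (eqm (tensA Y Z I) \oc (idm Y *t (ihb Z \oc (j w *t idm Z)))
     \oc at22 (block k w Y) Z \oc (q k *t idm (Y ** Z)))); last first.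
  apply: eq_bigr => w _; rewrite !at22_comp at22_idl at22_idr -tensm_idl.
  by rewrite !compA.
transitivity (\sum_w \sum_l ((idm (Y ** Z) *t j l) \oc (eqm (tensA Y Z _)
      \oc (idm Y *t block w l Z) \oc at22 (block k w Y) Z) \oc (q k *t idm (Y ** Z)))).
  rewrite exchange_big; apply: eq_bigr => l _ /=.
  by rewrite block_comp comp_sumr comp_suml.
apply: eq_bigr => w _; rewrite ihb_incl tens_sumr comp_sumr !comp_suml.
apply: eq_bigr => l _; rewrite -tensm_idl -tensm_idm tensm_rassoc -!compA.
by rewrite eqmKA.
Qed.

Definition induced : center_ob C :=
  Center (braid_inverse ihb_nat ihb_tens ihb_one) ihb_nat ihb_tens ihb_one.

Section FromUnit.
Variables (V : ob C) (w : hom unit_ob V) (p : hom V unit_ob).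
Hypotheses (pw : p \oc w = idm _).

(** The representative V of the unit is only isomorphic to it. The maps w and p stand in for an
    identity, and [spread] inserts the dual of p in front of the tail. *)
Definition spread T : hom T (dual V ** T) :=
  locked_with at_key (eqm (tens1X _) \oc (p *t idm (dual V ** T)) \oc coevt V T).

Lemma spreadE T : spread T = eqm (tens1X _) \oc (p *t idm (dual V ** T)) \oc coevt V T.
Proof. exact: locked_withE. Qed.

Lemma spread_nat T T' (g : hom T T') : spread T' \oc g = (idm _ *t g) \oc spread T.
Proof.
rewrite !spreadE -!compA coevt_nat (ra _ (tens_interchange p _)) !compA.
by rewrite -tensm1f.
Qed.

Lemma tld_spread W Y (x : hom W (V ** Y)) T :
  tld x T \oc spread T
    = ((eqm (tens1X Y) \oc (p *t idm Y) \oc x) *t idm (dual W ** T)) \oc coevt W T.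
Proof.
rewrite tldE -!compA -spread_nat (ra _ (esym (spread_nat _))) -compA spreadE.
have e S : evt' V S \oc (eqm (tens1X _) \oc (p *t idm (dual V ** (V ** S))) \oc coevt V (V ** S))
    = eqm (tens1X S) \oc (p *t idm S).
  rewrite !compA -tensm1f -!compA (ra _ (esym (tens_interchange p _))) -compA zz2.
  by rewrite compm1.
rewrite (ra _ (e _)) compA; congr (_ \oc _); rewrite at12E; push_eqm.
by rewrite !tensm_rassoc !tensm_idm; push_eqm; match_eqm.
Qed.

Definition from_unit : hom a (dual V ** (a ** V)) :=
  spread (a ** V) \oc (idm a *t w) \oc eqm (esym (tensX1 a)).

Lemma from_unit_tail Y :
  eqm (etrans (esym (tensA (dual V) (a ** V) Y))
        (f_equal (tens (dual V)) (esym (tensA a V Y)))) \oc (from_unit *t idm Y)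
    = spread (a ** (V ** Y)) \oc (idm a *t ((w *t idm Y) \oc eqm (esym (tens1X Y)))).
Proof.
rewrite /from_unit !spreadE -!tensm_idr (coevt_tail V (esym (tensA a V Y))).
rewrite tensm_rassoc tensm_idm.
rewrite (tens_idm_cast p (etrans (esym (tensA (dual V) (a ** V) Y))
        (f_equal (tens (dual V)) (esym (tensA a V Y))))).
by push_eqm; rewrite !tensm_rassoc; push_eqm; match_eqm.
Qed.

Lemma pass_from_unit W Y (x : hom W (V ** Y)) (y : hom (V ** Y) W) :
  pass x y \oc (from_unit *t idm Y)
    = ((eqm (tens1X Y) \oc (p *t idm Y) \oc x) *t idm (dual W ** (a ** W)))
      \oc coevt W (a ** W) \oc (idm a *t (y \oc ((w *t idm Y) \oc eqm (esym (tens1X Y))))).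
Proof.
rewrite /pass -!compA from_unit_tail (ra _ (esym (spread_nat _))) -!compA.
by rewrite (ra _ (tld_spread _ _)) -!compA tensm_idl.
Qed.

End FromUnit.

(* Restricting the half braiding of the induced object to the summand of the
   unit reaches the summand of b only, through the coevaluation of b. *)
Lemma block_from_unit k l b (w : hom unit_ob (X k)) (p : hom (X k) unit_ob) :
  p \oc w = idm _ ->
  block k l (X b) \oc (from_unit w p *t idm (X b))
    = d l *: \sum_m (((@dualx _ _ (X l) (X b) m) *t idm _) \oc coevt (X l) (a ** X l)
        \oc (idm a *t (@dualy _ _ (X l) (X b) m))).
Proof.
move=> pw; rewrite /block compZl comp_suml; congr (_ *: _).
under eq_bigr do rewrite pass_from_unit.
pose Psi (x : hom (X l) (X b)) (y : hom (X k ** X b) (X l)) :=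
  (x *t idm _) \oc coevt (X l) (a ** X l)
   \oc (idm a *t (y \oc ((w *t idm (X b)) \oc eqm (esym (tens1X (X b)))))).
have T := dualfam_transportl one_simple (eqm (tens1X _) \oc (p *t idm (X b)))
  (dualxyP C_semisimple one_simple (X l) (X k ** X b))
  (dualxyP C_semisimple one_simple (X l) (X b)) (Psi := Psi).
rewrite [LHS]T.
- apply: eq_bigr => m _; rewrite /Psi; congr (_ \oc (_ *t _)).
  rewrite -!compA (ra _ (tensm_idr _ _ _)) pw tensm_idm comp1m eqmC eqm_refl.
  exact: compm1.
- by move=> g c f f'; rewrite /Psi tensDl tensZl !compDl !compZl.
by move=> f c g g'; rewrite /Psi compDl compZl tensDr tensZr compDr compZr.
Qed.

Lemma block_from_unit_eq k b (w : hom unit_ob (X k)) (p : hom (X k) unit_ob) :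
  p \oc w = idm _ ->
  block k b (X b) \oc (from_unit w p *t idm (X b)) = coevt (X b) (a ** X b).
Proof.
move=> pw; rewrite block_from_unit //.
rewrite (dualfam_eq one_simple (dualxyP C_semisimple one_simple _ _) (dualfam_id b)
   (Psi := fun x y => (x *t idm _) \oc coevt (X b) (a ** X b) \oc (idm a *t y))).
- rewrite big_const card_unit /= addr0 tensZr !tensm_idm compZr compm1 comp1m.
  by rewrite scalerA mulfV ?scale1r // (d_neq0 C_semisimple one_simple X_repr).
- by move=> g c f f'; rewrite tensDl tensZl !compDl !compZl.
by move=> f c g g'; rewrite tensDr tensZr compDr compZr.
Qed.

Lemma block_from_unit_neq k l b (w : hom unit_ob (X k)) (p : hom (X k) unit_ob) :
  p \oc w = idm _ -> l != b ->
  block k l (X b) \oc (from_unit w p *t idm (X b)) = 0.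
Proof.
move=> pw lb; rewrite block_from_unit // big1 ?scaler0 // => m _.
have [->|/hom_neq0_eq e] := classic (@dualx _ _ (X l) (X b) m = 0).
  by rewrite tens0l !comp0l.
by rewrite (e C_semisimple X_repr) eqxx in lb.
Qed.

End Induced.

Section InducedSpan.
Variables (F : fieldType) (C : spherical F).
Hypothesis C_semisimple : semisimple C.
Hypothesis one_simple : simple_ob (@unit_ob F C).
Variables (n : nat) (X : 'I_n -> ob C).
Hypothesis X_repr : representatives (@simple_ob F C) (@isomorphic F C) X.

(** Take z induced from a, and s the inclusion of a as the summand of the unit. Crossing X_b leads
    from there to the summand b alone, by a coevaluation. Hence r, which projects to the summand l
    and closes up with g, sees only b = l, where a zigzag leaves g. *)
Lemma half_braiding_realize a l (g : hom (a ** X l) (X l ** a)) :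
  exists (z : center_ob C) (s : hom a (cob z)) (r : hom (cob z) a),
    (idm (X l) *t r) \oc hb z (X l) \oc (s *t idm (X l)) = g /\
    forall b, b != l -> (idm (X b) *t r) \oc hb z (X b) \oc (s *t idm (X b)) = 0.
Proof.
have [ds _ _ _] := C_semisimple; have [I [j [q [qj qj0 jq]]]] := ds n (summand X a).
have [_ _ ex] := X_repr; have [k [w [p [pw _]]]] := ex _ one_simple.
pose z := induced C_semisimple one_simple X_repr qj qj0 jq.
exists z, (j k \oc from_unit a w p), ((evt' (X l) a \oc (idm _ *t g)) \oc q l).
have hbE b : (idm (X b) *t (evt' (X l) a \oc (idm _ *t g) \oc q l)) \oc hb z (X b)
     \oc ((j k \oc from_unit a w p) *t idm (X b))
  = (idm (X b) *t (evt' (X l) a \oc (idm _ *t g)))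
     \oc (block X a k l (X b) \oc (from_unit a w p *t idm (X b))).
  rewrite -tensm_idr -(tensm_idl (X b) _ (q l)) -!compA; congr (_ \oc _).
  rewrite (ra _ (ihb_incl qj qj0 k (X b))).
  rewrite comp_suml comp_sumr (bigD1 l) //= big1 ?addr0 => [|l' l'l].
    by rewrite !compA tensm_idl qj tensm_idm comp1m.
  by rewrite !compA tensm_idl qj0 1?eq_sym // tens0r !comp0l.
split=> [|b bl]; rewrite hbE.
  rewrite block_from_unit_eq // -tensm_idl -compA -coevt_nat compA zz2.
  exact: comp1m.
by rewrite block_from_unit_neq 1?eq_sym // comp0r.
Qed.

End InducedSpan.

(** * The torus form and characters *)

Section TorusForm.
Variables (F : fieldType) (C : spherical F).
Hypothesis C_semisimple : semisimple C.
Hypothesis one_simple : simple_ob (@unit_ob F C).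
Variables (G : finType) (X : G -> ob C).
Hypothesis X_repr : representatives (@simple_ob F C) (@isomorphic F C) X.
Local Notation d i := (dim_ob (X i)).
Local Notation "1" := (@unit_ob F C).
Implicit Types (A B a b v : ob C).

Lemma tr_tail1 A (f : hom A A) : tr (f *t idm 1) = tr f.
Proof. by rewrite tensf1_eqm trC // compA eqmK comp1m. Qed.

Lemma tr_at22 A B (f : hom (A ** B) (A ** B)) : tr (at22 f 1) = tr f.
Proof. by rewrite at22E -(tr_tail1 f) trC // compA eqmK comp1m. Qed.

Section Term.
Variables (a b a' b' v : ob C).

(* The trace of b a v -> b v a' -> v b' a' -> v a' b' -> a v b' -> a b v -> b a v. *)
Definition torus_term (f : hom (a ** b) (b ** a)) (f' : hom (b' ** a') (a' ** b'))
    (al : hom (v ** a') (a ** v)) (al' : hom (a ** v) (v ** a'))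
    (be : hom (v ** b') (b ** v)) (be' : hom (b ** v) (v ** b')) : F :=
  tr (at22 f (v ** 1) \oc (idm a *t at22 be 1) \oc at22 al (b' ** 1)
      \oc (idm v *t at22 f' 1) \oc at22 be' (a' ** 1) \oc (idm b *t at22 al' 1)).

End Term.

Definition torus_form a b a' b' (f : hom (a ** b) (b ** a)) (f' : hom (b' ** a') (a' ** b')) : F :=
  \sum_v d v * \sum_m \sum_n torus_term f f'
    (@dualx _ _ (X v ** a') (a ** X v) m) (@dualy _ _ (X v ** a') (a ** X v) m)
    (@dualx _ _ (X v ** b') (b ** X v) n) (@dualy _ _ (X v ** b') (b ** X v) n).

Lemma lptr_resolution2 v b' Z A (I : G -> finType) (h : hom (v ** Z) (v ** A))
    (x : forall b : G, I b -> hom (X b ** v) (v ** b'))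
    (y : forall b : G, I b -> hom (v ** b') (X b ** v)) :
  (forall b : G, dualfam (x b) (y b)) ->
  \sum_(b : G) d b *: (\sum_m (at22 (x b m) A \oc (idm (X b) *t h) \oc at22 (y b m) Z))
    = idm v *t (idm b' *t lptr h).
Proof.
move=> xy; have R := lptr_resolution C_semisimple one_simple X_repr h xy.
transitivity (eqm (esym (tensA v b' A)) \oc (idm (v ** b') *t lptr h) \oc eqm (tensA v b' Z)).
  rewrite -R comp_sumr comp_suml; apply: eq_bigr => b _.
  rewrite compZr compZl comp_sumr comp_suml; congr (_ *: _); apply: eq_bigr => m _.
  by rewrite !at22E at21E at12E !compA.
by rewrite -tensm_idm tensm_rassoc -!compA eqmK compm1 eqmKA.
Qed.

Section Character.
Variables (z : center_ob C).
Local Notation Z := (cob z).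

(* ab -> Zb -> bZ -> ba through elements s, r of Hom(a, Z), Hom(Z, a). *)
Definition pull a b (s : hom a Z) (r : hom Z a) : hom (a ** b) (b ** a) :=
  (idm b *t r) \oc hb z b \oc (s *t idm b).

(** This represents chi_Z: by closing the strand b, a morphism f' : ba -> ab induces an operator on
    Hom(Z, a), and tr (f' \oc character a b) is the trace of that operator. *)
Definition character a b : hom (a ** b) (b ** a) :=
  \sum_m pull b (@dualy _ _ Z a m) (@dualx _ _ Z a m).

(** Sliding the strand Z through the box be trades its crossing with b for one with b'. The
    crossings with v created on both sides attach to r and to s. *)
Lemma prism_pull a b a' b' v (s : hom a Z) (r : hom Z a) f'
    (al : hom (v ** a') (a ** v)) al' (be : hom (v ** b') (b ** v)) be' :
  torus_term (pull b s r) f' al al' be be'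
  = tr ((idm v *t at22 f' 1)
      \oc (at22 be' (a' ** 1) \oc (idm b *t (at22 (al' \oc (r *t idm v) \oc hbi z v) 1))
            \oc at22 be (Z ** 1))
      \oc (idm v *t at22 (hb z b') 1)
      \oc at22 (hb z v \oc (s *t idm v) \oc al) (b' ** 1)).
Proof.
pose e1 := slide22 (hb_natural z) (hb_tens z) be 1.
have e2 : at22 (hb z b) (v ** 1) \oc (idm Z *t at22 be 1)
   = (idm b *t at22 (hbi z v) 1) \oc at22 be (Z ** 1) \oc (idm v *t at22 (hb z b') 1)
      \oc at22 (hb z v) (b' ** 1).
  rewrite -[RHS]compA -/(braid2 (hb z) v b' 1) -[RHS]compA slide22.
  - rewrite /braid2 !compA tensm_idl (at22K _ (hbiK z v)) tensm_idm.
    by rewrite comp1m.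
  - exact: hb_natural.
  exact: hb_tens.
rewrite /torus_term /pull !at22_comp at22_idl !at22_idr -!compA.
rewrite (ra _ (tens_interchange s _)) -!compA (ra _ e2) -!compA.
do 6!rewrite compA.
by rewrite trC // -!tensm_idl -!compA.
Qed.

(** Now be and be' enclose only the factor containing r, so the sum over b is a rotated resolution
    of the identity and closes that factor over v. The trace closes the factor containing s. *)
Lemma sum_prism_pull a a' b' v (s : hom a Z) (r : hom Z a) f'
    (al : hom (v ** a') (a ** v)) al' :
  \sum_b d b * \sum_n torus_term (pull (X b) s r) f' al al'
     (@dualx _ _ (v ** b') (X b ** v) n) (@dualy _ _ (v ** b') (X b ** v) n)
  = tr (f' \oc (idm b' *t lptr (al' \oc (r *t idm v) \oc hbi z v)) \oc hb z b'
        \oc (lptr (hb z v \oc (s *t idm v) \oc al) *t idm b')).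
Proof.
set x := al' \oc _ \oc _; set y := _ \oc al.
have L := lptr_resolution2 (at22 x 1) (fun b : G => dualfam_sym one_simple
   (dualxyP C_semisimple one_simple (v ** b') (X b ** v))).
transitivity (tr ((idm v *t at22 f' 1) \oc (idm v *t (idm b' *t lptr (at22 x 1)))
    \oc (idm v *t at22 (hb z b') 1) \oc at22 y (b' ** 1))).
  rewrite -L comp_sumr !comp_suml tr_sum //; apply: eq_bigr => b _.
  rewrite compZr !compZl trZ // comp_sumr !comp_suml tr_sum //; congr (_ * _).
  by apply: eq_bigr => n _; rewrite prism_pull.
rewrite !tensm_idl -tr_lptr // lptr_natl -!lptr_tens -[RHS]tr_at22.
by rewrite !at22_comp at22_idl at22_idr.
Qed.

Definition pair_sum a' b' (f' : hom (b' ** a') (a' ** b')) (x : hom Z a') (y : hom a' Z) : F :=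
  tr (f' \oc (idm b' *t x) \oc hb z b' \oc (y *t idm b')).

Lemma pair_sum_linl a' b' (f' : hom (b' ** a') (a' ** b')) y :
  linear (fun x => pair_sum f' x y : F^o).
Proof.
move=> c x x'; rewrite /pair_sum tensDr tensZr compDr compZr !compDl !compZl.
exact: tr_linear.
Qed.

Lemma pair_sum_linr a' b' (f' : hom (b' ** a') (a' ** b')) x :
  linear (fun y => pair_sum f' x y : F^o).
Proof.
by move=> c y y'; rewrite /pair_sum tensDl tensZl compDr compZr tr_linear.
Qed.

(** Expanding the first loop in a basis of Hom(Z, a') uses up the copairing of al and al'; the loops
    around r and s fuse into the one loop of the average of s r. *)
Lemma sum_average a a' (s : hom a Z) (r : hom Z a) (Psi : hom Z a' -> hom a' Z -> F) :
  (forall y, linear (fun x => Psi x y : F^o)) -> (forall x, linear (fun y => Psi x y : F^o)) ->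
  \sum_v d v * \sum_m Psi
     (lptr (@dualy _ _ (X v ** a') (a ** X v) m \oc (r *t idm (X v)) \oc hbi z (X v)))
     (lptr (hb z (X v) \oc (s *t idm (X v)) \oc @dualx _ _ (X v ** a') (a ** X v) m))
  = \sum_o Psi (@dualx _ _ Z a' o) (average X (s \oc r) \oc @dualy _ _ Z a' o).
Proof.
move=> linl linr; have [D _] := dualxyP C_semisimple one_simple Z a'.
transitivity (\sum_v d v * \sum_o Psi (@dualx _ _ Z a' o)
     (lptr (conj (s \oc r) (X v)) \oc @dualy _ _ Z a' o)).
  apply: eq_bigr => v _; congr (_ * _).
  transitivity (\sum_m \sum_o tr (@dualy _ _ Z a' o \oc
       lptr (@dualy _ _ (X v ** a') (a ** X v) m \oc (r *t idm (X v)) \oc hbi z (X v)))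
     *: (Psi (@dualx _ _ Z a' o)
     (lptr (hb z (X v) \oc (s *t idm (X v)) \oc @dualx _ _ (X v ** a') (a ** X v) m)) : F^o)).
    apply: eq_bigr => m _; rewrite -{1}[lptr (dualy m \oc _ \oc _)]D (lin_sum (linl _)).
    by apply: eq_bigr => o _; rewrite (linZ (linl _)).
  rewrite exchange_big; apply: eq_bigr => o _ /=.
  have [E _] := dualxyP C_semisimple one_simple (X v ** a') (a ** X v).
  rewrite -lptr_natr /conj.
  have -> : hb z (X v) \oc ((s \oc r) *t idm (X v)) \oc hbi z (X v) \oc (idm (X v) *t dualy o)
    = hb z (X v) \oc (s *t idm (X v)) \oc ((r *t idm (X v)) \oc hbi z (X v) \oc (idm (X v) *t dualy o)).
    by rewrite -tensm_idr !compA.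
  rewrite -[K in lptr (_ \oc K)]E comp_sumr (lin_sum (@lptr_linear _ _ _ _ _)).
  rewrite (lin_sum (linr _)); apply: eq_bigr => m _.
  rewrite compZr (linZ (@lptr_linear _ _ _ _ _)) (linZ (linr _)).
  apply: (f_equal2 (fun c (t : F^o) => c *: t)) => //.
  by rewrite -lptr_natl tr_lptr // trC // !compA.
under eq_bigr do rewrite mulr_sumr.
rewrite exchange_big; apply: eq_bigr => o _ /=.
rewrite /average comp_suml (lin_sum (linr _)); apply: eq_bigr => v _.
by rewrite compZl (linZ (linr _)).
Qed.

Lemma torus_form_pull a a' b' (s : hom a Z) (r : hom Z a)
    (f' : hom (b' ** a') (a' ** b')) lambda :
  average X (s \oc r) = lambda *: idm Z ->
  \sum_b d b * torus_form (pull (X b) s r) f' = lambda * tr (f' \oc character a' b').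
Proof.
move=> sr.
transitivity (\sum_v d v * \sum_m pair_sum f'
     (lptr (@dualy _ _ (X v ** a') (a ** X v) m \oc (r *t idm (X v)) \oc hbi z (X v)))
     (lptr (hb z (X v) \oc (s *t idm (X v)) \oc @dualx _ _ (X v ** a') (a ** X v) m))).
  rewrite /torus_form; under eq_bigr do rewrite mulr_sumr.
  rewrite exchange_big; apply: eq_bigr => v _ /=.
  transitivity (\sum_b \sum_m d v * (d b * \sum_n torus_term (pull (X b) s r) f'
      (@dualx _ _ (X v ** a') (a ** X v) m) (@dualy _ _ (X v ** a') (a ** X v) m)
      (@dualx _ _ (X v ** b') (X b ** X v) n) (@dualy _ _ (X v ** b') (X b ** X v) n))).
    apply: eq_bigr => b _; rewrite mulrCA !mulr_sumr; apply: eq_bigr => m _.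
    by rewrite mulrCA.
  rewrite exchange_big mulr_sumr; apply: eq_bigr => m _ /=; rewrite -mulr_sumr.
  by rewrite sum_prism_pull.
rewrite (sum_average s r (pair_sum_linl f') (pair_sum_linr f')) sr.
rewrite /character comp_sumr tr_sum // mulr_sumr; apply: eq_bigr => o _.
by rewrite compZl comp1m (linZ (pair_sum_linr _ _)) /pair_sum /pull !compA.
Qed.

End Character.

Definition push z a b (s : hom a (cob z)) (r : hom (cob z) a) : hom (b ** a) (a ** b) :=
  (r *t idm b) \oc hbi z b \oc (idm b *t s).

(** The orthogonality computation: the closed strand b conjugates a map from z2 to z1 by both half
    braidings, so its weighted sum is an average. *)
Lemma character_push z1 z2 a (s : hom a (cob z2)) (r : hom (cob z2) a) :
  \sum_b d b * tr (push (X b) s r \oc character z1 a (X b))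
  = \sum_o tr (@dualx _ _ (cob z1) a o \oc average X (@dualy _ _ (cob z1) a o \oc r) \oc s).
Proof.
under eq_bigr do rewrite /character comp_sumr tr_sum // mulr_sumr.
rewrite exchange_big; apply: eq_bigr => o _ /=.
rewrite /average comp_sumr comp_suml tr_sum //; apply: eq_bigr => b _.
rewrite compZr compZl trZ //; congr (_ * _).
rewrite -lptr_natl -lptr_natr tr_lptr // /push /pull /conj trC //.
by rewrite -!compA -tensm_idr -!compA.
Qed.

End TorusForm.

(** * Triangles, theta graphs and tetrahedra *)

Section Bends.
Variables (F : fieldType) (C : spherical F).
Hypothesis one_simple : simple_ob (@unit_ob F C).
Implicit Types (A B U K W Y Z T : ob C).
Local Notation "1" := (@unit_ob F C).

Lemma evtM A B T (e : (A ** B) ** (dual (A ** B) ** T) = A ** (B ** (dual B ** (dual A ** T)))) :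
  evt (A ** B) T = evt A T \oc (idm A *t evt B (dual A ** T)) \oc eqm e.
Proof.
rewrite !evtE evM; push_eqm.
by rewrite !tensm_rassoc !tensm_idm; push_eqm; match_eqm.
Qed.

Lemma evt_cast X S T (e : S = T) :
  evt X S = eqm (esym e) \oc evt X T \oc eqm (f_equal (fun Z => X ** (dual X ** Z)) e).
Proof. by case: T / e; rewrite !eqm_refl comp1m compm1. Qed.

Lemma evt'_cast X S T (e : S = T) :
  evt' X S = eqm (esym e) \oc evt' X T \oc eqm (f_equal (fun Z => dual X ** (X ** Z)) e).
Proof. by case: T / e; rewrite !eqm_refl comp1m compm1. Qed.

Lemma bendr_tail W Y Z (h : W = Z ** dual Y) (x : hom 1 W) T :
  bendr h x *t idm T = (idm Z *t evt' Y T) \oc at02 (eqm h \oc x) (Y ** T).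
Proof.
rewrite /bendr evt'E at02E; push_eqm.
by rewrite !tensm_rassoc !tensm_idm; push_eqm; match_eqm.
Qed.

Lemma bendl_tail W Y Z (h : W = dual Y ** Z) (x : hom 1 W) T :
  bendl h x *t idm T = evt Y (Z ** T) \oc (idm Y *t at02 (eqm h \oc x) T).
Proof.
rewrite /bendl evtE at02E; push_eqm.
by rewrite !tensm_rassoc !tensm_idm; push_eqm; match_eqm.
Qed.

Lemma unbendr_tail W Y Z (h : W = Z ** dual Y) (x : hom 1 W) T :
  at02 (eqm h \oc x) T = (bendr h x *t idm (dual Y ** T)) \oc coevt Y T.
Proof.
rewrite bendr_tail -compA nat02 compA tensm_idl zz4 tensm_idm comp1m.
by [].
Qed.

Lemma ldual_tail Y Z (s : hom Y Z) T : ldual s *t idm T = evt' Z (dual Y ** T)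
    \oc (idm (dual Z) *t (s *t idm (dual Y ** T))) \oc (idm (dual Z) *t coevt Y T).
Proof.
rewrite /ldual evt'E coevtE; push_eqm.
by rewrite !tensm_rassoc !tensm_idm; push_eqm; match_eqm.
Qed.

(** Bending left the strand that [bendr] leaves as its target, while the other strand stays put, is
    exactly the left dual of the right bend. *)
Lemma bendl_dual W U K Z (h : W = dual (dual K) ** Z) (h' : W = K ** dual U)
    (e : dual U = Z) (x : hom 1 W) :
  bendl h x = eqm e \oc ldual (bendr h' x).
Proof.
case: Z / e h => h; rewrite eqm_refl comp1m; apply: tail1_inj.
rewrite bendl_tail ldual_tail -compA tensm_idl -unbendr_tail evt_dual -compA tensm_idl.
by congr (_ \oc (_ *t _)); rewrite !at02E; push_eqm; match_eqm.
Qed.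

Lemma bendl_functional W U K P (eP : P = U ** dual K) (h : W = dual P ** 1)
    (h' : W = K ** dual U) (x : hom 1 W) :
  bendl h x = ev K \oc (bendr h' x *t idm (dual K)) \oc eqm eP.
Proof.
subst P; rewrite /= compm1; apply: tail1_inj.
have e : evt K 1 \oc (bendr h' x *t idm (dual K ** 1)) \oc eqm (esym (tensA U (dual K) 1))
  = eqm (tens1X 1) \oc ((ev K \oc (bendr h' x *t idm (dual K))) *t idm 1).
  rewrite evtE; push_eqm.
  by rewrite !tensm_rassoc !tensm_idm; push_eqm; match_eqm.
rewrite -[RHS](eqmKA (tens1X 1) (esym (tens1X 1))) -e ev_slide pivotal.
have -> : ldual (bendr h' x) *t idm 1 = evt' K (dual U ** 1)
    \oc (idm (dual K) *t at02 (eqm h' \oc x) 1).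
  by rewrite ldual_tail -compA tensm_idl -unbendr_tail.
rewrite bendl_tail.
have e1 : (U ** dual K) ** (dual (U ** dual K) ** (1 ** 1))
   = U ** (dual K ** (dual (dual K) ** (dual U ** (1 ** 1)))).
  by rewrite dualM !tensA.
rewrite (evtM e1) evt_dual (evt_cast U (tens1X 1)).
rewrite (evt'_cast K (f_equal (tens (dual U)) (tens1X 1))) !at02E.
rewrite -(tensm_idm U (dual K)) tensm_rassoc.
by push_eqm; match_eqm.
Qed.

Lemma scalar_tail (f : hom 1 1) :
  eqm (tens1X 1) \oc (f *t idm 1) \oc eqm (esym (tens1X 1)) = scalar_of f *: idm 1.
Proof.
by rewrite -scalar_ofE // tensf1_eqm; push_eqm.
Qed.

Section Tetra.
Variables (A B D H K U V : ob C).

Lemma chain_tail (p : hom V (A ** B)) (q : hom B (H ** D)) (r : hom (A ** H) U)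
    (s : hom (U ** D) K) S :
  (s \oc (r *t idm D) \oc eqm (tensA A H D) \oc (idm A *t q) \oc p) *t idm S
  = at21 s S \oc at21 r (D ** S) \oc (idm A *t at12 q S) \oc at12 p S.
Proof.
rewrite !at21E !at12E; push_eqm.
by rewrite !tensm_rassoc !tensm_idm; push_eqm; match_eqm.
Qed.

Lemma chain_tail' (p : hom V (U ** D)) (q : hom U (A ** H)) (r : hom (H ** D) B)
    (s : hom (A ** B) K) S :
  (s \oc (idm A *t r) \oc eqm (esym (tensA A H D)) \oc (q *t idm D) \oc p) *t idm S
  = at21 s S \oc (idm A *t at21 r S) \oc at12 q (D ** S) \oc at12 p S.
Proof.
rewrite !at21E !at12E; push_eqm.
by rewrite !tensm_rassoc !tensm_idm; push_eqm; match_eqm.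
Qed.

End Tetra.

Lemma tetra_tail (A B D E H K : ob C) (x : hom 1 (A ** (B ** K)))
    (y : hom K (D ** E)) (z : hom (B ** D) H) (w : hom (A ** (H ** E)) 1)
    (x' : hom 1 (A ** (B ** (K ** 1)))) (w' : hom (A ** (H ** (E ** 1))) 1) :
  (forall e e', x' = eqm e \oc (x *t idm 1) \oc eqm e') ->
  (forall e e', w' = eqm e \oc (w *t idm 1) \oc eqm e') ->
  tetra x y z w *: idm 1
   = w' \oc (idm A *t at21 z (E ** 1)) \oc (idm A *t (idm B *t at12 y 1)) \oc x'.
Proof.
have ex : (A ** (B ** K)) ** 1 = A ** (B ** (K ** 1)) by rewrite !tensA.
have ew : A ** (H ** (E ** 1)) = (A ** (H ** E)) ** 1 by rewrite !tensA.
move=> /(_ ex (esym (tens1X 1))) -> /(_ (tens1X 1) ew) ->.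
rewrite /tetra -scalar_tail at21E at12E; push_eqm.
by rewrite !tensm_rassoc !tensm_idm; push_eqm; match_eqm.
Qed.

Lemma vector_tail A B K (x : hom 1 (A ** (B ** dual K))) (h : hom K (A ** B)) :
  eqm (tensA A B (dual K)) \oc x = (h *t idm (dual K)) \oc coev K ->
  forall e e', at12 h (dual K ** 1) \oc coevt K 1 = eqm e \oc (x *t idm 1) \oc eqm e'.
Proof.
move=> ex e e'.
have -> : x = eqm (esym (tensA A B (dual K))) \oc ((h *t idm (dual K)) \oc coev K).
  by rewrite -ex eqmKA.
rewrite at12E coevtE; push_eqm.
by rewrite !tensm_rassoc !tensm_idm; push_eqm; match_eqm.
Qed.

Lemma functional_tail A B L (w : hom (A ** (B ** dual L)) 1) (h : hom (A ** B) L) :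
  w = ev L \oc (h *t idm (dual L)) \oc eqm (tensA A B (dual L)) ->
  forall e e', evt L 1 \oc at21 h (dual L ** 1) = eqm e \oc (w *t idm 1) \oc eqm e'.
Proof.
move=> -> e e'; rewrite at21E evtE; push_eqm.
by rewrite !tensm_rassoc !tensm_idm; push_eqm; match_eqm.
Qed.

Section Tetra.
Variables (l01 l02 l03 l12 l13 l23 : ob C).

(** The dual morphism y slides along the nested caps and becomes h023, which also consumes the cap
    over l23 in z. What is left is the loop l03 -> l01 l13 -> l01 l12 l23 -> l02 l23 -> l03. *)
Lemma tetra_posE (h123 : hom l13 (l12 ** l23)) (h023 : hom (l02 ** l23) l03)
    (h013 : hom l03 (l01 ** l13)) (h012 : hom (l01 ** l12) l02)
    (x : hom 1 (l01 ** (l13 ** dual l03))) (y : hom (dual l03) (dual l23 ** dual l02))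
    (z : hom (l13 ** dual l23) l12) (w : hom (l01 ** (l12 ** dual l02)) 1)
    (ey : dual (l02 ** l23) = dual l23 ** dual l02) :
  eqm (tensA _ _ _) \oc x = (h013 *t idm (dual l03)) \oc coev l03 ->
  y = eqm ey \oc rdual h023 ->
  z = eqm (tensX1 _) \oc (idm l12 *t ev l23) \oc eqm (esym (tensA _ _ _)) \oc (h123 *t idm _) ->
  w = ev l02 \oc (h012 *t idm (dual l02)) \oc eqm (tensA _ _ _) ->
  tetra x y z w
   = tr (h023 \oc (h012 *t idm l23) \oc eqm (tensA _ _ _) \oc (idm l01 *t h123) \oc h013).
Proof.
move=> ex ey' ez ew; apply: (scale1_inj one_simple).
rewrite (tetra_tail _ _ (vector_tail ex) (functional_tail ew)) -trT //.
have zT T : at21 z T = (idm l12 *t evt l23 T) \oc at12 h123 (dual l23 ** T).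
  rewrite ez at21E at12E evtE; push_eqm.
  by rewrite !tensm_rassoc !tensm_idm; push_eqm; match_eqm.
have yT T : evt l02 T \oc ((idm l02 *t evt l23 (dual l02 ** T))
     \oc (idm l02 *t (idm l23 *t at12 y T))) = evt l03 T \oc at21 h023 (dual l03 ** T).
  have -> : at21 h023 (dual l03 ** T) = (h023 *t idm _) \oc eqm (tensA _ _ _) by exact: at21E.
  rewrite [RHS]compA ev_slide; move: (rdual h023) ey' => g ->.
  have e : (l02 ** l23) ** (dual (l02 ** l23) ** T)
    = l02 ** (l23 ** (dual l23 ** (dual l02 ** T))) by rewrite dualM !tensA.
  rewrite (evtM e) at12E; push_eqm.
  rewrite -(tensm_idm l02 l23) tensm_rassoc.
  by push_eqm; match_eqm.
have e1 T : (idm l01 *t at12 h123 (dual l23 ** (dual l02 ** T)))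
     \oc (idm l01 *t (idm l13 *t at12 y T))
   = (idm l01 *t (idm l12 *t (idm l23 *t at12 y T)))
     \oc (idm l01 *t at12 h123 (dual l03 ** T)) by rewrite tensm_idl nat12 -tensm_idl.
rewrite zT chain_tail -tensm_idl -!compA (ra _ (e1 1)) -!compA.
rewrite (ra _ (nat21 (evt l23 _) h012)) -!compA.
rewrite (ra _ (nat21 (idm l23 *t at12 y 1) h012)) -!compA.
by rewrite (ra3 _ (yT 1)) -!compA.
Qed.

(** A zigzag unbends y to h023, leaving the reversed loop l03 -> l02 l23 -> l01 l12 l23 -> l01 l13
    -> l03. *)
Lemma tetra_negE (h123 : hom (l12 ** l23) l13) (h023 : hom l03 (l02 ** l23))
    (h013 : hom (l01 ** l13) l03) (h012 : hom l02 (l01 ** l12))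
    (x : hom 1 (l01 ** (l12 ** dual l02))) (y : hom (dual l02) (l23 ** dual l03))
    (w : hom (l01 ** (l13 ** dual l03)) 1) (x0 : hom 1 (l02 ** (l23 ** dual l03)))
    W (x0' : hom 1 W) (ey : W = dual (dual l02) ** (l23 ** dual l03))
    (e0 : W = l02 ** (l23 ** dual l03)) :
  eqm (tensA _ _ _) \oc x = (h012 *t idm (dual l02)) \oc coev l02 ->
  y = bendl ey x0' -> x0 = eqm e0 \oc x0' ->
  eqm (tensA _ _ _) \oc x0 = (h023 *t idm (dual l03)) \oc coev l03 ->
  w = ev l03 \oc (h013 *t idm (dual l03)) \oc eqm (tensA _ _ _) ->
  tetra x y h123 w
   = tr (h013 \oc (idm l01 *t h123) \oc eqm (esym (tensA _ _ _)) \oc (h012 *t idm l23) \oc h023).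
Proof.
move=> ex -> ex0 e023 ew; apply: (scale1_inj one_simple).
rewrite (tetra_tail _ _ (vector_tail ex) (functional_tail ew)) -trT //.
have yT : (idm l02 *t at12 (bendl ey x0') 1) \oc coevt l02 1
   = at12 h023 (dual l03 ** 1) \oc coevt l03 1.
  have e1 : 1 = 1 ** 1 by rewrite tens1X.
  have e2 : (l02 ** (l23 ** dual l03)) ** 1 = l02 ** (l23 ** (dual l03 ** 1)) by rewrite -!tensA.
  rewrite (vector_tail e023 e2 e1) ex0.
  have zz S (Q : hom 1 (l02 ** S)) :
      (idm l02 *t (evt' l02 S \oc (idm (dual l02) *t Q))) \oc coevt l02 1 = Q.
    by rewrite -tensm_idl -compA -coevt_nat compA zz2 comp1m.
  rewrite at12E bendl_tail evt_dual at02E -(compA (evt' _ _)) tensm_idl.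
  by rewrite -tensm_idl -compA zz; push_eqm; match_eqm.
rewrite chain_tail' -!compA (ra _ (esym (nat12 (at12 (bendl ey x0') 1) h012))) -!compA.
by rewrite yT.
Qed.
End Tetra.

Lemma at02_inj A B (f g : hom 1 (A ** B)) : at02 f 1 = at02 g 1 -> f = g.
Proof.
rewrite !at02E => /(congr1 (fun k => eqm (tensA A B 1) \oc k \oc eqm (tens1X 1))).
by rewrite -!compA !eqmKA eqmK !compm1 => /tail1_inj.
Qed.

Lemma unbendr W Y Z (h : W = Z ** dual Y) (x : hom 1 W) :
  eqm h \oc x = (bendr h x *t idm (dual Y)) \oc coev Y.
Proof.
apply: at02_inj; rewrite unbendr_tail coevtE at02E; push_eqm.
by rewrite !tensm_rassoc !tensm_idm; push_eqm; match_eqm.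
Qed.

Lemma bendr_prod A D U W (h : W = A ** dual (U ** dual D)) (h' : W = (A ** D) ** dual U)
    (x : hom 1 W) :
  bendr h x = eqm (tensX1 A) \oc (idm A *t ev D) \oc eqm (esym (tensA A D (dual D)))
    \oc (bendr h' x *t idm (dual D)).
Proof.
apply: tail1_inj.
transitivity ((idm A *t evt D 1) \oc eqm (esym (tensA A D (dual D ** 1)))
    \oc (bendr h' x *t idm (dual D ** 1)) \oc eqm (esym (tensA U (dual D) 1))); last first.
  rewrite evtE; push_eqm.
  by rewrite !tensm_rassoc !tensm_idm; push_eqm; match_eqm.
have e : dual (U ** dual D) ** ((U ** dual D) ** 1)
   = dual (dual D) ** (dual U ** (U ** (dual D ** 1))) by rewrite dualM !tensA.
rewrite !bendr_tail (evt'M e) evt'_dual !at02E; push_eqm.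
rewrite (tens_idm_cast x (esym (tensA U (dual D) 1))) -(tensm_idm A D) tensm_rassoc.
rewrite (tens_cast_idm (evt' U _) (dualK D)).
by push_eqm; match_eqm.
Qed.

End Bends.

(** * Triangle vectors as splittings and mergings of strands; theta as the trace pairing *)

Section Graphs.
Variables (F : fieldType) (C : spherical F).
Hypothesis one_simple : simple_ob (@unit_ob F C).
Variables (G : finType) (X : G -> ob C).
Implicit Types i j k : G.

Definition hpos i j k (x : Vpos X i j k) : hom (X k) (X i ** X j) :=
  locked_with at_key (bendr (tensA (X i) (X j) (dual (X k))) x).

Lemma hposE i j k (x : Vpos X i j k) : hpos x = bendr (tensA (X i) (X j) (dual (X k))) x.
Proof. exact: locked_withE. Qed.

Lemma wneg_bend i j k : wneg X i j k = X k ** dual (X i ** X j).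
Proof. by rewrite dualM. Qed.

Definition hneg i j k (y : Vneg X i j k) : hom (X i ** X j) (X k) :=
  locked_with at_key (bendr (wneg_bend i j k) y).

Lemma hnegE i j k (y : Vneg X i j k) h : hneg y = bendr (Y := X i ** X j) (Z := X k) h y.
Proof. by rewrite (proof_irrelevance _ h (wneg_bend i j k)); exact: locked_withE. Qed.

Lemma bendl_hneg i j k (y : Vneg X i j k) :
  bendl (wneg_dual X i j k) y = ev (X k) \oc (hneg y *t idm (dual (X k)))
    \oc eqm (tensA (X i) (X j) (dual (X k))).
Proof. by rewrite (hnegE _ (wneg_bend i j k)); apply: bendl_functional. Qed.

Lemma theta_tr i j k (x : Vpos X i j k) (y : Vneg X i j k) :
  theta x y = tr (hneg y \oc hpos x).
Proof.
rewrite /theta bendl_hneg /tr /trace; congr scalar_of.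
transitivity (ev (X k) \oc (hneg y *t idm (dual (X k)))
    \oc ((hpos x *t idm (dual (X k))) \oc coev (X k))).
  rewrite -[LHS]compA; congr (_ \oc _); rewrite hposE; exact: unbendr.
by rewrite -[LHS]compA -[RHS]compA (ra _ (tensm_idr _ _ _)).
Qed.

Lemma tetra_posP l01 l02 l03 l12 l13 l23 (x123 : Vpos X l12 l23 l13)
    (x023 : Vneg X l02 l23 l03) (x013 : Vpos X l01 l13 l03) (x012 : Vneg X l01 l12 l02) :
  tetra_pos x123 x023 x013 x012
   = tr (hneg x023 \oc (hneg x012 *t idm (X l23)) \oc eqm (tensA _ _ _)
          \oc (idm (X l01) *t hpos x123) \oc hpos x013).
Proof.
have e : dual (X l02 ** X l23) = dual (X l23) ** dual (X l02) by rewrite dualM.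
apply: (tetra_posE one_simple (ey := e)).
- by rewrite hposE; apply: unbendr.
- by rewrite pivotal (hnegE _ (wneg_bend _ _ _)); apply: bendl_dual.
- by rewrite hposE; apply: bendr_prod.
exact: bendl_hneg.
Qed.

Lemma tetra_negP l01 l02 l03 l12 l13 l23 (x123 : Vneg X l12 l23 l13)
    (x023 : Vpos X l02 l23 l03) (x013 : Vneg X l01 l13 l03) (x012 : Vpos X l01 l12 l02) :
  tetra_neg x123 x023 x013 x012
   = tr (hneg x013 \oc (idm (X l01) *t hneg x123) \oc eqm (esym (tensA _ _ _))
          \oc (hpos x012 *t idm (X l23)) \oc hpos x023).
Proof.
rewrite (hnegE x123 (tneg_z X l12 l13 l23)).
apply: (tetra_negE one_simple _ (x0 := x023) (x0' := x023) (ey := tneg_y X l02 l03 l23) (e0 := erefl)).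
- by rewrite hposE; apply: unbendr.
- by [].
- by rewrite comp1m.
- by rewrite hposE; apply: unbendr.
exact: bendl_hneg.
Qed.

Hypothesis C_semisimple : semisimple C.
Local Notation "1" := (@unit_ob F C).

Lemma bendr_eqm_inj (W Y Z : ob C) (h : W = Z ** dual Y) (x x' : hom 1 W) :
  bendr h x = bendr h x' -> x = x'.
Proof.
move=> e; have := unbendr h x; rewrite e -(unbendr h x').
move/(congr1 (fun t => eqm (esym h) \oc t)).
by rewrite !eqmKA.
Qed.

Lemma bendr_surj (W Y Z : ob C) (h : W = Z ** dual Y) (g : hom Y Z) :
  exists x : hom 1 W, bendr h x = g.
Proof.
exists (eqm (esym h) \oc ((g *t idm (dual Y)) \oc coev Y)); apply: tail1_inj.
rewrite bendr_tail eqmKA.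
have -> : at02 ((g *t idm (dual Y)) \oc coev Y) (Y ** 1)
    = (g *t idm (dual Y ** (Y ** 1))) \oc coevt Y (Y ** 1).
  rewrite at02E coevtE; push_eqm.
  by rewrite !tensm_rassoc !tensm_idm; push_eqm; match_eqm.
by rewrite compA -tens_interchange -compA zz2 compm1.
Qed.

Lemma bendr_linear (W Y Z : ob C) (h : W = Z ** dual Y) : linear (fun x : hom 1 W => bendr h x).
Proof.
by move=> c f g; rewrite /bendr !(compDr, compZr) !(tensDl, tensZl) !(compDr, compZr) !(compDl, compZl).
Qed.

Lemma hpos_linear i j k : linear (@hpos i j k).
Proof. by move=> c f g; rewrite !hposE; apply: bendr_linear. Qed.

Lemma hneg_linear i j k : linear (@hneg i j k).
Proof. by move=> c f g; rewrite !(hnegE _ (wneg_bend i j k)); apply: bendr_linear. Qed.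

Lemma hpos_surj i j k (g : hom (X k) (X i ** X j)) : exists x, hpos x = g.
Proof.
have [x xg] := bendr_surj (tensA (X i) (X j) (dual (X k))) g.
by exists x; rewrite hposE.
Qed.

Lemma hneg_surj i j k (g : hom (X i ** X j) (X k)) : exists y : Vneg X i j k, hneg y = g.
Proof.
have [x xg] := bendr_surj (wneg_bend i j k) g.
by exists x; rewrite (hnegE _ (wneg_bend i j k)).
Qed.

Lemma hpos_inj i j k : injective (@hpos i j k).
Proof. by move=> x x'; rewrite !hposE => /bendr_eqm_inj. Qed.

Lemma hneg_inj i j k : injective (@hneg i j k).
Proof. by move=> x x'; rewrite !(hnegE _ (wneg_bend i j k)) => /bendr_eqm_inj. Qed.

Section Bases.
Variables (i j k : G).

Lemma theta_linl (y : Vneg X i j k) : linear ((@theta F C G X i j k)^~ y : Vpos X i j k -> F^o).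
Proof. by move=> c f g; rewrite !theta_tr hpos_linear compDr compZr tr_linear. Qed.

Lemma theta_linr (x : Vpos X i j k) : linear (theta x : Vneg X i j k -> F^o).
Proof. by move=> c f g; rewrite !theta_tr hneg_linear compDl compZl tr_linear. Qed.

Lemma theta_ndl (x : Vpos X i j k) : (forall y, theta x y = 0) -> x = 0.
Proof.
move=> H; apply: hpos_inj; rewrite (lin0 (@hpos_linear _ _ _)).
apply: (tr_nondegl C_semisimple one_simple) => g; have [y <-] := hneg_surj g.
by rewrite -theta_tr.
Qed.

Lemma theta_ndr (y : Vneg X i j k) : (forall x, theta x y = 0) -> y = 0.
Proof.
move=> H; apply: hneg_inj; rewrite (lin0 (@hneg_linear _ _ _)).
apply: (tr_nondegr C_semisimple one_simple) => g; have [x <-] := hpos_surj g.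
by rewrite -theta_tr.
Qed.

Lemma bnegE (m : 'I_(ndim X i j k)) : bneg X i j k m = dbasis (@theta F C G X i j k) m.
Proof. by rewrite /bneg (nth_map m) ?size_enum_ord // nth_ord_enum. Qed.

Lemma dualfam_triangle : dualfam (fun m : 'I_(ndim X i j k) => hpos (bpos X i j k m))
  (fun m => hneg (bneg X i j k m)).
Proof.
split=> [g|h].
  have [x <-] := hpos_surj g.
  rewrite -[in RHS](dbasis_suml theta_linl theta_linr theta_ndl x).
  rewrite (lin_sum (@hpos_linear _ _ _)); apply: eq_bigr => m _.
  by rewrite (linZ (@hpos_linear _ _ _)) -theta_tr bnegE.
have [y <-] := hneg_surj h.
rewrite -[in RHS](dbasis_sumr theta_linl theta_linr theta_ndl theta_ndr y).
rewrite (lin_sum (@hneg_linear _ _ _)); apply: eq_bigr => m _.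
by rewrite (linZ (@hneg_linear _ _ _)) -theta_tr bnegE.
Qed.

(** The default 0 outside the range of the basis permits one common range of summation for all
    triangles. *)
Lemma bpos0 m : (ndim X i j k <= m)%N -> bpos X i j k m = 0.
Proof. by move=> le_m; rewrite /bpos nth_default // size_tuple. Qed.

Lemma bneg0 m : (ndim X i j k <= m)%N -> bneg X i j k m = 0.
Proof. by move=> le_m; rewrite /bneg nth_default // size_map size_enum_ord. Qed.

End Bases.
End Graphs.

(** * Contraction of the six tetrahedra *)

Section Contraction.
Variables (F : fieldType) (C : spherical F).
Hypothesis C_semisimple : semisimple C.
Hypothesis one_simple : simple_ob (@unit_ob F C).
Variables (G : finType) (X : G -> ob C).
Hypothesis X_repr : representatives (@simple_ob F C) (@isomorphic F C) X.
Local Notation d i := (dim_ob (X i)).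
Variable N : nat.
Hypothesis N_max : forall i j k, (ndim X i j k <= N)%N.
Local Notation "1" := (@unit_ob F C).

Definition tri_split i j k (m : nat) : hom (X k) (X i ** X j) := hpos (bpos X i j k m).
Definition tri_merge i j k (m : nat) : hom (X i ** X j) (X k) := hneg (bneg X i j k m).

Local Notation P := tri_split.
Local Notation Q := tri_merge.

Lemma tri_split_out i j k m : (ndim X i j k <= m)%N -> P i j k m = 0.
Proof. by move=> le_m; rewrite /tri_split bpos0 // (lin0 (@hpos_linear _ _ _ _ _ _ _)). Qed.

Lemma tri_merge_out i j k m : (ndim X i j k <= m)%N -> Q i j k m = 0.
Proof. by move=> le_m; rewrite /tri_merge bneg0 // (lin0 (@hneg_linear _ _ _ _ _ _ _)). Qed.

Lemma dualfam_N i j k : dualfam (fun m : 'I_N => P i j k m) (fun m : 'I_N => Q i j k m).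
Proof.
have [PQ1 PQ2] := dualfam_triangle one_simple X C_semisimple i j k.
split=> g.
  rewrite -[RHS]PQ1.
  rewrite (big_ord_widen N (fun m => tr (Q i j k m \oc g) *: P i j k m) (N_max i j k)).
  rewrite [RHS]big_mkcond; apply: eq_bigr => m _; case: ltnP => // le_m.
  by rewrite tri_split_out // scaler0.
rewrite -[RHS]PQ2.
rewrite (big_ord_widen N (fun m => tr (g \oc P i j k m) *: Q i j k m) (N_max i j k)).
rewrite [RHS]big_mkcond; apply: eq_bigr => m _; case: ltnP => // le_m.
by rewrite tri_merge_out // scaler0.
Qed.

(** Gluing along a face: summing over dual vectors of the face joins two traces into one. *)
Lemma contract (A B : ob C) (I : finType) (x : I -> hom A B) (y : I -> hom B A) (U : hom A B) (W : hom B A) :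
  dualfam x y -> \sum_m tr (y m \oc U) * tr (W \oc x m) = tr (W \oc U).
Proof.
case=> xy _; rewrite -[in RHS](xy U) comp_sumr tr_sum //.
by apply: eq_bigr => m _; rewrite compZr trZ.
Qed.

(** The square over an edge is cut by a diagonal of colour k into a splitting and a merging
    triangle. The weight d k of the diagonal is precisely what makes the products a dual family of
    the whole square. *)
Lemma dualfam_through i j i' j' : dualfam
  (fun t : G * 'I_N * 'I_N => P i j t.1.1 t.1.2 \oc Q i' j' t.1.1 t.2)
  (fun t : G * 'I_N * 'I_N => d t.1.1 *: (P i' j' t.1.1 t.2 \oc Q i j t.1.1 t.1.2)).
Proof.
have R := resolution C_semisimple one_simple X_repr (fun k => dualfam_N i j k).
apply: dualfam1 => // g.
rewrite -(pair_bigA _ (fun (t : G * 'I_N) (n : 'I_N) =>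
  tr (d t.1 *: (P i' j' t.1 n \oc Q i j t.1 t.2) \oc g) *: (P i j t.1 t.2 \oc Q i' j' t.1 n))) /=.
rewrite -(pair_bigA _ (fun (k : G) (m : 'I_N) => \sum_(n < N)
  tr (d k *: (P i' j' k n \oc Q i j k m) \oc g) *: (P i j k m \oc Q i' j' k n))) /=.
rewrite -[RHS]comp1m -R comp_suml; apply: eq_bigr => k _.
rewrite compZl comp_suml scaler_sumr; apply: eq_bigr => m _.
have [_ Q2] := dualfam_N i' j' k.
rewrite -compA -[in RHS](Q2 (Q i j k m \oc g)) comp_sumr scaler_sumr; apply: eq_bigr => n _.
by rewrite compZr scalerA compZl trZ // -compA trC // compA.
Qed.

Section Sum.
Variables (a b c a' b' c' : G) (m n m' n' : nat).

Let f : hom (X a ** X b) (X b ** X a) := P b a c n \oc Q a b c m.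
Let f' : hom (X b' ** X a') (X a' ** X b') := P a' b' c' m' \oc Q b' a' c' n'.

(* The six tetrahedra over the triangles true (t) and false (f).  The labels ah,
   bh, ch are those of the diagonals over a, b, c, and v that of the vertical edge;
   A, B, C index the vectors of the faces over a, b, c and D those of the diagonal
   faces, with 0 for the lower and 1 for the upper face. *)
Definition tet1t v ah ch A1 C1 D1 := tr (Q ah b' ch D1 \oc (Q v a' ah A1 *t idm (X b'))
  \oc eqm (tensA _ _ _) \oc (idm (X v) *t P a' b' c' m') \oc P v c' ch C1).
Definition tet2t v ah bh ch A0 B1 D0 D1 := tr (Q a bh ch D0 \oc (idm (X a) *t Q v b' bh B1)
  \oc eqm (esym (tensA _ _ _)) \oc (P a v ah A0 *t idm (X b')) \oc P ah b' ch D1).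
Definition tet3t v bh ch B0 C0 D0 := tr (Q c v ch C0 \oc (Q a b c m *t idm (X v))
  \oc eqm (tensA _ _ _) \oc (idm (X a) *t P b v bh B0) \oc P a bh ch D0).
Definition tet1f v bh ch B1 C1 D1 := tr (Q v c' ch C1 \oc (idm (X v) *t Q b' a' c' n')
  \oc eqm (esym (tensA _ _ _)) \oc (P v b' bh B1 *t idm (X a')) \oc P bh a' ch D1).
Definition tet2f v ah bh ch A1 B0 D0 D1 := tr (Q bh a' ch D1 \oc (Q b v bh B0 *t idm (X a'))
  \oc eqm (tensA _ _ _) \oc (idm (X b) *t P v a' ah A1) \oc P b ah ch D0).
Definition tet3f v ah ch A0 C0 D0 := tr (Q b ah ch D0 \oc (idm (X b) *t Q a v ah A0)
  \oc eqm (esym (tensA _ _ _)) \oc (P b a c n *t idm (X v)) \oc P c v ch C0).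

(* The sides of the two prisms over the triangles, with al, be the sides over a, b. *)
Definition prism_t v (al : hom (X v ** X a') (X a ** X v)) (be : hom (X v ** X b') (X b ** X v)) :
    hom (X v ** X c') (X c ** X v) :=
  (Q a b c m *t idm (X v)) \oc eqm (tensA _ _ _) \oc (idm (X a) *t be)
   \oc eqm (esym (tensA _ _ _)) \oc (al *t idm (X b')) \oc eqm (tensA _ _ _)
   \oc (idm (X v) *t P a' b' c' m').
Definition prism_f v (al' : hom (X a ** X v) (X v ** X a')) (be' : hom (X b ** X v) (X v ** X b')) :
    hom (X c ** X v) (X v ** X c') :=
  (idm (X v) *t Q b' a' c' n') \oc eqm (esym (tensA _ _ _)) \oc (be' *t idm (X a'))
   \oc eqm (tensA _ _ _) \oc (idm (X b) *t al') \oc eqm (esym (tensA _ _ _))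
   \oc (P b a c n *t idm (X v)).

(** Contracting the two diagonal faces stacks the three tetrahedra over a triangle into one
    prism. *)
Lemma sum_prism_t v ah bh ch A0 A1 B0 B1 C0 C1 :
  \sum_(D0 < N) \sum_(D1 < N) tet1t v ah ch A1 C1 D1 * tet2t v ah bh ch A0 B1 D0 D1
     * tet3t v bh ch B0 C0 D0
  = tr (Q c v ch C0 \oc prism_t (P a v ah A0 \oc Q v a' ah A1) (P b v bh B0 \oc Q v b' bh B1)
       \oc P v c' ch C1).
Proof.
transitivity (\sum_(D0 < N) tr (Q a bh ch D0 \oc ((idm (X a) *t Q v b' bh B1)
    \oc eqm (esym (tensA _ _ _)) \oc ((P a v ah A0 \oc Q v a' ah A1) *t idm (X b'))
  \oc eqm (tensA _ _ _) \oc (idm (X v) *t P a' b' c' m') \oc P v c' ch C1)) * tet3t v bh ch B0 C0 D0).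
  apply: eq_bigr => D0 _; rewrite -mulr_suml; congr (_ * _).
  rewrite /tet1t /tet2t; under eq_bigr do rewrite -!(compA (Q ah b' ch _)).
  rewrite contract; last exact: dualfam_N.
  by rewrite -tensm_idr !compA.
rewrite contract; last exact: dualfam_N.
by rewrite /prism_t -(tensm_idl (X a)) !compA.
Qed.

Lemma sum_prism_f v ah bh ch A0 A1 B0 B1 C0 C1 :
  \sum_(D0 < N) \sum_(D1 < N) tet1f v bh ch B1 C1 D1 * tet2f v ah bh ch A1 B0 D0 D1
     * tet3f v ah ch A0 C0 D0
  = tr (Q v c' ch C1 \oc prism_f (P v a' ah A1 \oc Q a v ah A0) (P v b' bh B1 \oc Q b v bh B0)
       \oc P c v ch C0).
Proof.
transitivity (\sum_(D0 < N) tr (Q b ah ch D0 \oc ((idm (X b) *t Q a v ah A0)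
  \oc eqm (esym (tensA _ _ _)) \oc (P b a c n *t idm (X v)) \oc P c v ch C0))
   * tr ((Q v c' ch C1 \oc (idm (X v) *t Q b' a' c' n')
  \oc eqm (esym (tensA _ _ _)) \oc ((P v b' bh B1 \oc Q b v bh B0) *t idm (X a'))
  \oc eqm (tensA _ _ _) \oc (idm (X b) *t P v a' ah A1)) \oc P b ah ch D0)).
  apply: eq_bigr => D0 _; rewrite -mulr_suml mulrC; congr (_ * _).
    by rewrite /tet3f !compA.
  rewrite /tet1f /tet2f; under eq_bigr do rewrite mulrC -!(compA (Q bh a' ch _)).
  rewrite contract; last exact: dualfam_N.
  by rewrite -tensm_idr !compA.
rewrite contract; last exact: dualfam_N.
by rewrite /prism_f -(tensm_idl (X b)) !compA.
Qed.

(** The two prisms share the square over c: C1 contracts one of its triangles, and C0 with the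
    colour ch forms a resolution of the identity of X_c ** X_v. *)
Lemma sum_prisms v ah bh A0 A1 B0 B1 :
  \sum_ch d ch * \sum_(C0 < N) \sum_(C1 < N)
     (\sum_(D0 < N) \sum_(D1 < N) tet1t v ah ch A1 C1 D1 * tet2t v ah bh ch A0 B1 D0 D1
     * tet3t v bh ch B0 C0 D0)
   * (\sum_(D0 < N) \sum_(D1 < N) tet1f v bh ch B1 C1 D1 * tet2f v ah bh ch A1 B0 D0 D1
     * tet3f v ah ch A0 C0 D0)
  = tr (prism_t (P a v ah A0 \oc Q v a' ah A1) (P b v bh B0 \oc Q v b' bh B1)
     \oc prism_f (P v a' ah A1 \oc Q a v ah A0) (P v b' bh B1 \oc Q b v bh B0)).
Proof.
set U := prism_t _ _; set W := prism_f _ _.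
have R := resolution C_semisimple one_simple X_repr (fun k => dualfam_N c v k).
rewrite -[U \oc W]compm1 -R comp_sumr tr_sum //; apply: eq_bigr => ch _.
rewrite compZr trZ //; congr (_ * _); rewrite comp_sumr tr_sum //.
apply: eq_bigr => C0 _.
rewrite (eq_bigr (fun C1 : 'I_N => tr (Q v c' ch C1 \oc (W \oc P c v ch C0))
    * tr ((Q c v ch C0 \oc U) \oc P v c' ch C1))); last first.
  by move=> C1 _; rewrite sum_prism_t sum_prism_f mulrC !compA.
rewrite contract; last exact: dualfam_N.
by rewrite -(compA (Q c v ch C0)) trC // !compA.
Qed.

(** Cyclicity of the trace brings the lower triangle vectors together as f; the upper ones already
    meet as f'. *)
Lemma prism_torus v al be al' be' :
  tr (@prism_t v al be \oc @prism_f v al' be') = torus_term f f' al al' be be'.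
Proof.
pose U := (idm (X a) *t be) \oc eqm (esym (tensA _ _ _)) \oc (al *t idm (X b'))
  \oc eqm (tensA _ _ _) \oc (idm (X v) *t f') \oc eqm (esym (tensA _ _ _))
  \oc (be' *t idm (X a')) \oc eqm (tensA _ _ _) \oc (idm (X b) *t al').
transitivity (tr ((f *t idm (X v)) \oc eqm (tensA _ _ _) \oc U \oc eqm (esym (tensA _ _ _)))).
  have -> : prism_t al be \oc prism_f al' be' = ((Q a b c m *t idm (X v)) \oc eqm (tensA _ _ _)
      \oc U \oc eqm (esym (tensA _ _ _))) \oc (P b a c n *t idm (X v)).
    by rewrite /prism_t /prism_f /U /f' -(tensm_idl (X v)) !compA.
  by rewrite trC // /f -tensm_idr !compA.
have e : ((X b ** X a) ** X v) ** 1 = X b ** (X a ** (X v ** 1)) by rewrite !tensA.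
transitivity (tr (eqm e \oc (((f *t idm (X v)) \oc eqm (tensA _ _ _) \oc U
    \oc eqm (esym (tensA _ _ _))) *t idm 1) \oc eqm (esym e))).
  by rewrite [RHS]trC // compA eqmK comp1m tr_tail1.
congr tr; rewrite !at22E /U; move: f f' => g g'; push_eqm.
by rewrite !tensm_rassoc !tensm_idm; push_eqm; match_eqm.
Qed.

End Sum.

Section Linear.
Variables (a b a' b' v : ob C) (f : hom (a ** b) (b ** a)) (f' : hom (b' ** a') (a' ** b')).

Lemma torus_term_al al' (be : hom (v ** b') (b ** v)) be' :
  linear (fun al => torus_term f f' al al' be be' : F^o).
Proof.
move=> c g h; rewrite /torus_term at22_linear !(compDr, compZr) !(compDl, compZl).
exact: tr_linear.
Qed.

Lemma torus_term_al' (al : hom (v ** a') (a ** v)) (be : hom (v ** b') (b ** v)) be' :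
  linear (fun al' => torus_term f f' al al' be be' : F^o).
Proof.
move=> c g h; rewrite /torus_term at22_linear !(tensDr, tensZr) !(compDr, compZr).
exact: tr_linear.
Qed.

Lemma torus_term_be (al : hom (v ** a') (a ** v)) al' (be' : hom (b ** v) (v ** b')) :
  linear (fun be => torus_term f f' al al' be be' : F^o).
Proof.
move=> c g h; rewrite /torus_term at22_linear !(tensDr, tensZr) !(compDr, compZr) !(compDl, compZl).
exact: tr_linear.
Qed.

Lemma torus_term_be' (al : hom (v ** a') (a ** v)) al' (be : hom (v ** b') (b ** v)) :
  linear (fun be' => torus_term f f' al al' be be' : F^o).
Proof.
move=> c g h; rewrite /torus_term at22_linear !(compDr, compZr) !(compDl, compZl).
exact: tr_linear.
Qed.

End Linear.

Lemma torus_form_through a b a' b' (f : hom (X a ** X b) (X b ** X a))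
    (f' : hom (X b' ** X a') (X a' ** X b')) :
  torus_form X f f' = \sum_v d v * \sum_(t : G * 'I_N * 'I_N) \sum_(u : G * 'I_N * 'I_N)
    d t.1.1 * d u.1.1 * torus_term f f'
     (P a v t.1.1 t.1.2 \oc Q v a' t.1.1 t.2) (P v a' t.1.1 t.2 \oc Q a v t.1.1 t.1.2)
     (P b v u.1.1 u.1.2 \oc Q v b' u.1.1 u.2) (P v b' u.1.1 u.2 \oc Q b v u.1.1 u.1.2).
Proof.
apply: eq_bigr => v _; congr (_ * _).
transitivity (\sum_m \sum_(u : G * 'I_N * 'I_N) torus_term f f'
     (@dualx _ _ (X v ** X a') (X a ** X v) m) (@dualy _ _ (X v ** X a') (X a ** X v) m)
     (P b v u.1.1 u.1.2 \oc Q v b' u.1.1 u.2)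
     (d u.1.1 *: (P v b' u.1.1 u.2 \oc Q b v u.1.1 u.1.2))).
  apply: eq_bigr => m _.
  apply: (dualfam_eq (V := F^o) one_simple (dualxyP C_semisimple one_simple _ _)
     (dualfam_through b v v b') (Psi := fun be be' => torus_term f f' (dualx m) (dualy m) be be')).
    by move=> g; apply: torus_term_be.
  by move=> g; apply: torus_term_be'.
rewrite exchange_big [RHS]exchange_big; apply: eq_bigr => u _ /=.
rewrite (dualfam_eq (V := F^o) one_simple (dualxyP C_semisimple one_simple _ _)
     (dualfam_through a v v a') (Psi := fun al al' => torus_term f f' al al'
       (P b v u.1.1 u.1.2 \oc Q v b' u.1.1 u.2)
       (d u.1.1 *: (P v b' u.1.1 u.2 \oc Q b v u.1.1 u.1.2)))).
- apply: eq_bigr => t _; rewrite (linZ (torus_term_al' _ _ _ _ _)).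
  by rewrite (linZ (torus_term_be' _ _ _ _ _)) scalerA.
- by move=> g; apply: torus_term_al.
by move=> g; apply: torus_term_al'.
Qed.

Lemma sum_pair (V : nmodType) (I J : finType) (H : I * J -> V) : \sum_t H t = \sum_i \sum_j H (i, j).
Proof. by rewrite (pair_bigA _ (fun i j => H (i, j))); apply: eq_bigr => [[i j]]. Qed.

Lemma sum_tets a b c a' b' c' m n m' n' :
  \sum_v \sum_(t : G * 'I_N * 'I_N) \sum_(u : G * 'I_N * 'I_N) \sum_(s : G * 'I_N * 'I_N)
   \sum_(e : 'I_N * 'I_N * ('I_N * 'I_N))
   (tet1t a' b' c' m' v t.1.1 s.1.1 t.2 s.2 e.1.2
    * tet2t a b' v t.1.1 u.1.1 s.1.1 t.1.2 u.2 e.1.1 e.1.2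
    * tet3t a b c m v u.1.1 s.1.1 u.1.2 s.1.2 e.1.1
    * (tet1f a' b' c' n' v u.1.1 s.1.1 u.2 s.2 e.2.2
      * tet2f b a' v t.1.1 u.1.1 s.1.1 t.2 u.1.2 e.2.1 e.2.2
      * tet3f a b c n v t.1.1 s.1.1 t.1.2 s.1.2 e.2.1)
    * (d v * d t.1.1 * d u.1.1 * d s.1.1))
  = torus_form X (P b a c n \oc Q a b c m) (P a' b' c' m' \oc Q b' a' c' n').
Proof.
rewrite torus_form_through; apply: eq_bigr => v _; rewrite mulr_sumr.
apply: eq_bigr => [[[ah A0] A1]] _; rewrite mulr_sumr; apply: eq_bigr => [[[bh B0] B1]] _ /=.
rewrite -prism_torus -sum_prisms !mulr_sumr sum_pair sum_pair; apply: eq_bigr => ch _.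
rewrite !mulr_sumr; apply: eq_bigr => C0 _ /=; rewrite !mulr_sumr; apply: eq_bigr => C1 _ /=.
rewrite sum_pair sum_pair big_distrl /= !mulr_sumr; apply: eq_bigr => D0 _ /=.
rewrite big_distrl /= !mulr_sumr; apply: eq_bigr => D1 _ /=.
rewrite sum_pair !mulr_sumr; apply: eq_bigr => E0 _ /=.
rewrite !mulr_sumr; apply: eq_bigr => E1 _ /=.
rewrite [RHS]mulrA [RHS]mulrA mulrC; congr (_ * _).
by rewrite !mulrA.
Qed.

End Contraction.

(** * The states of the prism over the torus *)

(** Here Y may exceed the image of g by points of weight zero. This trades states, whose face
    indices have label-dependent bounds, for tuples with indices in 'I_N. *)
Lemma sum_reindex_support (V : nmodType) (S Y : finType) (A : pred S) (g : S -> Y)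
    (w : S -> V) (w' : Y -> V) :
    {in A &, injective g} -> (forall s, A s -> w s = w' (g s)) ->
    (forall y, w' y != 0 -> exists2 s, A s & g s = y) ->
  \sum_(s | A s) w s = \sum_y w' y.
Proof.
move=> g_inj gw g_onto; rewrite (eq_bigr _ gw).
transitivity (\sum_(y in [set g s | s in A]) w' y); first by rewrite big_imset.
rewrite [RHS](bigID (mem [set g s | s in A])) /= [X in _ + X]big1 ?addr0 // => y yA.
apply: contraNeq yA => /g_onto[s As <-].
by apply/imsetP; exists s.
Qed.

Lemma prod_ord3 (R : comPzSemiRingType) (f : 'I_3 -> R) : \prod_e f e = f o0 * f o1 * f o2.
Proof.
rewrite !big_ord_recl big_ord0 mulr1 mulrA.
by congr (f _ * f _ * f _); apply: val_inj.
Qed.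

Lemma ord3_ind (Pr : 'I_3 -> Prop) : Pr o0 -> Pr o1 -> Pr o2 -> forall e, Pr e.
Proof.
move=> P0 P1 P2 [[|[|[|//]]] lt3].
- by rewrite (_ : Ordinal lt3 = o0) //; apply: val_inj.
- by rewrite (_ : Ordinal lt3 = o1) //; apply: val_inj.
by rewrite (_ : Ordinal lt3 = o2) //; apply: val_inj.
Qed.

Local Notation thor := (@hor torus).
Local Notation tdia := (@dia torus).
Local Notation tver := (@ver torus).
Local Notation thorf := (@horf torus).
Local Notation tdiaf := (@diaf torus).
Local Notation tverf := (@verf torus).

Lemma prod_tet3 (R : comPzSemiRingType) (f : ptet torus -> R) :
  \prod_t f t = f (inl (inl true)) * f (inl (inr true)) * f (inr true)
    * (f (inl (inl false)) * f (inl (inr false)) * f (inr false)).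
Proof.
rewrite !big_sumType !big_bool /=.
by rewrite (mulrACA (f _)) (mulrACA (f _ * f _)).
Qed.

Lemma prod_pedge (R : comPzSemiRingType) (f : pedge torus -> R) :
  \prod_(e | e \notin codom (thor false)) f e
  = f (thor true o0) * f (thor true o1) * f (thor true o2)
    * (f (tver tt) * (f (tdia o0) * f (tdia o1) * f (tdia o2))).
Proof.
have codomE (e : pedge torus) :
    (e \notin codom (thor false)) = (if e is inl (inl (false, _)) then false else true).
  apply/idP/idP => [|He].
    by apply: contraNT; case: e => [[[[] e]|e]|[]] // _; apply: codom_f.
  by apply/negP => /codomP[e0 e_e0]; rewrite e_e0 in He.
rewrite (eq_bigl _ f codomE) !big_sumType /= big_mkcond /=.
rewrite (eq_bigr (fun p : bool * 'I_3 => if p.1 then f (thor p.1 p.2) else 1)); last by case=> [[] e].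
rewrite -(pair_bigA _ (fun b e => if b then f (thor b e) else 1)) /= big_bool /=.
rewrite (big1 _ _ (fun=> 1%R)) // mulr1 !prod_ord3 (big_pred1 tt); last by case.
by rewrite -mulrA; congr (_ * _); rewrite mulrC.
Qed.

Definition at3 (V : Type) (x0 x1 x2 : V) (e : 'I_3) : V :=
  match val e with 0 => x0 | 1 => x1 | _ => x2 end.

Section States.
Variables (F : fieldType) (C : spherical F).
Hypothesis C_semisimple : semisimple C.
Hypothesis one_simple : simple_ob (@unit_ob F C).
Variables (G : finType) (X : G -> ob C).
Hypothesis X_repr : representatives (@simple_ob F C) (@isomorphic F C) X.
Local Notation d i := (dim_ob (X i)).
Variable N : nat.
Hypothesis N_max : forall i j k, (ndim X i j k <= N)%N.
Local Notation P := (tri_split X).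
Local Notation Q := (tri_merge X).

Definition face (K : delta_complex) (s : state X K) (f : tri K) : nat := tagged s f.

Lemma state_eq (K : delta_complex) (s s' : state X K) : tag s =1 tag s' ->
  (forall f, tagged s f = tagged s' f :> nat) -> s = s'.
Proof.
case: s s' => [l k] [l' k'] /= ll' kk'.
have ell' : l = l' by apply/ffunP.
case: l' / ell' {ll'} k' kk' => k' kk'; congr existT.
by apply/ffunP => f; apply: ord_inj; apply: kk'.
Qed.

Lemma tet_weightE (T : surface) (W : cobordism T) (s : state X W) (t : tet W) :
  tet_weight s t =
  let l := tag s in
  let k f : nat := tagged s f in
  let l01 := l (e01 (f012 t)) in
  let l02 := l (e02 (f012 t)) in
  let l03 := l (e02 (f013 t)) in
  let l12 := l (e12 (f012 t)) in
  let l13 := l (e12 (f013 t)) in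
  let l23 := l (e12 (f023 t)) in
  if tsgn t then
    tr (Q l02 l23 l03 (k (f023 t)) \oc (Q l01 l12 l02 (k (f012 t)) *t idm (X l23))
      \oc eqm (tensA _ _ _) \oc (idm (X l01) *t P l12 l23 l13 (k (f123 t)))
      \oc P l01 l13 l03 (k (f013 t)))
  else
    tr (Q l01 l13 l03 (k (f013 t)) \oc (idm (X l01) *t Q l12 l23 l13 (k (f123 t)))
      \oc eqm (esym (tensA _ _ _)) \oc (P l01 l12 l02 (k (f012 t)) *t idm (X l23))
      \oc P l02 l23 l03 (k (f023 t))).
Proof.
by rewrite /tet_weight; case: (tsgn t); rewrite ?(tetra_posP one_simple) ?(tetra_negP one_simple).
Qed.

Lemma prod_tets (s : state X (prism torus)) :
  let l := tag s in let k f : nat := tagged s f in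
  let a := l (thor false o0) in
  let b := l (thor false o1) in
  let c := l (thor false o2) in
  let a' := l (thor true o0) in
  let b' := l (thor true o1) in
  let c' := l (thor true o2) in
  let v := l (tver tt) in
  let ah := l (tdia o0) in
  let bh := l (tdia o1) in
  let ch := l (tdia o2) in
  let A i := k (tverf i o0) in
  let B i := k (tverf i o1) in
  let C i := k (tverf i o2) in
  let D i := k (tdiaf i true) in
  let E i := k (tdiaf i false) in
  let m i := k (thorf i true) in
  let n i := k (thorf i false) in
  \prod_(t : tet (prism torus)) tet_weight s t =
   (tet1t X a' b' c' (m true) v ah ch (A true) (C true) (D true)
    * tet2t X a b' v ah bh ch (A false) (B true) (D false) (D true)
    * tet3t X a b c (m false) v bh ch (B false) (C false) (D false)
    * (tet1f X a' b' c' (n true) v bh ch (B true) (C true) (E true)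
      * tet2f X b a' v ah bh ch (A true) (B false) (E false) (E true)
      * tet3f X a b c (n false) v ah ch (A false) (C false) (E false))).
Proof.
move=> l k a b c a' b' c' v ah bh ch A B C0 D E m n; rewrite (prod_tet3 (tet_weight s)).
congr (_ * _ * _ * (_ * _ * _)); exact: tet_weightE.
Qed.

Lemma prod_edges (s : state X (prism torus)) : let l := tag s in
  \prod_(e : edge (prism torus) | e \notin codom (on_edge (bot (prism torus)))) d (tag s e)
  = d (l (thor true o0)) * d (l (thor true o1)) * d (l (thor true o2))
    * (d (l (tver tt)) * d (l (tdia o0)) * d (l (tdia o1))
       * d (l (tdia o2))).
Proof. by move=> l; rewrite (prod_pedge (fun e => d (tag s e))) !mulrA. Qed.

Lemma prod_verts : \prod_(v : vert (prism torus) | v \notin codom (on_vert (bot (prism torus))))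
   (dim_cat X)^-1 = (dim_cat X)^-1.
Proof.
rewrite (big_pred1 (true, tt)) // => -[b []] /=.
rewrite xpair_eqE andbT; case: b => /=.
  by apply/negP => /codomP[[]].
by rewrite codom_f.
Qed.

(** Vectors beyond the basis are zero, so a nonzero weight forces the padded indices into range.
    Together the five bounds cover all ten interior faces, and so turn a tuple of nonzero weight
    into a state. *)
Lemma bound1t a' b' c' m' v ah ch A1 C1 D1 : tet1t X a' b' c' m' v ah ch A1 C1 D1 != 0 ->
  [/\ A1 < ndim X v a' ah, C1 < ndim X v c' ch & D1 < ndim X ah b' ch]%N.
Proof.
move=> nz; split; rewrite ltnNge; apply: contra nz => le_m; rewrite /tet1t.
all: by rewrite ?(tri_split_out le_m) ?(tri_merge_out le_m) ?(tens0l, tens0r, comp0l, comp0r) tr0.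
Qed.

Lemma bound2t a b' v ah bh ch A0 B1 D0 D1 : tet2t X a b' v ah bh ch A0 B1 D0 D1 != 0 ->
  ((A0 < ndim X a v ah) /\ (B1 < ndim X v b' bh))%N.
Proof.
move=> nz; split; rewrite ltnNge; apply: contra nz => le_m; rewrite /tet2t.
all: by rewrite ?(tri_split_out le_m) ?(tri_merge_out le_m) ?(tens0l, tens0r, comp0l, comp0r) tr0.
Qed.

Lemma bound3t a b c m v bh ch B0 C0 D0 : tet3t X a b c m v bh ch B0 C0 D0 != 0 ->
  [/\ B0 < ndim X b v bh, C0 < ndim X c v ch & D0 < ndim X a bh ch]%N.
Proof.
move=> nz; split; rewrite ltnNge; apply: contra nz => le_m; rewrite /tet3t.
all: by rewrite ?(tri_split_out le_m) ?(tri_merge_out le_m) ?(tens0l, tens0r, comp0l, comp0r) tr0.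
Qed.

Lemma bound1f a' b' c' n' v bh ch B1 C1 E1 : tet1f X a' b' c' n' v bh ch B1 C1 E1 != 0 ->
  (E1 < ndim X bh a' ch)%N.
Proof.
move=> nz; rewrite ltnNge; apply: contra nz => le_m; rewrite /tet1f.
all: by rewrite ?(tri_split_out le_m) ?(tri_merge_out le_m) ?(tens0l, tens0r, comp0l, comp0r) tr0.
Qed.

Lemma bound3f a b c n v ah ch A0 C0 E0 : tet3f X a b c n v ah ch A0 C0 E0 != 0 ->
  (E0 < ndim X b ah ch)%N.
Proof.
move=> nz; rewrite ltnNge; apply: contra nz => le_m; rewrite /tet3f.
all: by rewrite ?(tri_split_out le_m) ?(tri_merge_out le_m) ?(tens0l, tens0r, comp0l, comp0r) tr0.
Qed.

Section TorusSum.
Variables r0 r1 : state X torus.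
Local Notation a := (tag r0 o0).
Local Notation b := (tag r0 o1).
Local Notation c := (tag r0 o2).
Local Notation a' := (tag r1 o0).
Local Notation b' := (tag r1 o1).
Local Notation c' := (tag r1 o2).
Local Notation m := (face r0 true).
Local Notation n := (face r0 false).
Local Notation m' := (face r1 true).
Local Notation n' := (face r1 false).

Let Y : finType := (G * (G * 'I_N * 'I_N) * (G * 'I_N * 'I_N) * (G * 'I_N * 'I_N)
  * ('I_N * 'I_N * ('I_N * 'I_N)))%type.

Let term_at (a b c a' b' c' : G) (m n m' n' : nat) (y : Y) : F := let: (v, t, u, s, e) := y in
  tet1t X a' b' c' m' v t.1.1 s.1.1 t.2 s.2 e.1.2
    * tet2t X a b' v t.1.1 u.1.1 s.1.1 t.1.2 u.2 e.1.1 e.1.2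
    * tet3t X a b c m v u.1.1 s.1.1 u.1.2 s.1.2 e.1.1
    * (tet1f X a' b' c' n' v u.1.1 s.1.1 u.2 s.2 e.2.2
      * tet2f X b a' v t.1.1 u.1.1 s.1.1 t.2 u.1.2 e.2.1 e.2.2
      * tet3f X a b c n v t.1.1 s.1.1 t.1.2 s.1.2 e.2.1)
    * (d v * d t.1.1 * d u.1.1 * d s.1.1).

Let term : Y -> F := term_at a b c a' b' c' m n m' n'.

Let idx (s : state X (prism torus)) (f : ptri torus) : 'I_N :=
  widen_ord (N_max _ _ _) (tagged s f).

(** What the boundary states leave undetermined: the colours of the vertical and diagonal edges and
    the indices of the interior faces, widened to 'I_N. *)
Let free (s : state X (prism torus)) : Y :=
  (tag s (tver tt), (tag s (tdia o0), idx s (tverf false o0), idx s (tverf true o0)),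
   (tag s (tdia o1), idx s (tverf false o1), idx s (tverf true o1)),
   (tag s (tdia o2), idx s (tverf false o2), idx s (tverf true o2)),
   (idx s (tdiaf false true), idx s (tdiaf true true),
     (idx s (tdiaf false false), idx s (tdiaf true false)))).

Let bounded (s : state X (prism torus)) : bool :=
  restricts (top (prism torus)) s r1 && restricts (bot (prism torus)) s r0.

Let boundedP (s : state X (prism torus)) : reflect ((forall i e, tag s (thor i e) = tag (if i then r1 else r0) e)
  /\ forall i f, @face (prism torus) s (thorf i f) = face (if i then r1 else r0) f) (bounded s).
Proof.
apply: (iffP andP) => [[/andP[/forallP e1 /forallP f1] /andP[/forallP e0 /forallP f0]]|[He Hf]].
  split=> [] [] e; apply/eqP; [exact: e1|exact: e0|exact: f1|exact: f0].
by split; apply/andP; split; apply/forallP => e; apply/eqP;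
  [exact: (He true)|exact: (Hf true)|exact: (He false)|exact: (Hf false)].
Qed.

Let free_inj : {in bounded &, injective free}.
Proof.
move=> s s' /boundedP[es fs] /boundedP[es' fs'] ss'.
apply: state_eq => [[[[i e]|e]|[]]|[[[i f]|[i f]]|[i e]]].
- exact: etrans (es i e) (esym (es' i e)).
- move: e; apply: ord3_ind.
  + exact: (congr1 (fun y : Y => y.1.1.1.2.1.1) ss').
  + exact: (congr1 (fun y : Y => y.1.1.2.1.1) ss').
  exact: (congr1 (fun y : Y => y.1.2.1.1) ss').
- exact: (congr1 (fun y : Y => y.1.1.1.1) ss').
- exact: etrans (fs i f) (esym (fs' i f)).
- case: i f => [] [].
  + exact: (congr1 (fun y : Y => val y.2.1.2) ss').
  + exact: (congr1 (fun y : Y => val y.2.2.2) ss').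
  + exact: (congr1 (fun y : Y => val y.2.1.1) ss').
  exact: (congr1 (fun y : Y => val y.2.2.1) ss').
move: e; apply: ord3_ind; case: i.
- exact: (congr1 (fun y : Y => val y.1.1.1.2.2) ss').
- exact: (congr1 (fun y : Y => val y.1.1.1.2.1.2) ss').
- exact: (congr1 (fun y : Y => val y.1.1.2.2) ss').
- exact: (congr1 (fun y : Y => val y.1.1.2.1.2) ss').
- exact: (congr1 (fun y : Y => val y.1.2.2) ss').
exact: (congr1 (fun y : Y => val y.1.2.1.2) ss').
Qed.

Let weightE (s : state X (prism torus)) (l := tag s) (k := @face (prism torus) s) : state_weight s =
  (dim_cat X)^-1 * (d (l (thor true o0)) * d (l (thor true o1)) * d (l (thor true o2)))
   * term_at (l (thor false o0)) (l (thor false o1)) (l (thor false o2))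
      (l (thor true o0)) (l (thor true o1)) (l (thor true o2))
      (k (thorf false true)) (k (thorf false false)) (k (thorf true true)) (k (thorf true false))
      (free s).
Proof.
have ac (x y z t : F) : x * (y * z) * t = t * y * (x * z).
  by rewrite (mulrC _ t) -!mulrA (mulrCA x).
rewrite /state_weight prod_verts prod_edges prod_tets ac; reflexivity.
Qed.

Let free_weight s : bounded s ->
  state_weight s = (dim_cat X)^-1 * (d a' * d b' * d c') * term (free s).
Proof.
move=> /boundedP[es fs]; rewrite weightE.
congr (_ * (d _ * d _ * d _) * term_at _ _ _ _ _ _ _ _ _ _ _).
all: first [exact: (es true) | exact: (es false) | exact: (fs true) | exact: (fs false)].
Qed.

Let free_onto y : term y != 0 -> exists2 s, bounded s & free s = y.
Proof.
case: y => [[[[v [[ah A0] A1]] [[bh B0] B1]] [[ch C0] C1]] [[D0 D1] [E0 E1]]].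
rewrite /term /= mulf_eq0 negb_or => /andP[+ _]; rewrite !mulf_eq0 !negb_or.
case/andP=> /andP[/andP[/bound1t[A1_lt C1_lt D1_lt] /bound2t[A0_lt B1_lt]] /bound3t[B0_lt C0_lt D0_lt]].
case/andP=> /andP[/bound1f E1_lt _] /bound3f E0_lt.
pose lab (x : pedge torus) : G := match x with
  | inl (inl (i, e)) => tag (if i then r1 else r0) e
  | inl (inr e) => at3 ah bh ch e
  | inr _ => v
  end.
pose ix (x : ptri torus) : nat := match x with
  | inl (inl (i, f)) => face (if i then r1 else r0) f
  | inl (inr (i, f)) => if f then (if i then D1 else D0) else (if i then E1 else E0)
  | inr (i, e) => if i then at3 A1 B1 C1 e else at3 A0 B0 C0 e
  end.
pose lf : labelling G (prism torus) := [ffun x => lab x].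
have ix_lt (f : tri (prism torus)) : (ix f < fdim X lf f)%N.
  rewrite /fdim !ffunE; case: f => [[[i f]|[i f]]|[i e]].
  - by case: i f => [] []; apply: ltn_ord.
  - by case: i f => [] [].
  by move: e; apply: ord3_ind; case: i.
pose s : state X (prism torus) := existT _ lf [ffun f => Ordinal (ix_lt f)].
have sE (e : edge (prism torus)) : tag s e = lab e by rewrite /= ffunE.
have sF (f : tri (prism torus)) : tagged s f = ix f :> nat by rewrite /= ffunE.
exists s.
  by apply/boundedP; split=> i e; [exact: sE|exact: sF].
by rewrite /free !sE; congr (_, (_, _, _), (_, _, _), (_, _, _), (_, _, (_, _)));
  apply: val_inj; apply: sF.
Qed.

Lemma state_sum :
  \sum_(s : state X (prism torus) | restricts (top (prism torus)) s r1
      && restricts (bot (prism torus)) s r0) state_weight s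
  = (dim_cat X)^-1 * (d a' * d b' * d c')
    * torus_form X (P b a c n \oc Q a b c m) (P a' b' c' m' \oc Q b' a' c' n').
Proof.
rewrite (sum_reindex_support (w' := fun y => (dim_cat X)^-1 * (d a' * d b' * d c') * term y)
  free_inj free_weight); last first.
  by move=> y; rewrite mulf_eq0 negb_or => /andP[_ /free_onto].
rewrite -mulr_sumr; congr (_ * _).
rewrite [LHS]sum_pair [LHS]sum_pair [LHS]sum_pair [LHS]sum_pair.
exact: (sum_tets C_semisimple one_simple X_repr N_max).
Qed.
End TorusSum.

End States.

(** * Characters and the kernel of the projector *)

Section Characters.
Variables (F : closedFieldType) (C : spherical F).
Hypothesis C_semisimple : semisimple C.
Hypothesis one_simple : simple_ob (@unit_ob F C).
Variables (G : finType) (X : G -> ob C).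
Hypothesis X_repr : representatives (@simple_ob F C) (@isomorphic F C) X.
Hypothesis dim_neq0 : dim_cat X != 0.
Local Notation d i := (dim_ob (X i)).
Local Notation S := (state X torus).
Local Notation P := (tri_split X).
Local Notation Q := (tri_merge X).
Implicit Types (z : center_ob C).

Let N : nat := \max_(t : G * G * G) ndim X t.1.1 t.1.2 t.2.

Let N_max i j k : (ndim X i j k <= N)%N.
Proof. exact: (@leq_bigmax _ (fun t : G * G * G => ndim X t.1.1 t.1.2 t.2) (i, j, k)). Qed.

Definition bot_vec (r : S) : hom (X (tag r o0) ** X (tag r o1)) (X (tag r o1) ** X (tag r o0)) :=
  P (tag r o1) (tag r o0) (tag r o2) (face r false) \oc Q (tag r o0) (tag r o1) (tag r o2) (face r true).
Definition top_vec (r : S) : hom (X (tag r o1) ** X (tag r o0)) (X (tag r o0) ** X (tag r o1)) :=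
  P (tag r o0) (tag r o1) (tag r o2) (face r true) \oc Q (tag r o1) (tag r o0) (tag r o2) (face r false).
(** The three edges and the single vertex of the top torus. *)
Definition weight (r : S) : F := (dim_cat X)^-1 * (d (tag r o0) * d (tag r o1) * d (tag r o2)).

Lemma weight_neq0 r : weight r != 0.
Proof. by rewrite !mulf_neq0 ?invr_neq0 // (d_neq0 C_semisimple one_simple X_repr). Qed.

Lemma cobordism_mapE (v : Vsurf X torus) r0 :
  cobordism_map (prism torus) v r0 = \sum_r1 weight r1 * torus_form X (bot_vec r0) (top_vec r1) * v r1.
Proof.
rewrite ffunE; apply: eq_bigr => r1 _; congr (_ * _).
by rewrite (state_sum C_semisimple one_simple X_repr N_max).
Qed.

Lemma state_exists a b c m n : (m < ndim X a b c)%N -> (n < ndim X b a c)%N ->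
  exists r : S, [/\ tag r o0 = a, tag r o1 = b, tag r o2 = c, face r true = m & face r false = n].
Proof.
move=> lt_m lt_n; pose l : labelling G torus := [ffun e => at3 a b c e].
have lt (f : tri torus) : ((if f then m else n) < fdim X l f)%N.
  by rewrite /fdim !ffunE; case: f.
pose r : S := existT _ l [ffun f => Ordinal (lt f)].
exists r; split; by rewrite /face /= ffunE.
Qed.

(** Each g expands through the intermediate colour c into products P Q. A product with both indices
    in range is the bottom vector of some state, and the others are zero. *)
Lemma bot_span (L : forall a b, hom (X a ** X b) (X b ** X a) -> F^o) : (forall a b, linear (@L a b)) ->
  (forall r, L _ _ (bot_vec r) = 0) -> forall a b g, L a b g = 0.
Proof.
move=> linL L0 a b g.
have [D _] := dualfam_through C_semisimple one_simple X_repr N_max b a a b.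
rewrite -[g]D (lin_sum (@linL a b)) big1 // => -[[c n] m] _ /=; rewrite (linZ (@linL a b)).
suff -> : L a b (P b a c n \oc Q a b c m) = 0 by rewrite scaler0.
case: (ltnP m (ndim X a b c)) => [lt_m|?]; last by rewrite tri_merge_out // comp0r (lin0 (@linL a b)).
case: (ltnP n (ndim X b a c)) => [lt_n|?]; last by rewrite tri_split_out // comp0l (lin0 (@linL a b)).
have [r [ra rb rc rm rn]] := state_exists lt_m lt_n.
by have := L0 r; rewrite /bot_vec ra rb rc rm rn.
Qed.

Lemma top_span (L : forall a b, hom (X b ** X a) (X a ** X b) -> F^o) : (forall a b, linear (@L a b)) ->
  (forall r, L _ _ (top_vec r) = 0) -> forall a b g, L a b g = 0.
Proof.
move=> linL L0 a b g.
have [D _] := dualfam_through C_semisimple one_simple X_repr N_max a b b a.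
rewrite -[g]D (lin_sum (@linL a b)) big1 // => -[[c m] n] _ /=; rewrite (linZ (@linL a b)).
suff -> : L a b (P a b c m \oc Q b a c n) = 0 by rewrite scaler0.
case: (ltnP m (ndim X a b c)) => [lt_m|?]; last by rewrite tri_split_out // comp0l (lin0 (@linL a b)).
case: (ltnP n (ndim X b a c)) => [lt_n|?]; last by rewrite tri_merge_out // comp0r (lin0 (@linL a b)).
have [r [ra rb rc rm rn]] := state_exists lt_m lt_n.
by have := L0 r; rewrite /top_vec ra rb rc rm rn.
Qed.

Lemma center_simple_scalar z (t : hom (cob z) (cob z)) :
  center_simple z -> center_mor t -> exists c, t = c *: idm _.
Proof. by move=> sz /sz[c [tc _]]; exists c. Qed.

(** Provides s and r with tr (s \oc r) = d a, which is nonzero. *)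
Lemma center_simple_retract z : center_simple z ->
  exists a (s : hom (X a) (cob z)) (r : hom (cob z) (X a)), r \oc s = idm (X a).
Proof.
move=> sz; have [S [s [r [sS rs]]]] := neq0_simple C_semisimple (center_simple_neq0 sz).
have [_ _ ex] := X_repr; have [a [u [v [vu uv]]]] := ex _ sS.
exists a, (s \oc v), (u \oc r).
by rewrite compm1 in rs; rewrite -!compA [r \oc _]compA rs comp1m uv.
Qed.

(** Compare traces. In particular c is nonzero as soon as tr t is. *)
Lemma average_scalar z (t : hom (cob z) (cob z)) : center_simple z ->
  exists2 c, average X t = c *: idm _ & c * dim_ob (cob z) = dim_cat X * tr t.
Proof.
move=> sz; have tm := average_mor C_semisimple one_simple X_repr t.
have [c tc] := center_simple_scalar sz tm.
exists c => //; rewrite -(tr_average one_simple X t) tc trZ // tr_id.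
done.
Qed.

Definition char_val z (r : S) : F :=
  tr (top_vec r \oc character z (X (tag r o0)) (X (tag r o1))).

(** Composing s and t with an isomorphism in the center changes neither the pulled morphisms nor the
    scalar c, so both characters are computed by the same torus forms. *)
Lemma char_val_iso z z' r : center_simple z -> center_isomorphic z z' -> char_val z r = char_val z' r.
Proof.
move=> sz [f [g [fm gm gf fg]]].
have [a [s [t ts]]] := center_simple_retract sz.
have [c st cd] := average_scalar (s \oc t) sz.
have c0 : c != 0.
  apply: contraTneq isT => c0; move/eqP: cd; rewrite c0 mul0r eq_sym mulf_eq0 (negPf dim_neq0) /=.
  by rewrite trC // ts tr_id (negPf (d_neq0 C_semisimple one_simple X_repr _)).
apply: (mulfI c0); rewrite /char_val.
rewrite -(torus_form_pull C_semisimple one_simple X_repr _ st).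
have st' : average X ((f \oc s) \oc (t \oc g)) = c *: idm (cob z').
  have -> : (f \oc s) \oc (t \oc g) = f \oc (s \oc t \oc g) by rewrite !compA.
  rewrite (average_compl X) // (average_compr X) // st compZl comp1m compZr fg.
  done.
rewrite -(torus_form_pull C_semisimple one_simple X_repr _ st').
suff e b : pull (X b) s t = pull (X b) (f \oc s) (t \oc g) by apply: eq_bigr => b _; rewrite e.
rewrite /pull -[idm (X b) *t (t \oc g)]tensm_idl -tensm_idr.
rewrite -!compA [hb z' _ \oc _]compA -fm -!compA; congr (_ \oc _).
by rewrite [RHS]compA tensm_idl gf tensm_idm comp1m.
Qed.

(** Test the relation on [push] for a retract X_a of Z i. The averages from Z i to any other Z j
    vanish by Schur's lemma, which isolates c i. *)
Lemma char_val_free k (Z : 'I_k -> center_ob C) (c : 'I_k -> F) :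
  (forall i, center_simple (Z i)) -> (forall i j, center_isomorphic (Z i) (Z j) -> i = j) ->
  (forall r, \sum_i c i * char_val (Z i) r = 0) -> forall i, c i = 0.
Proof.
move=> sZ Zinj Z0 i.
have Z00 := top_span (L := fun a b g => \sum_j c j * tr (g \oc character (Z j) (X a) (X b))) _ Z0.
have {Z00} Z0 a b g : \sum_j c j * tr (g \oc character (Z j) (X a) (X b)) = 0.
  apply: Z00 => a' b' e x y; rewrite scaler_sumr -big_split; apply: eq_bigr => j _ /=.
  by rewrite compDl compZl tr_linear // mulrDr scalerAr.
have [a [s [t ts]]] := center_simple_retract (sZ i).
have : \sum_b d b * (\sum_j c j * tr (push (X b) s t \oc character (Z j) (X a) (X b))) = 0.
  by apply: big1 => b _; rewrite Z0 mulr0.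
have -> : \sum_b d b * (\sum_j c j * tr (push (X b) s t \oc character (Z j) (X a) (X b)))
  = \sum_j c j * \sum_b d b * tr (push (X b) s t \oc character (Z j) (X a) (X b)).
  under eq_bigr do rewrite mulr_sumr; rewrite exchange_big; apply: eq_bigr => j _ /=.
  by rewrite mulr_sumr; apply: eq_bigr => b _; rewrite mulrCA.
rewrite (bigD1 i) //= [X in _ + X]big1 ?addr0 => [|j ji].
  move/eqP; rewrite mulf_eq0 => /orP[/eqP//|/eqP].
  rewrite character_push // => H.
  suff : dim_cat X * d a = 0 by move/eqP; rewrite mulf_eq0 (negPf dim_neq0)
    (negPf (d_neq0 C_semisimple one_simple X_repr _)).
  (* The factor dim_ob (cob (Z i)) turns each scalar l into dim_cat times a trace; the sum over o
     then reassembles t and leaves dim_cat tr (t s). *)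
  transitivity (0 * dim_ob (cob (Z i))); last by rewrite mul0r.
  rewrite -H [RHS]mulr_suml; have [D _] := dualxyP C_semisimple one_simple (cob (Z i)) (X a).
  have -> : d a = tr (t \oc s) by rewrite ts tr_id.
  rewrite -[t in tr (t \oc s)]D comp_suml tr_sum // [LHS]mulr_sumr; apply: eq_bigr => o _.
  have [l -> ld] := average_scalar (dualy o \oc t) (sZ i).
  by rewrite compZl compZr compm1 trZ // compZl trZ // mulrAC ld -mulrA.
rewrite character_push // big1 ?mulr0 // => o _.
suff -> : average X (dualy o \oc t) = 0 by rewrite comp0r comp0l tr0.
apply: NNPP => t0; case/eqP: ji; apply/esym/Zinj.
by apply: (center_schur C_semisimple one_simple X_repr dim_neq0 _ _ _ t0) => //; apply: average_mor.
Qed.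

Lemma torus_form_linear a b a' b' (f' : hom (b' ** a') (a' ** b')) :
  linear (fun f : hom (a ** b) (b ** a) => torus_form X f f' : F^o).
Proof.
move=> e f g; rewrite /torus_form scaler_sumr -big_split; apply: eq_bigr => v _ /=.
rewrite scalerAr -mulrDr scaler_sumr -big_split; congr (_ * _); apply: eq_bigr => m _ /=.
rewrite scaler_sumr -big_split; apply: eq_bigr => n _ /=.
by rewrite /torus_term at22_linear !compDl !compZl tr_linear.
Qed.

(** * The kernel of the projector is the common kernel of the characters *)

Section Kernel.
Variable v : S -> F.

Definition top_form a b (f : hom (X a ** X b) (X b ** X a)) : F :=
  \sum_r weight r * torus_form X f (top_vec r) * v r.

Lemma top_form_linear a b : linear (@top_form a b : _ -> F^o).
Proof.
move=> e f g; rewrite /top_form scaler_sumr -big_split; apply: eq_bigr => r _ /=.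
rewrite torus_form_linear mulrDr mulrDl; congr (_ + _).
transitivity (weight r * (e * torus_form X f (top_vec r)) * v r) => //.
by rewrite mulrCA -[LHS]mulrA.
Qed.

Lemma top_form_pull z a (s : hom (X a) (cob z)) (t : hom (cob z) (X a)) c :
  average X (s \oc t) = c *: idm _ ->
  \sum_b d b * top_form (pull (X b) s t) = c * \sum_r weight r * char_val z r * v r.
Proof.
move=> st; under eq_bigr do rewrite mulr_sumr.
rewrite exchange_big mulr_sumr; apply: eq_bigr => r _ /=.
transitivity (weight r * v r * \sum_b d b * torus_form X (pull (X b) s t) (top_vec r)).
  by rewrite mulr_sumr; apply: eq_bigr => b _; rewrite [RHS]mulrCA (mulrAC (weight r)).
rewrite (torus_form_pull C_semisimple one_simple X_repr _ st) -/(char_val z r).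
by rewrite mulrCA (mulrAC (weight r)).
Qed.

Lemma kernel_char : (forall r, top_form (bot_vec r) = 0) ->
  forall z, center_simple z -> \sum_r weight r * char_val z r * v r = 0.
Proof.
move=> /(bot_span top_form_linear) v0 z sz.
have [a [s [t ts]]] := center_simple_retract sz.
have [c st cd] := average_scalar (s \oc t) sz.
have := top_form_pull st; rewrite big1 => [/esym/eqP|b _]; last by rewrite v0 mulr0.
rewrite mulf_eq0 => /orP[/eqP c0|/eqP//]; move/eqP: cd.
rewrite c0 mul0r eq_sym mulf_eq0 (negPf dim_neq0) /= trC // ts tr_id.
by rewrite (negPf (d_neq0 C_semisimple one_simple X_repr _)).
Qed.

Lemma char_kernel : (forall z, center_simple z -> \sum_r weight r * char_val z r * v r = 0) ->
  forall a b (g : hom (X a ** X b) (X b ** X a)), top_form g = 0.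
Proof.
move=> v0 a b.
(* Direct sums are indexed by ordinals, so the colours are enumerated before inducing. *)
have X'_repr : representatives (@simple_ob F C) (@isomorphic F C) (X \o @enum_val G predT).
  have [sX injX exX] := X_repr; split=> [i|i j /injX/enum_val_inj //|o /exX[k ok]] /=; first exact: sX.
  by exists (enum_rank k); rewrite /= enum_rankK.
rewrite -(enum_rankK b); move: (enum_rank b) => l g.
have [z [s [t [stg st0]]]] := half_braiding_realize C_semisimple one_simple X'_repr g.
(* The extra endomorphism h makes the expression linear in the identity of z, so that
   [center_semisimple] reduces it to summands i \oc p through simple objects. *)
pose T (h : hom (cob z) (cob z)) := \sum_b' d b' * top_form (pull (X b') (h \oc s) t).
have T_lin : linear (T : _ -> F^o).
  move=> e h h'; rewrite /T scaler_sumr -big_split; apply: eq_bigr => b' _ /=.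
  rewrite /pull compDl compZl tensDl tensZl compDr compZr top_form_linear.
  by rewrite mulrDr scalerAr.
have : T (idm _) = 0.
  apply: (center_semisimple C_semisimple one_simple X_repr dim_neq0 (P := fun h => T h = 0)).
  - exact: (lin0 T_lin).
  - by move=> h h' h0 h'0; rewrite (linD T_lin) h0 h'0 addr0.
  move=> y i p sy im pm; have [c st _] := average_scalar ((p \oc s) \oc (t \oc i)) sy.
  transitivity (c * \sum_r weight r * char_val y r * v r); last by rewrite v0 ?mulr0.
  rewrite -(top_form_pull st); apply: eq_bigr => b' _; congr (_ * top_form _).
  rewrite /pull -[idm _ *t (t \oc i)]tensm_idl -[in RHS](compA (idm _ *t t)) im.
  by rewrite -!compA tensm_idr !compA.
rewrite /T (bigD1 (enum_val l)) //= big1 ?addr0 => [/eqP|b' b'l].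
  rewrite mulf_eq0 (negPf (d_neq0 C_semisimple one_simple X_repr _)) comp1m /pull => /eqP.
  by rewrite stg.
rewrite comp1m -(enum_rankK b') [pull _ _ _]st0 ?(lin0 (@top_form_linear _ _)) ?mulr0 //.
by apply: contraNneq b'l => <-; rewrite enum_rankK.
Qed.

End Kernel.
End Characters.

(** * The dimension of the state space *)

Lemma maximal_nat (Pr : nat -> Prop) B : Pr 0%N -> (forall k, Pr k -> (k <= B)%N) ->
  exists2 k, Pr k & ~ Pr k.+1.
Proof.
move=> P0 P_le; apply: NNPP => H.
have PS k : Pr k by elim: k => // k Pk; apply: NNPP => nPk; apply: H; exists k.
by have := P_le _ (PS B.+1); rewrite ltnn.
Qed.

(** Rank is the codimension of the kernel, and k independent functionals map onto K^k. *)
Lemma dim_limg_functionals (K : fieldType) (S : finType) (k : nat) (f : 'End({ffun S -> K^o}))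
    (A : 'I_k -> S -> K) :
  (forall c : 'I_k -> K, (forall r, \sum_i c i * A i r = 0) -> forall i, c i = 0) ->
  (forall v, f v = 0 <-> forall i, \sum_r A i r * v r = 0) ->
  \dim (limg f) = k.
Proof.
move=> A_free kerf; pose phi (v : {ffun S -> K^o}) : 'rV[K]_k := \row_i \sum_r A i r * v r.
have phi_lin : linear phi.
  move=> c u v; apply/rowP => i; rewrite !mxE mulr_sumr -big_split; apply: eq_bigr => r _ /=.
  by rewrite !ffunE mulrDr; congr (_ + _); rewrite -[LHS]/(_ * (_ * _)) mulrCA.
pose L := GRing.isLinear.Build K _ _ _ phi phi_lin.
pose phi' : {linear {ffun S -> K^o} -> 'rV[K]_k} := HB.pack phi L.
have phiE v : linfun phi' v = phi v by rewrite lfunE.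
have ker : lker f = lker (linfun phi').
  apply/vspaceP => v; rewrite !memv_ker phiE; apply/eqP/eqP => [/kerf H|H].
    by apply/rowP => i; rewrite !mxE.
  by apply/kerf => i; have /rowP/(_ i) := H; rewrite !mxE.
have surj : limg (linfun phi') = fullv.
  apply/vspaceP => u; rewrite memvf.
  pose AM : 'M[K]_(k, #|S|) := \matrix_(i, j) A i (enum_val j).
  have free : row_free AM.
    apply/inj_row_free => w wA; apply/rowP => i; rewrite mxE.
    apply: (A_free (fun i => w 0 i)) => r.
    have /rowP/(_ (enum_rank r)) := wA; rewrite mxE [RHS]mxE => wr; rewrite -[RHS]wr; apply: eq_bigr => j _.
    by rewrite mxE enum_rankK.
  have [B AB] := row_freeP free.
  pose v : {ffun S -> K^o} := [ffun r => (B *m u^T) (enum_rank r) 0].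
  have -> : u = linfun phi' v; last exact: memv_img (memvf v).
  rewrite phiE; apply/rowP => i; rewrite mxE.
  have -> : u 0 i = (AM *m (B *m u^T)) i 0 by rewrite mulmxA AB mul1mx mxE.
  rewrite mxE (reindex_onto enum_rank enum_val) => [|j _]; last exact: enum_valK.
  apply: eq_big => [r|r _]; first by rewrite enum_rankK eqxx.
  by rewrite mxE ffunE enum_rankK.
have := etrans (limg_ker_dim f fullv) (esym (limg_ker_dim (linfun phi') fullv)).
by rewrite ker surj => /addnI ->; rewrite dimvf /dim /= mul1n.
Qed.

Section Count.
Variables (F : closedFieldType) (C : spherical F).
Hypothesis C_semisimple : semisimple C.
Hypothesis one_simple : simple_ob (@unit_ob F C).
Variables (G : finType) (X : G -> ob C).
Hypothesis X_repr : representatives (@simple_ob F C) (@isomorphic F C) X.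
Hypothesis dim_neq0 : dim_cat X != 0.
Local Notation S := (state X torus).

Let distinct_simples k := exists Z : 'I_k -> center_ob C,
  (forall i, center_simple (Z i)) /\ (forall i j, center_isomorphic (Z i) (Z j) -> i = j).

(** The characters are k independent row vectors indexed by the states. *)
Lemma distinct_simples_bound k : distinct_simples k -> (k <= #|S|)%N.
Proof.
case=> Z [sZ Zinj]; pose AM : 'M[F]_(k, #|S|) := \matrix_(i, j) char_val (X := X) (Z i) (enum_val j).
suff /eqP <- : row_free AM by apply: rank_leq_col.
apply/inj_row_free => w wA; apply/rowP => i; rewrite mxE.
apply: (char_val_free C_semisimple one_simple X_repr dim_neq0 sZ Zinj (c := w 0)) => r.
have /rowP/(_ (enum_rank r)) := wA; rewrite mxE [RHS]mxE => wr; rewrite -[RHS]wr; apply: eq_bigr => j _.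
by rewrite mxE enum_rankK.
Qed.

(** Choose k maximal among lists of pairwise non-isomorphic simple objects; a simple object
    isomorphic to none of them would extend the list. *)
Lemma center_representatives : exists k (Z : 'I_k -> center_ob C),
  representatives (@center_simple F C) (@center_isomorphic F C) Z.
Proof.
have [|k [Z [sZ Zinj]] max] := maximal_nat _ distinct_simples_bound.
  by exists (fun i : 'I_0 => match i with Ordinal _ lt => False_rect _ (notF lt) end); split=> -[].
exists k, Z; split=> // o so; apply: NNPP => no; apply: max.
exists (fun i => if unlift ord0 i is Some j then Z j else o); split=> [i|i j].
  by case: unliftP.
case: unliftP => [i' ->|->]; case: unliftP => [j' ->|->] //.
- by move/Zinj => ->.
- by move/center_isomorphic_sym => H; case: no; exists i'.
by move=> H; case: no; exists j'.
Qed.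

Lemma projectorE (v : Vsurf X torus) : projector X torus v = cobordism_map (prism torus) v.
Proof.
pose L := GRing.isLinear.Build F (Vsurf X torus) (Vsurf X torus) _ _
  (@cobordism_map_linear F C G X torus (prism torus)).
pose f : {linear Vsurf X torus -> Vsurf X torus} :=
  HB.pack (@cobordism_map F C G X torus (prism torus)) L.
exact: (lfunE f).
Qed.

Lemma dim_torus k (Z : 'I_k -> center_ob C) :
  representatives (@center_simple F C) (@center_isomorphic F C) Z ->
  \dim (state_space X torus) = k.
Proof.
case=> sZ Zinj Zex.
apply: (@dim_limg_functionals F S k _ (fun i r => weight r * char_val (X := X) (Z i) r)).
  move=> c c0; apply: (char_val_free C_semisimple one_simple X_repr dim_neq0 sZ Zinj) => r.
  apply: (mulfI (weight_neq0 C_semisimple one_simple X_repr dim_neq0 r)).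
  by rewrite mulr0 -[RHS](c0 r) mulr_sumr; apply: eq_bigr => i _; rewrite mulrCA.
move=> v; rewrite projectorE; split=> [/ffunP v0 i|v0].
  apply: (kernel_char C_semisimple one_simple X_repr dim_neq0) => // r.
  by have := v0 r; rewrite (cobordism_mapE C_semisimple one_simple X_repr) [RHS]ffunE.
apply/ffunP => r; rewrite (cobordism_mapE C_semisimple one_simple X_repr) [RHS]ffunE.
apply: (char_kernel C_semisimple one_simple X_repr dim_neq0 (v := v)) => z sz.
have [i zi] := Zex z sz; rewrite -[RHS](v0 i); apply: eq_bigr => r' _.
by rewrite (char_val_iso C_semisimple one_simple X_repr dim_neq0 _ sz zi).
Qed.

End Count.

Theorem proposition8p3 (F : closedFieldType) (C : spherical F)
    (C_semisimple : semisimple C) (one_simple : simple_ob (@unit_ob F C))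
    (G : finType) (X : G -> ob C)
    (X_repr : representatives (@simple_ob F C) (@isomorphic F C) X)
    (dim_neq0 : dim_cat X != 0) :
  number_simples_center C (\dim (state_space X torus)).
Proof.
have [k [Z Z_repr]] := center_representatives C_semisimple one_simple X_repr dim_neq0.
by rewrite (dim_torus C_semisimple one_simple X_repr dim_neq0 Z_repr); exists Z.
Qed.
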